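(* Let $\Omega\subset\mathbb{R}^n$ be a domain and let $p:\Omega\to\mathbb{R}$ be Lipschitz continuous with $1<p^-\le p(x)\le p^+<\infty$. Let $a<0$ be a constant. Assume that $u,v\in W^{1,p(\cdot)}(\Omega)$ are weak solutions, respectively, of $$-\Delta_{p(\cdot)}u=a|u|^{p(\cdot)-2}u+f\ \text{ in }\Omega,\qquad u=g\ \text{ on }\partial\Omega,$$ and $$-\Delta_{p(\cdot)}v=a|v|^{p(\cdot)-2}v+f'\ \text{ in }\Omega,\qquad v=g'\ \text{ on }\partial\Omega,$$ where $f,f'\in L^{p'(\cdot)}(\Omega)$ with $f\le f'$ a.e. and $g\le g'$ in $\Omega$. Then $u\le v$ a.e. in $\Omega$.
   Context: $\Delta_{p(\cdot)}u:=\nabla\cdot(|\nabla u|^{p(x)-2}\nabla u)$, $p'(x)=p(x)/(p(x)-1)$. $W^{1,p(\cdot)}(\Omega)$ and $L^{p'(\cdot)}(\Omega)$ are the variable exponent Sobolev and Lebesgue spaces, and $W^{1,p(\cdot)}_0(\Omega)$ is the closure of $C_c^\infty(\Omega)$ in $W^{1,p(\cdot)}(\Omega)$. Here $g,g'\in W^{1,p(\cdot)}(\Omega)$, the boundary condition $u=g$ on $\partial\Omega$ means $u-g\in W_0^{1,p(\cdot)}(\Omega)$ (similarly for $v$ and $g'$), and $u$ is a weak solution of $-\Delta_{p(\cdot)}u=a|u|^{p(\cdot)-2}u+f$ if $\int_\Omega|\nabla u|^{p(x)-2}\langle\nabla u,\nabla\psi\rangle\,dx=\int_\Omega\big(a|u|^{p(x)-2}u+f\big)\psi\,dx$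 for all $\psi\in W_0^{1,p(\cdot)}(\Omega)$ (similarly for $v$ with $f'$). *)

(* Defs.v *)
From HB Require Import structures.
From mathcomp Require Import all_boot all_order all_algebra.
From mathcomp Require Import all_classical all_reals all_analysis.
Set Implicit Arguments.
Unset Strict Implicit.
Unset Printing Implicit Defensive.
Import Order.TTheory GRing.Theory Num.Theory.
Import numFieldNormedType.Exports.
Local Open Scope classical_set_scope.
Local Open Scope ring_scope.

Definition measure_rV_display : measure_display -> measure_display.
Proof. exact. Qed.

(* Row vectors carry the sigma-algebra generated by the coordinates, as
   n.-tuple T does in the library; for T a realType it is the Borel
   sigma-algebra of R^n. *)
Section measurable_rV.
Context {d} {T : measurableType d}.
Variable n : nat.

Let coors : 'I_n -> 'rV[T]_n -> T := fun i x => x ord0 i.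

Let rV_set0 : g_sigma_preimage coors set0.
Proof. exact: sigma_algebra0. Qed.

Let rV_setC A : g_sigma_preimage coors A -> g_sigma_preimage coors (~` A).
Proof. exact: sigma_algebraC. Qed.

Let rV_bigcup (F : _^nat) : (forall i, g_sigma_preimage coors (F i)) ->
  g_sigma_preimage coors (\bigcup_i (F i)).
Proof. exact: sigma_algebra_bigcup. Qed.

HB.instance Definition _ := @isMeasurable.Build (measure_rV_display d)
  ('rV[T]_n) (g_sigma_preimage coors) rV_set0 rV_setC rV_bigcup.

End measurable_rV.

Lemma measurable_coord d (T : measurableType d) n (i : 'I_n) :
  measurable_fun [set: 'rV[T]_n] (fun x : 'rV[T]_n => x ord0 i).
Proof.
move=> _ Y mY; rewrite setTI; apply: sub_sigma_algebra => /=.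
rewrite -bigcup_seq/=; exists i => /=; first by rewrite mem_index_enum.
by exists Y => //; rewrite setTI.
Qed.

Lemma measurable_fun_coordP d1 d2 (T1 : measurableType d1)
    (T2 : measurableType d2) n (f : T1 -> 'rV[T2]_n) :
  (forall i, measurable_fun [set: T1] (fun x => f x ord0 i)) ->
  measurable_fun [set: T1] f.
Proof.
move=> mf.
suff : preimage_set_system setT f (g_sigma_preimage (fun i (x : 'rV[T2]_n) => x ord0 i))
    `<=` measurable.
  by move=> h _ A mA; apply: h; exists A.
case: n f mf => [|n] f mf.
  rewrite -g_sigma_preimageE big_ord0 preimage_set_system0.
  by apply: smallest_sub => //; exact: sigma_algebra_measurable.
rewrite -g_sigma_preimage_comp; apply: smallest_sub;
  first exact: sigma_algebra_measurable.
rewrite -bigcup_mkord_ord; apply: bigcup_sub => i Ii.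
by move=> A [B mB <-]; exact: mf.
Qed.

Section lebesgue_rV.
Context {R : realType}.

Definition rV_cons n (x : measurableTypeR R * 'rV[R]_n) : 'rV[R]_n.+1 :=
  \row_i oapp (fun j => x.2 ord0 j) x.1 (unlift ord0 i).

Definition rV_uncons n (x : 'rV[R]_n.+1) : measurableTypeR R * 'rV[R]_n :=
  (x ord0 ord0, \row_j x ord0 (lift ord0 j)).

Lemma rV_consK n : cancel (@rV_cons n) (@rV_uncons n).
Proof.
move=> [a v]; rewrite /rV_uncons /rV_cons !mxE unlift_none /=; congr pair.
by apply/rowP => j; rewrite !mxE liftK.
Qed.

Lemma rV_unconsK n : cancel (@rV_uncons n) (@rV_cons n).
Proof.
move=> x; apply/rowP => i; rewrite mxE.
by case: unliftP => [j|] -> /=; rewrite ?mxE.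
Qed.

Lemma measurable_rV_cons n : measurable_fun setT (@rV_cons n).
Proof.
apply: measurable_fun_coordP => i.
under eq_fun do rewrite mxE.
case: (unlift ord0 i) => [j|] /=; last exact: measurable_fst.
exact: (measurableT_comp (measurable_coord j) measurable_snd).
Qed.

Lemma measurable_rV_uncons n : measurable_fun setT (@rV_uncons n).
Proof.
apply: measurable_fun_pair; first exact: measurable_coord.
apply: measurable_fun_coordP => j.
under eq_fun do rewrite mxE.
exact: measurable_coord.
Qed.

Section step.
Variables (n : nat) (mu : {sigma_finite_measure set 'rV[R]_n -> \bar R}).

Definition lebesgue_rV_step : set 'rV[R]_n.+1 -> \bar R :=
  pushforward (lebesgue_measure \x mu)%E (@rV_cons n).

Let step0 : lebesgue_rV_step set0 = 0%E.
Proof. by rewrite /lebesgue_rV_step /pushforward preimage_set0 measure0. Qed.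

Let step_ge0 A : (0 <= lebesgue_rV_step A)%E.
Proof. by rewrite /lebesgue_rV_step /pushforward measure_ge0. Qed.

Let step_sigma_additive : semi_sigma_additive lebesgue_rV_step.
Proof.
have mpre A : measurable A -> measurable (@rV_cons n @^-1` A).
  by move=> mA; rewrite -[X in measurable X]setTI; exact: measurable_rV_cons.
move=> F mF tF mUF; rewrite /lebesgue_rV_step /pushforward preimage_bigcup.
apply: measure_semi_sigma_additive.
- by move=> k; exact: mpre.
- apply/trivIsetP => /= i j _ _ ij; rewrite -preimage_setI.
  by move/trivIsetP : tF => /(_ _ _ _ _ ij) ->//; rewrite preimage_set0.
- by rewrite -preimage_bigcup; exact: mpre.
Qed.

HB.instance Definition _ :=
  isMeasure.Build _ _ _ lebesgue_rV_step step0 step_ge0 step_sigma_additive.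

Let step_sigma_finite : sigma_finite setT lebesgue_rV_step.
Proof.
have /sigma_finiteP[F [TF ndF Foo]] := sigma_finiteT (@lebesgue_measure R).
have /sigma_finiteP[G [TG ndG Goo]] := sigma_finiteT mu.
exists (fun k => @rV_uncons n @^-1` (F k `*` G k)).
  rewrite -preimage_bigcup (_ : \bigcup_k _ = setT) ?preimage_setT//.
  rewrite -setXTT TF TG predeqE => -[x y]; split.
    by move=> [k _ []/= ? ?]; split; exists k.
  move=> [/= [k _ Fkx] [l _ Gly]]; exists (maxn k l) => //; split.
  - by move: x Fkx; exact/subsetPset/ndF/leq_maxl.
  - by move: y Gly; exact/subsetPset/ndG/leq_maxr.
move=> k; have [mF Fk] := Foo k; have [mG Gk] := Goo k; split.
  rewrite -[X in measurable X]setTI; apply: measurable_rV_uncons => //.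
  exact: measurableX.
rewrite /lebesgue_rV_step /pushforward -comp_preimage.
rewrite (_ : _ \o _ = id) ?preimage_id; last first.
  by apply/funext => x /=; rewrite rV_consK.
by rewrite product_measure1E// lte_mul_pinfty// ge0_fin_numE.
Qed.

HB.instance Definition _ :=
  Measure_isSigmaFinite.Build _ _ _ lebesgue_rV_step step_sigma_finite.

End step.

(* Lebesgue measure on R^n, as the n-fold product of one-dimensional Lebesgue
   measures (see lebesgue_rV_box). *)
Fixpoint lebesgue_rV n : {sigma_finite_measure set 'rV[R]_n -> \bar R} :=
  match n return {sigma_finite_measure set 'rV[R]_n -> \bar R} with
  | 0 => \d_(0 : 'rV[R]_0)
  | n'.+1 => lebesgue_rV_step (lebesgue_rV n')
  end.

Lemma lebesgue_rV_box n (A : 'I_n -> set R) : (forall i, measurable (A i)) ->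
  lebesgue_rV n [set x : 'rV[R]_n | forall i, A i (x ord0 i)] =
  (\prod_(i < n) lebesgue_measure (A i))%E.
Proof.
elim: n A => [|n IH] A mA.
  by rewrite big_ord0 /= diracE mem_set// => -[].
rewrite big_ord_recl -IH//= /lebesgue_rV_step /pushforward.
have mB : measurable [set x : 'rV[R]_n | forall i, A (lift ord0 i) (x ord0 i)].
  rewrite (_ : mkset _ = \bigcap_(i in [set: 'I_n])
      ((fun x : 'rV[R]_n => x ord0 i) @^-1` A (lift ord0 i))); last first.
    by apply/seteqP; split => x /= h i; [move=> _|]; exact: h.
  apply: fin_bigcap_measurable => //.
  move=> i _; rewrite -[X in measurable X]setTI.
  exact: (measurable_coord (T:=R)).
rewrite -(product_measure1E lebesgue_measure (lebesgue_rV n) (mA ord0) mB).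
congr (_ _).
apply/seteqP; split => -[a v] /=.
  move=> h; split => /=; first by have := h ord0; rewrite mxE unlift_none.
  by move=> i; have := h (lift ord0 i); rewrite mxE liftK.
by move=> [h1 h2] i; rewrite mxE; case: unliftP => [j|] -> /=.
Qed.

End lebesgue_rV.

(* Functions on an open set Om are total functions on R^n of which only the
   values on Om are used. *)
Section variable_exponent.
Context {R : realType} {n : nat}.
Implicit Types (Om : set 'rV[R]_n) (p f u : 'rV[R]_n -> R)
  (G : 'rV[R]_n -> 'rV[R]_n).

(* The library's norm `|x| on 'rV[R]_n is the maximum norm. *)
Definition dot (x y : 'rV[R]_n) : R := \sum_i x ord0 i * y ord0 i.
Definition enorm (x : 'rV[R]_n) : R := Num.sqrt (dot x x).

Definition domain Om := [/\ open Om, connected Om & Om !=set0].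

Definition lipschitz_continuous_in Om p := exists L : R,
  forall x y, Om x -> Om y -> `|p x - p y| <= L * enorm (x - y).

Definition exponent_inf Om p : \bar R := ereal_inf [set (p x)%:E | x in Om].
Definition exponent_sup Om p : \bar R := ereal_sup [set (p x)%:E | x in Om].
Definition conjugate_exponent p : 'rV[R]_n -> R := fun x => p x / (p x - 1).

Definition modular Om p f : \bar R :=
  (\int[lebesgue_rV n]_(x in Om) (`|f x| `^ p x)%:E)%E.

Definition variable_Lebesgue Om p f := measurable_fun Om f /\
  exists2 l : R, 0 < l & (modular Om p (fun x => (f x / l)%R) < +oo)%E.

Definition luxemburg_norm Om p f : \bar R := ereal_inf
  [set l%:E | l in [set l : R | 0 < l /\
    (modular Om p (fun x => (f x / l)%R) <= 1)%E]].

Definition partial (i : 'I_n) (f : 'rV[R]_n -> R) : 'rV[R]_n -> R :=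
  fun x => 'D_(delta_mx ord0 i) f x.

Definition gradient (f : 'rV[R]_n -> R) : 'rV[R]_n -> 'rV[R]_n :=
  fun x => \row_i partial i f x.

(* C^infinity on R^n: every iterated partial derivative exists everywhere and
   is continuous. *)
Definition smooth (f : 'rV[R]_n -> R) := forall s : seq 'I_n,
  continuous (foldr partial f s) /\
  forall i x, derivable (foldr partial f s) x (delta_mx ord0 i).

(* Elements of C_c^infinity(Om), extended by 0 to R^n. *)
Definition test_function Om (phi : 'rV[R]_n -> R) :=
  let supp := closure [set x | phi x != 0] in
  [/\ smooth phi, compact supp & supp `<=` Om].

Definition loc_integrable Om f := measurable_fun Om f /\
  forall K, compact K -> K `<=` Om ->
    (lebesgue_rV n).-integrable K (EFin \o f).

(* Distributional derivatives are unique up to a.e. equality, so it is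
   immaterial below whether G is quantified existentially or universally. *)
Definition weak_gradient Om u G := loc_integrable Om u /\
  forall i, loc_integrable Om (fun x => G x ord0 i) /\
    forall phi, test_function Om phi ->
      \int[lebesgue_rV n]_(x in Om) (u x * partial i phi x) =
      - \int[lebesgue_rV n]_(x in Om) (G x ord0 i * phi x).

Definition variable_Sobolev Om p u := variable_Lebesgue Om p u /\
  exists2 G, weak_gradient Om u G & variable_Lebesgue Om p (enorm \o G).

(* G stands for the weak gradient of u. *)
Definition Sobolev_norm Om p u G : \bar R :=
  (luxemburg_norm Om p u + luxemburg_norm Om p (enorm \o G))%E.

(* Closure of C_c^infinity(Om) in W^{1,p(.)}(Om); the weak gradient of
   u - phi is G - gradient phi. *)
Definition variable_Sobolev0 Om p u := variable_Sobolev Om p u /\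
  exists2 G, weak_gradient Om u G &
    forall e : R, 0 < e -> exists2 phi, test_function Om phi &
      (Sobolev_norm Om p (fun x => u x - phi x)%R
        (fun x => G x - gradient phi x)%R < e%:E)%E.

(* Since 0 `^ r = 0 for every r != 0, the products |xi|^{p-2} xi and
   |t|^{p-2} t vanish at 0 also when p < 2. *)
Definition weak_solution Om p (a : R) f u := variable_Sobolev Om p u /\
  forall Du psi Dpsi, weak_gradient Om u Du ->
    variable_Sobolev0 Om p psi -> weak_gradient Om psi Dpsi ->
    \int[lebesgue_rV n]_(x in Om)
      (enorm (Du x) `^ (p x - 2) * dot (Du x) (Dpsi x)) =
    \int[lebesgue_rV n]_(x in Om)
      ((a * `|u x| `^ (p x - 2) * u x + f x) * psi x).

End variable_exponent.

(* Main.v *)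
(* Test both equations with psi = H(u - v), where H(t) = exp(-1/t) for t > 0 and
   H(t) = 0 otherwise. Subtracting, the left-hand sides differ by the integral of
   H'(u - v) times <|Du|^(p-2) Du - |Dv|^(p-2) Dv, Du - Dv>, which is nonnegative,
   while the right-hand sides differ by the integral of
   (a (|u|^(p-2) u - |v|^(p-2) v) + f - f') H(u - v), whose integrand is nonpositive
   and negative wherever u > v because a < 0. Both integrals vanish, so u <= v a.e.

   That psi lies in W_0^{1,p(.)} is the hard part: u - v = w + h with w in
   W_0^{1,p(.)} and h = g - g' <= 0. With phi a test function close to w and eta a
   mollifier, H(phi + eta * h) is a test function, and it converges to psi in the
   modular. This rests on the convergence of eta * h to h in the modular, which
   follows from the Lipschitz continuity of p: at scale eps the values of the
   mollified function are O(eps^-n), so replacing p(y) by p(x) within distance eps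
   costs a factor of at most O(eps^-n)^(L eps), which is bounded. *)

Require Import Defs.
From HB Require Import structures.
From mathcomp Require Import all_boot all_order all_algebra.
From mathcomp Require Import all_classical all_reals all_analysis.
From mathcomp Require Import measurable_realfun.
From mathcomp Require Import ring lra.
Set Implicit Arguments.
Unset Strict Implicit.
Unset Printing Implicit Defensive.
Import Order.TTheory GRing.Theory Num.Theory.
Import numFieldNormedType.Exports.
Local Open Scope classical_set_scope.
Local Open Scope ring_scope.

(** * Lebesgue measure on R^n *)

(** [H] is smooth, rather than the positive part, because W_0 is a closure of smooth functions:
    composed with [phi + he], where [he] mollifies h, it gives an element of C_c^infinity at once,
    and bounds on H' and H'' replace the chain rule for weak derivatives of truncations. The
    delicate term is H'(w + h)(W + K), with W, K the gradients of w, h: closeness of the arguments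
    of H' gets multiplied by an unbounded gradient. It is split at a level M of the gradient; above
    M it is small in the modular, below M the Lipschitz bound of H' suffices. Hence M is fixed
    before phi, and phi before the scale eps. The mollification of h matters only on the support of
    phi, so h is set to zero outside Om and outside a ball, which keeps the boundary of Om out of
    the argument. Estimates are made in the modular: for p <= P it satisfies a triangle inequality
    up to the factor 3^P, and its smallness is equivalent to that of the norm. In the modular
    convergence of eta * h, only the part of h above a high level needs the Lipschitz bound on p;
    the bounded part converges already in L^1, by continuity of translations, which is reduced to
    level sets. *)

Section rV_space.
Context {R : realType} {n : nat}.
Implicit Types (x y z : 'rV[R]_n) (D : set 'rV[R]_n).
Local Notation mu := (@lebesgue_rV R n).

Lemma rV_norm_leP x (e : R) : 0 <= e ->
  (`|x| <= e) <-> (forall i, `|x ord0 i| <= e).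
Proof.
move=> e0; rewrite [in X in X <-> _]/Num.norm /= mx_normrE; split=> [/bigmax_leP[_ h] i|h].
  exact: (h (ord0, i)).
by apply/bigmax_leP; split=> // -[j i] _ /=; rewrite (ord1 j).
Qed.

Lemma le_coord_norm x i : `|x ord0 i| <= `|x|.
Proof. exact: (rV_norm_leP x (normr_ge0 x)).1. Qed.

(** The sigma-algebra is generated by the coordinates, so openness has to enter through a countable
    union: [D] is the union of the cubes with rational centre and half-side [1 / (k + 1)] that it
    contains, enumerated by [unpickle]. *)
Lemma open_rV_measurable D : open D -> measurable D.
Proof.
move=> oD.
pose B (q : 'rV[rat]_n * nat) := [set x : 'rV[R]_n |
  forall i, `|x ord0 i - ratr (q.1 ord0 i)| < q.2.+1%:R^-1].
have mB q : measurable (B q).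
  rewrite (_ : B q = \bigcap_(i in [set: 'I_n])
      ((fun x : 'rV[R]_n => x ord0 i) @^-1`
         ball (ratr (q.1 ord0 i) : R) q.2.+1%:R^-1)); last first.
    apply/seteqP; split => x /= h i; last first.
      by have := h i I; rewrite -ball_normE /ball_ /= distrC.
    by move=> _; rewrite /= -ball_normE /ball_ /= distrC; exact: h.
  apply: fin_bigcap_measurable => // i _; rewrite -[X in measurable X]setTI.
  by apply: (measurable_coord (T:=measurableTypeR R) i) => //; apply: open_measurable; exact: ball_open.
rewrite (_ : D = \bigcup_k (if @unpickle ('rV[rat]_n * nat)%type k is Some q
   then (if `[< B q `<=` D >] then B q else set0) else set0)); last first.
  apply/seteqP; split=> [x Dx|x [k _]]; last first.
    by case: unpickle => // q; case: ifPn => // /asboolP h /h.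
  have /nbhs_ballP[e /= e0 xeD] : nbhs x D by exact: open_nbhs_nbhs.
  have [k ke] : exists k : nat, k.+1%:R^-1 < e / 2.
    have [k _ /(_ k (leqnn k)) hk] := near_infty_natSinv_lt (PosNum (divr_gt0 e0 (ltr0Sn _ 1))).
    by exists k.
  have q_ i : exists q : rat, `|x ord0 i - ratr q| < k.+1%:R^-1.
    have := @rat_in_itvoo R (x ord0 i - k.+1%:R^-1) (x ord0 i + k.+1%:R^-1).
    have k0 : 0 < k.+1%:R^-1 :> R by rewrite invr_gt0.
    case; first by rewrite ltrBlDr -addrA ltrDl addr_gt0.
    move=> q; rewrite in_itv/= => /andP[h1 h2]; exists q.
    by rewrite ltr_norml ltrBrDl ltrBlDr h2 ltrBlDr -ltrBlDl h1.
  pose q : 'rV[rat]_n := \row_i sval (cid (q_ i)).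
  exists (pickle (q, k)) => //; rewrite pickleK ifT.
    by move=> i /=; rewrite mxE; case: cid.
  apply/asboolP => y /= By; apply: xeD; rewrite -ball_normE /ball_ /=.
  apply: (@le_lt_trans _ _ (k.+1%:R^-1 + k.+1%:R^-1)); last by rewrite [ltRHS]splitr ltrD.
  apply/rV_norm_leP; first by rewrite addr_ge0.
  move=> i; have := By i; rewrite !mxE; case: cid => q' /= h1 h2.
  rewrite (le_trans (ler_distD (ratr q') _ _))// lerD ?ltW//.
  by rewrite distrC.
apply: bigcupT_measurable => k; case: unpickle => // q; case: ifPn => // _.
Qed.

Lemma closed_rV_measurable D : closed D -> measurable D.
Proof.
by move=> cD; rewrite -(setCK D); apply: measurableC; apply: open_rV_measurable; exact: closed_openC.
Qed.

Lemma compact_rV_measurable D : compact D -> measurable D.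
Proof.
move=> cD; apply: closed_rV_measurable; apply: compact_closed => //.
Qed.

Lemma continuous_in_rV_measurable D (f : 'rV[R]_n -> R) : open D ->
  (forall x, D x -> {for x, continuous f}) -> measurable_fun D f.
Proof.
move=> oD cf; apply: (measurability _ (RGenOInfty.measurableE R)) => _ [_ [r ->] <-].
apply: open_rV_measurable; rewrite openE => x [/= Dx].
rewrite in_itv/= andbT => rfx; apply: filterI; first exact: open_nbhs_nbhs.
apply: (cf x Dx); apply: open_nbhs_nbhs; split; first exact: interval_open.
by rewrite /= in_itv/= rfx.
Qed.

Lemma continuous_rV_measurable (f : 'rV[R]_n -> R) : continuous f ->
  measurable_fun setT f.
Proof. by move=> cf; apply: continuous_in_rV_measurable; [exact: openT|move=> x _; exact: cf]. Qed.

Definition cball (N : R) : set 'rV[R]_n := [set x | `|x| <= N].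

Lemma closed_cball N : closed (cball N).
Proof.
rewrite /cball (_ : mkset _ = Num.norm @^-1` [set t : R | t <= N]) //.
by apply: closed_comp; [move=> x _; exact: norm_continuous | exact: closed_le].
Qed.

Lemma measurable_cball N : measurable (cball N).
Proof. by apply: closed_rV_measurable; exact: closed_cball. Qed.

Lemma compact_cball N : compact (cball N).
Proof.
apply: bounded_closed_compact; last exact: closed_cball.
by exists N; split=> [|M NM x /= /le_trans]; [exact: num_real | apply; exact: ltW].
Qed.

(** In the maximum norm a ball is a cube of side [N + N], so [lebesgue_rV_box] gives its exact
    volume. *)
Lemma lebesgue_rV_cball (N : R) : 0 <= N ->
  mu (cball N) = ((N + N) ^+ n)%:E.
Proof.
pose A (i : 'I_n) : set R := `[- N, N]%classic.
move=> N0; rewrite (_ : cball N = [set x | forall i, A i (x ord0 i)]).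
  rewrite lebesgue_rV_box; last by move=> i; exact: measurable_itv.
  rewrite /A.
  under eq_bigr.
    move=> i _; rewrite lebesgue_measure_itv/= lte_fin.
    rewrite (_ : (if _ then _ else _) = (N + N)%:E); last first.
      case: ifPn => [_|]; first by rewrite -EFinB opprK.
      by rewrite -leNgt => NN; (have -> : N = 0 by lra); rewrite addr0.
    over.
  by rewrite prodEFin prodr_const card_ord.
apply/seteqP; split => x /=.
  by move/rV_norm_leP => h i; rewrite /A/= in_itv/= -ler_norml; exact: h.
move=> h; apply/rV_norm_leP => // i.
by have := h i; rewrite /A/= in_itv/= -ler_norml.
Qed.

Lemma lebesgue_rV_cball_lty (N : R) : (mu (cball N) < +oo)%E.
Proof.
have [N0|N0] := leP 0 N; first by rewrite lebesgue_rV_cball// ltry.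
rewrite (_ : cball N = set0) ?measure0 ?ltry//.
by apply/seteqP; split=> // x /= /(le_trans (normr_ge0 x)); rewrite leNgt N0.
Qed.

Lemma compact_sub_cball D : compact D -> exists2 N : R, 1 <= N & D `<=` cball N.
Proof.
move=> /compact_bounded[M [Mr hM]]; exists (Num.max 1 (M + 1)).
  by rewrite le_max lexx.
by move=> x Dx; apply: (hM _ _ x Dx); rewrite lt_max ltrDl ltr01 orbT.
Qed.

Lemma compact_lebesgue_rV_lty D : compact D -> (mu D < +oo)%E.
Proof.
move=> cD; have [N _ DN] := compact_sub_cball cD.
apply: le_lt_trans (lebesgue_rV_cball_lty N).
by apply: le_measure => //; rewrite inE; [exact: compact_rV_measurable|exact: measurable_cball].
Qed.

End rV_space.

(** * Translation invariance of Lebesgue measure on R^n *)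

Section translation_invariance.
Context {R : realType}.

Lemma lebesgue_measure_shift (a : R) (A : set R) : measurable A ->
  lebesgue_measure ((fun x => x + a) @^-1` A) = lebesgue_measure A.
Proof.
move=> mA; have ms : measurable_fun [set: measurableTypeR R]
    (fun x : measurableTypeR R => x + a : measurableTypeR R).
  exact: measurable_funD.
rewrite -[LHS]/(pushforward lebesgue_measure
  (fun x : measurableTypeR R => x + a : measurableTypeR R) A).
apply/esym/lebesgue_measure_unique => //= _ [[b c]] _ <-.
rewrite /pushforward /= (_ : _ @^-1` _ = [set` `]b - a, c - a]]).
  by rewrite !lebesgue_measure_itv/= !lte_fin ltrD2r -!EFinB opprB addrA subrK.
by apply/seteqP; split=> x /=; rewrite !in_itv/= ltrBlDr lerBrDr.
Qed.

Lemma measurable_rV_shift n (z : 'rV[R]_n) :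
  measurable_fun setT (fun x : 'rV[R]_n => x + z).
Proof.
apply: measurable_fun_coordP => i; under eq_fun do rewrite mxE.
by apply: measurable_funD => //; exact: measurable_coord.
Qed.

(** Induction on the dimension. Through [rV_cons] the translation acts separately on the first
    coordinate and on the others, so the translated product measure agrees with the product measure
    on rectangles, which determine it. *)
Lemma lebesgue_rV_shift n (z : 'rV[R]_n) (A : set 'rV[R]_n) : measurable A ->
  lebesgue_rV n ((fun x => x + z) @^-1` A) = lebesgue_rV n A.
Proof.
elim: n z A => [|n IH] z A mA.
  congr (lebesgue_rV 0 _); apply/seteqP.
  by split=> x /=; rewrite (thinmx0 (x + z)) (thinmx0 x).
rewrite /= /lebesgue_rV_step /pushforward.
pose z' : 'rV[R]_n := \row_j z ord0 (lift ord0 j).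
pose T (q : measurableTypeR R * 'rV[R]_n) : measurableTypeR R * 'rV[R]_n :=
  (q.1 + z ord0 ord0, q.2 + z').
have mT : measurable_fun setT T.
  apply: measurable_fun_pair; first exact: measurable_funD.
  exact: (measurableT_comp (measurable_rV_shift z')).
have mpre : measurable (@rV_cons R n @^-1` A).
  by rewrite -[X in measurable X]setTI; exact: measurable_rV_cons.
rewrite -comp_preimage (_ : _ \o _ = @rV_cons R n \o T); last first.
  apply/funext => -[x y]; apply/rowP => i; rewrite !mxE/=.
  by case: unliftP => [j|] -> /=; rewrite ?mxE.
rewrite comp_preimage.
rewrite -[LHS]/(pushforward (lebesgue_measure \x lebesgue_rV n)%E T
  (@rV_cons R n @^-1` A)).
apply/esym/product_measure_unique => //= B C mB mC.
rewrite /pushforward (_ : T @^-1` _ =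
  ((fun x => x + z ord0 ord0) @^-1` B) `*` ((fun x => x + z') @^-1` C)) //.
have mB' : measurable ((fun x : measurableTypeR R => x + z ord0 ord0) @^-1` B).
  by rewrite -[X in measurable X]setTI; exact: measurable_funD.
have mC' : measurable ((fun x => x + z') @^-1` C).
  by rewrite -[X in measurable X]setTI; exact: measurable_rV_shift.
rewrite product_measure1E//.
by congr (_ * _)%E; [exact: lebesgue_measure_shift | exact: IH].
Qed.

Lemma ge0_integral_rV_shift n (z : 'rV[R]_n) (f : 'rV[R]_n -> \bar R) :
  measurable_fun setT f -> (forall x, 0 <= f x)%E ->
  (\int[lebesgue_rV n]_x f (x + z)%R = \int[lebesgue_rV n]_x f x)%E.
Proof.
move=> mf f0.
have mz := @measurable_rV_shift n z.
transitivity (\int[pushforward (lebesgue_rV n) (fun x : 'rV[R]_n => (x + z)%R)]_x f x)%E.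
  by rewrite ge0_integral_pushforward.
by apply: eq_measure_integral => //= A mA _; exact: lebesgue_rV_shift.
Qed.

Lemma Rintegral_rV_shift n (z : 'rV[R]_n) (f : 'rV[R]_n -> R) :
  measurable_fun setT f ->
  \int[lebesgue_rV n]_x f (x + z) = \int[lebesgue_rV n]_x f x.
Proof.
move=> mf; rewrite /Rintegral; congr fine.
have mEf : measurable_fun setT (EFin \o f) by exact/measurable_EFinP.
rewrite integralE [RHS]integralE; congr (_ - _)%E.
  rewrite -[RHS](ge0_integral_rV_shift z (measurable_funepos mEf) (funepos_ge0 _)).
  by apply: eq_integral => x _; rewrite !funeposE.
rewrite -[RHS](ge0_integral_rV_shift z (measurable_funeneg mEf) (funeneg_ge0 _)).
by apply: eq_integral => x _; rewrite !funenegE.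
Qed.

End translation_invariance.

(** * Smooth functions *)

Section smooth_functions.
Context {R : realType} {n : nat}.
Implicit Types (f g : 'rV[R]_n -> R) (x y v : 'rV[R]_n) (H : nat -> R -> R).

(** A directional derivative is an ordinary derivative along a line. Since [smooth] speaks of
    partial derivatives only, the chain rule and the mean value theorem are always applied along
    such lines. *)
Lemma derive_lineE f y v (t : R) :
  derivable (fun h : R => f (h *: v + y)) t 1 = derivable f (t *: v + y) v /\
  'D_1 (fun h : R => f (h *: v + y)) t = 'D_v f (t *: v + y).
Proof.
rewrite /derivable /derive.
rewrite (_ : (fun h : R => h^-1 *: (((fun h0 : R => f (h0 *: v + y)) \o shift t)
    (h *: 1) - f (t *: v + y))) =
  (fun h : R => h^-1 *: ((f \o shift (t *: v + y)) (h *: v) - f (t *: v + y)))) //.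
by apply/funext => h /=; rewrite [h%:A]mulr1 scalerDl addrA.
Qed.

Lemma is_derive_line f y v (t df : R) : is_derive (t *: v + y) v f df ->
  is_derive t 1 (fun h : R => f (h *: v + y)) df.
Proof.
have [h1 h2] := derive_lineE f y v t.
by move=> [d1 d2]; split; [rewrite h1 | rewrite h2].
Qed.

Lemma is_derive_lineP f y v (df : R) :
  is_derive (0 : R) 1 (fun h : R => f (h *: v + y)) df -> is_derive y v f df.
Proof.
have [h1 h2] := derive_lineE f y v 0.
move=> [d1 d2]; have e : 0 *: v + y = y by rewrite scale0r add0r.
by rewrite h1 in d1; rewrite h2 in d2; rewrite -e; split.
Qed.

Lemma is_derive_comp_rV (h : R -> R) f x v (dh df : R) :
  is_derive (f x) 1 h dh -> is_derive x v f df ->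
  is_derive x v (h \o f) (dh * df).
Proof.
move=> hh hf; apply: is_derive_lineP.
have e : 0 *: v + x = x by rewrite scale0r add0r.
apply: (@is_derive1_comp R h (fun t : R => f (t *: v + x))).
  by rewrite e.
by apply: is_derive_line; rewrite e.
Qed.

Lemma is_derive_shift_rV f x y v (df : R) : is_derive (x + y) v f df ->
  is_derive x v (fun z => f (z + y)) df.
Proof.
move=> hf; apply: is_derive_lineP.
rewrite (_ : (fun h => _) = (fun h : R => f (h *: v + (x + y)))).
  by apply: is_derive_line; rewrite scale0r add0r.
by apply/funext => h; rewrite addrA.
Qed.

(* [smooth] exposes the outermost partial derivative; this form peels off the
   innermost one, which is what inductions on products and compositions need. *)
Fixpoint cont_diff (k : nat) f : Prop := continuous f /\
  match k with
  | 0 => True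
  | k'.+1 => forall i, (forall x, derivable f x (delta_mx ord0 i)) /\
      cont_diff k' (partial i f)
  end.

Lemma smooth_partial f i : smooth f -> smooth (partial i f).
Proof.
by move=> sf s; have := sf (rcons s i); rewrite foldr_rcons.
Qed.

Lemma smoothP f : smooth f <-> forall k, cont_diff k f.
Proof.
split=> [sf k|sf s].
  elim: k f sf => [|k IH] f sf /=; split=> //; first by have [] := sf [::].
    by have [] := sf [::].
  by move=> i; split; [have [_] := sf [::]; apply | apply: IH; exact: smooth_partial].
elim/last_ind: s f sf => [|s i IH] f sf /=.
  have [cf h] := sf 1; split=> // i x; by have [+ _] := h i; apply.
by rewrite foldr_rcons; apply: IH => k; have [_ /(_ i)[]] := sf k.+1.
Qed.

Lemma cont_diffS k f : cont_diff k.+1 f -> cont_diff k f.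
Proof.
elim: k f => [|k IH] f [cf h]; first by split.
by split=> // i; have [d c] := h i; split=> //; exact: IH.
Qed.

Lemma cont_diff_is_derive k f x i : cont_diff k.+1 f ->
  is_derive x (delta_mx ord0 i) f (partial i f x).
Proof. by move=> [_ /(_ i)[d _]]; split. Qed.

Lemma partial_is_derive f df i :
  (forall x, is_derive x (delta_mx ord0 i) f (df x)) ->
  (forall x, derivable f x (delta_mx ord0 i)) /\ partial i f = df.
Proof.
by move=> h; split=> [x|]; [have [] := h x | apply/funext => x; have [] := h x].
Qed.

Lemma cont_diff_cst k (c : R) : cont_diff k (cst c).
Proof.
elim: k c => [|k IH] c; split=> //; try exact: cst_continuous.
move=> i; have hd : forall z : 'rV[R]_n, is_derive z (delta_mx ord0 i) (cst c) ((cst 0) z).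
  by move=> x; exact: is_derive_cst.
have [d ->] := partial_is_derive hd.
by split=> //; exact: IH.
Qed.

Lemma cont_diffD k f g : cont_diff k f -> cont_diff k g -> cont_diff k (f + g).
Proof.
elim: k f g => [|k IH] f g [cf hf] [cg hg]; split=> //;
  try by move=> x; apply: continuousD; [exact: cf|exact: cg].
move=> i; have [df cdf] := hf i; have [dg cdg] := hg i.
have hd : forall z : 'rV[R]_n, is_derive z (delta_mx ord0 i) (f + g) ((partial i f + partial i g) z).
  by move=> x; apply: is_deriveD; split.
have [d ->] := partial_is_derive hd.
by split=> //; exact: IH.
Qed.

Lemma cont_diffM k f g : cont_diff k f -> cont_diff k g -> cont_diff k (f * g).
Proof.
elim: k f g => [|k IH] f g cf cg; have [cf0 hf] := cf; have [cg0 hg] := cg; split=> //;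
  try by move=> x; apply: continuousM; [exact: cf0|exact: cg0].
move=> i; have [df cdf] := hf i; have [dg cdg] := hg i.
have hd : forall z : 'rV[R]_n, is_derive z (delta_mx ord0 i) (f * g) ((f * partial i g + g * partial i f) z).
  by move=> x; apply: is_deriveM; split.
have [d ->] := partial_is_derive hd.
by split=> //; apply: cont_diffD; apply: IH => //; exact: cont_diffS.
Qed.

Lemma cont_diff_coord k i : cont_diff k (fun x => x ord0 i).
Proof.
have ci : continuous (fun x : 'rV[R]_n => x ord0 i) by exact: coord_continuous.
case: k => [|k]; split=> //.
move=> j; have hd : forall z : 'rV[R]_n, is_derive z (delta_mx ord0 j) (fun x => x ord0 i) ((cst ((delta_mx ord0 j : 'rV[R]_n) ord0 i)) z).
  move=> x; apply: is_derive_lineP.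
  rewrite (_ : (fun h => _) = (fun h : R => h * (delta_mx ord0 j : 'rV[R]_n) ord0 i + x ord0 i)).
    by apply: is_derive_eq; rewrite addr0 scaler0 add0r [_%:A]mulr1.
  by apply/funext => h; rewrite !mxE.
have [d ->] := partial_is_derive hd.
by split=> //; exact: cont_diff_cst.
Qed.

(** A whole sequence of successive derivatives is taken as datum, with [j] free, because
    differentiating [H j \o f] produces the factor [H j.+1 \o f], to which the induction hypothesis
    must apply. *)
Lemma cont_diff_comp k H j f : (forall j (t : R), is_derive t 1 (H j) (H j.+1 t)) ->
  cont_diff k f -> cont_diff k (H j \o f).
Proof.
move=> hH; elim: k j f => [|k IH] j f cf; have [cf0 hf] := cf; split=> //;
  try (move=> x; apply: continuous_comp; [exact: cf0|];
       by apply/differentiable_continuous/derivable1_diffP; have [] := hH j (f x)).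
move=> i; have [df cdf] := hf i.
have hd : forall z : 'rV[R]_n, is_derive z (delta_mx ord0 i) (H j \o f) (((H j.+1 \o f) * partial i f) z).
  by move=> x; apply: is_derive_comp_rV => //; split.
have [d ->] := partial_is_derive hd.
by split=> //; apply: cont_diffM => //; apply: IH; exact: cont_diffS.
Qed.

Lemma continuous_rV_shift f y : continuous f -> continuous (fun x => f (x + y)).
Proof.
move=> cf x; apply: (@continuous_comp _ _ _ (fun z : 'rV[R]_n => z + y) f _ _ (cf _)).
by apply: continuousD; [exact: cvg_id|exact: cst_continuous].
Qed.

Lemma cont_diff_shift k f y : cont_diff k f -> cont_diff k (fun x => f (x + y)).
Proof.
elim: k f => [|k IH] f [cf hf]; split=> //;
  try exact: continuous_rV_shift.
move=> i; have [df cdf] := hf i.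
have hd : forall z : 'rV[R]_n, is_derive z (delta_mx ord0 i) (fun x => f (x + y)) ((fun x => partial i f (x + y)) z).
  by move=> x; apply: is_derive_shift_rV; split.
have [d ->] := partial_is_derive hd.
by split=> //; exact: IH.
Qed.

Lemma smooth_continuous f : smooth f -> continuous f.
Proof. by move=> /(_ [::])[]. Qed.

Lemma smooth_is_derive f x i : smooth f ->
  is_derive x (delta_mx ord0 i) f (partial i f x).
Proof. by move=> /smoothP /(_ 1) /cont_diff_is_derive; apply. Qed.

Lemma smooth_cst (c : R) : smooth (cst c : 'rV[R]_n -> R).
Proof. by apply/smoothP => k; exact: cont_diff_cst. Qed.

Lemma smoothD f g : smooth f -> smooth g -> smooth (f + g).
Proof. by move=> /smoothP sf /smoothP sg; apply/smoothP => k; exact: cont_diffD. Qed.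

Lemma smoothM f g : smooth f -> smooth g -> smooth (f * g).
Proof. by move=> /smoothP sf /smoothP sg; apply/smoothP => k; exact: cont_diffM. Qed.

Lemma smooth_coord i : smooth (fun x : 'rV[R]_n => x ord0 i).
Proof. by apply/smoothP => k; exact: cont_diff_coord. Qed.

Lemma smooth_comp H j f : (forall j (t : R), is_derive t 1 (H j) (H j.+1 t)) ->
  smooth f -> smooth (H j \o f).
Proof. by move=> hH /smoothP sf; apply/smoothP => k; exact: cont_diff_comp. Qed.

Lemma smooth_shift f y : smooth f -> smooth (fun x => f (x + y)).
Proof. by move=> /smoothP sf; apply/smoothP => k; exact: cont_diff_shift. Qed.

Lemma partial_shift f y i x : smooth f ->
  partial i (fun x => f (x + y)) x = partial i f (x + y).
Proof.
move=> sf; rewrite /partial; apply: derive_val; apply: is_derive_shift_rV.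
exact: smooth_is_derive.
Qed.

Lemma partial_comp H j f i x : (forall j (t : R), is_derive t 1 (H j) (H j.+1 t)) ->
  smooth f -> partial i (H j \o f) x = H j.+1 (f x) * partial i f x.
Proof.
move=> hH sf; rewrite /partial; apply: derive_val; apply: is_derive_comp_rV => //.
exact: smooth_is_derive.
Qed.

Lemma partialD f g i x : smooth f -> smooth g ->
  partial i (f + g) x = partial i f x + partial i g x.
Proof.
by move=> sf sg; apply: derive_val; apply: is_deriveD; exact: smooth_is_derive.
Qed.

Lemma partialM f g i x : smooth f -> smooth g ->
  partial i (f * g) x = f x * partial i g x + g x * partial i f x.
Proof.
by move=> sf sg; apply: derive_val; apply: is_deriveM; exact: smooth_is_derive.
Qed.

End smooth_functions.

(** * Smoothness of exp(-1/t) at the origin *)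

Section flat_function.
Context {R : realType}.
Implicit Types (p q : {poly R}) (s t : R).

(** Each monomial obeys [s ^ i <= i! * expR s]; the constant is the resulting sum over the
    coefficients. *)
Lemma horner_expRN_bounded q : exists2 C : R, 0 <= C &
  forall s, 0 <= s -> `|q.[s] * expR (- s)| <= C.
Proof.
exists (\sum_(i < size q) `|q`_i| * i`!%:R).
  by apply: sumr_ge0 => i _; rewrite mulr_ge0.
move=> s s0; rewrite horner_coef mulr_suml (le_trans (ler_norm_sum _ _ _))//.
apply: ler_sum => i _; rewrite -mulrA normrM ler_wpM2l//.
rewrite ger0_norm ?mulr_ge0 ?exprn_ge0 ?expR_ge0//.
rewrite expRN ler_pdivrMr ?expR_gt0//.
case: (nat_of_ord i) => [|k].
  by rewrite expr0 fact0 mul1r -expR0 ler_expR.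
have := expR_ge1Dxn k s0.
have f0 : 0 < (k.+1)`!%:R :> R by rewrite ltr0n fact_gt0.
move=> h; rewrite mulrC -ler_pdivrMr//.
by apply: le_trans h; rewrite lerDr.
Qed.

Definition flat p t : R := if 0 < t then p.[t^-1] * expR (- t^-1) else 0.

(* (p(1/t) exp(-1/t))' = t^-2 (p - p')(1/t) exp(-1/t), so the class of functions
   [flat p] is stable under differentiation. *)
Definition flat_next p : {poly R} := 'X^2 * (p - p^`()).

Lemma flat_bounded p : exists2 C : R, 0 <= C & forall t, `|flat p t| <= C.
Proof.
have [C C0 hC] := horner_expRN_bounded p; exists C => // t; rewrite /flat.
by case: ifPn => t0; [apply: hC; rewrite invr_ge0 ltW | rewrite normr0].
Qed.

Lemma is_derive_flat p t : is_derive t 1 (flat p) (flat (flat_next p) t).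
Proof.
have [t0|t0|->] := ltgtP t 0.
- have -> : flat (flat_next p) t = 0 by rewrite /flat ltNge (ltW t0).
  apply: (@near_eq_is_derive R R R (cst 0)).
  near=> x; rewrite /flat ifF//; apply/negbTE; rewrite -leNgt ltW//.
  by near: x; exact: lt_nbhsl.
- have -> : flat (flat_next p) t =
      p.[t^-1] * (expR (- t^-1) * t ^- 2) + expR (- t^-1) * (p^`().[t^-1] * - t ^- 2).
    rewrite /flat t0 /flat_next hornerM hornerXn hornerD hornerN exprVn.
    by move: (t ^- 2) (expR _) (p.[t^-1]) (p^`().[t^-1]) => a b c d; ring.
  apply: (@near_eq_is_derive R R R ((horner p \o (fun x => x^-1)) * (expR \o (fun x => - x^-1)))).
    by near=> x; rewrite /flat ifT//; near: x; exact: lt_nbhsr.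
  have dV : is_derive t 1 (fun x : R => x^-1) (- t ^- 2).
    by apply: (is_derive_eq (is_deriveV _ _)); [rewrite gt_eqF | exact: mulr1].
  have dNV : is_derive t 1 (fun x : R => - x^-1) (t ^- 2).
    by apply: (is_derive_eq (is_deriveN dV)); rewrite opprK.
  exact: (is_deriveM (@is_derive1_comp R (horner p) (fun x => x^-1) t _ _ (is_derive_poly p t^-1) dV)
    (@is_derive1_comp R expR (fun x => - x^-1) t _ _ (is_derive_expR (- t^-1)) dNV)).
- have f0 q : flat q 0 = 0 by rewrite /flat ltxx.
  rewrite f0.
  (* At [1 / h] the factor ['X^2] contributes [h ^- 2], so the boundedness of [flat ('X^2 * p)] says
     that [flat p h] is O(h^2), and the difference quotient at 0 tends to 0. *)
  have [C C0 hC] := flat_bounded ('X^2 * p).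
  have hp h : `|flat p h| <= C * h ^+ 2.
    have := hC h; rewrite /flat; case: ifPn => h0; last first.
      by rewrite normr0 => _; rewrite mulr_ge0// sqr_ge0.
    rewrite hornerM hornerXn -mulrA normrM exprVn ger0_norm ?invr_ge0 ?sqr_ge0//.
    by rewrite mulrC ler_pdivrMr// exprn_gt0.
  have cv : (fun h : R => h^-1 *: ((flat p \o shift 0) (h *: 1) - flat p 0)) @ 0^' --> (0 : R).
    apply/cvgrPdist_le => e e0; near=> h.
    have h0 : h != 0 by near: h; exact: nbhs_dnbhs_neq.
    rewrite f0 subr0 sub0r normrN /= addr0 [h%:A]mulr1 normrM normfV.
    rewrite ler_pdivrMl ?normr_gt0// (le_trans (hp h))//.
    rewrite -(real_normK (num_real h)) expr2 mulrA [leLHS]mulrC ler_wpM2l//.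
    near: h; exists (e / (C + 1)) => /=; first by rewrite divr_gt0// ltr_pwDr.
    move=> h /=; rewrite sub0r normrN => he _.
    rewrite (@le_trans _ _ ((C + 1) * `|h|))//; first by rewrite ler_wpM2r// lerDl.
    by rewrite mulrC -ler_pdivlMr ?ltr_pwDr// ltW.
  split; first by apply/cvg_ex; exists 0.
  by apply: cvg_lim cv.
Unshelve. all: end_near. Qed.

End flat_function.

(** * Test functions and convolution *)

Section test_functions.
Context {R : realType} {n : nat}.
Implicit Types (Om K : set 'rV[R]_n) (phi w : 'rV[R]_n -> R) (x y : 'rV[R]_n).
Local Notation mu := (@lebesgue_rV R n).

Lemma test_functionI Om K phi : smooth phi -> compact K -> K `<=` Om ->
  (forall x, ~ K x -> phi x = 0) -> test_function Om phi.
Proof.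
move=> sphi cK KOm phi0.
have sK : closure [set x | phi x != 0] `<=` K.
  rewrite [X in _ `<=` X](closure_id K).1; last first.
    by apply: compact_closed => //; exact: norm_hausdorff.
  apply: closure_subset => x /= /eqP px; apply: contrapT => /phi0; exact: px.
split=> //; last exact: subset_trans KOm.
by apply: subclosed_compact cK sK; exact: closed_closure.
Qed.

Lemma test_function_support Om phi : test_function Om phi ->
  exists K, [/\ compact K, K `<=` Om & forall x, ~ K x -> phi x = 0].
Proof.
move=> [_ cK KOm]; exists (closure [set x | phi x != 0]); split=> // x nKx.
by apply/eqP; apply: contra_notT nKx => px; exact: subset_closure.
Qed.

Lemma test_functionT Om phi : test_function Om phi -> test_function setT phi.
Proof. by move=> [? ? ?]; split. Qed.

Lemma partial_supported K phi i : closed K -> (forall x, ~ K x -> phi x = 0) ->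
  forall x, ~ K x -> partial i phi x = 0.
Proof.
move=> cK phi0 x nKx; rewrite /partial -[RHS](@derive_cst R _ R 0 x (delta_mx ord0 i)).
apply: near_eq_derive; near=> y; rewrite phi0//.
by near: y; apply: open_nbhs_nbhs; split => //; exact: closed_openC.
Unshelve. all: end_near. Qed.

Lemma test_function_partial Om phi i : test_function Om phi ->
  test_function Om (partial i phi).
Proof.
move=> tphi; have [sphi _ _] := tphi.
have [K [cK KOm K0]] := test_function_support tphi.
apply: (test_functionI (smooth_partial i sphi) cK KOm).
by apply: partial_supported => //; apply: compact_closed => //; exact: norm_hausdorff.
Qed.

Lemma test_function_shift phi x : test_function setT phi ->
  test_function setT (fun y => phi (y + x)).
Proof.
move=> tphi; have [sphi _ _] := tphi.
have [K [cK _ K0]] := test_function_support tphi.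
have [N N1 KN] := compact_sub_cball cK.
apply: (test_functionI (K := cball (N + `|x|)) (smooth_shift x sphi)) => //.
  exact: compact_cball.
move=> y yN; apply: K0 => /KN /= yxN; apply: yN; rewrite /cball /=.
by rewrite -[y](addrK x) (le_trans (ler_normB _ _))// lerD2r.
Qed.

Lemma test_functionD Om phi psi : test_function Om phi -> test_function Om psi ->
  test_function Om (phi + psi).
Proof.
move=> tphi tpsi; have [sphi _ _] := tphi; have [spsi _ _] := tpsi.
have [K [cK KO K0]] := test_function_support tphi.
have [L [cL LO L0]] := test_function_support tpsi.
apply: (test_functionI (K := K `|` L) (smoothD sphi spsi)).
- exact: compactU.
- by rewrite subUset.
- by move=> x /not_orP[nK nL]; rewrite fctE K0// L0// addr0.
Qed.

Lemma test_functionM Om f phi : smooth f -> test_function Om phi ->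
  test_function Om (f * phi).
Proof.
move=> sf tphi; have [sphi _ _] := tphi.
have [K [cK KO K0]] := test_function_support tphi.
apply: (test_functionI (smoothM sf sphi) cK KO).
by move=> x nK; rewrite fctE K0// mulr0.
Qed.

Lemma test_function_measurable Om phi : test_function Om phi -> measurable_fun setT phi.
Proof. by move=> [sphi _ _]; apply: continuous_rV_measurable; exact: smooth_continuous. Qed.

Lemma test_function_bounded Om phi : test_function Om phi ->
  exists2 C : R, 0 <= C & forall x, `|phi x| <= C.
Proof.
move=> tphi; have [sphi _ _] := tphi.
have [K [cK KO K0]] := test_function_support tphi.
have /compact_bounded[M [_ hM]] : compact (phi @` K).
  apply: continuous_compact => //; apply: continuous_subspaceT.
  exact: smooth_continuous.
exists (Num.max 0 (M + 1)); first by rewrite le_max lexx.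
move=> x; have [Kx|nKx] := pselect (K x); last by rewrite K0// normr0 le_max lexx.
rewrite le_max; apply/orP; right; apply: (hM (M + 1)); last by exists x.
by rewrite ltrDl.
Qed.

Lemma test_function_cball Om phi : test_function Om phi ->
  exists2 N : R, 1 <= N & forall x, N < `|x| -> phi x = 0.
Proof.
move=> tphi; have [K [cK KO K0]] := test_function_support tphi.
have [N N1 KN] := compact_sub_cball cK; exists N => // x Nx.
by apply: K0 => /KN; rewrite /cball /= leNgt Nx.
Qed.

(** Local integrability on all of R^n, tested on balls. Convolution integrates over the whole space,
    whereas [loc_integrable] sees only compact subsets of [Om]. *)
Definition loc_int w := measurable_fun setT w /\
  forall N, mu.-integrable (cball N) (EFin \o w).

Lemma loc_int_cst (c : R) : loc_int (cst c).
Proof.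
split=> // N; apply: measurable_bounded_integrable => //.
- exact: measurable_cball.
- exact: lebesgue_rV_cball_lty.
- by exists `|c|; split=> // M cM x _ /=; exact: ltW.
Qed.

Lemma integrable_loc_int w : mu.-integrable setT (EFin \o w) -> loc_int w.
Proof.
move=> iw; split; first by apply/measurable_EFinP; exact: (measurable_int mu).
by move=> N; apply: integrableS iw => //; exact: measurable_cball.
Qed.

Lemma bounded_support_integrable (f w : 'rV[R]_n -> R) (C N : R) :
  measurable_fun setT f -> (forall x, `|f x| <= C) ->
  (forall x, N < `|x| -> f x = 0) -> loc_int w ->
  mu.-integrable setT (EFin \o (fun x => f x * w x)).
Proof.
move=> mf fC f0 [mw iw].
rewrite (_ : EFin \o _ = ((EFin \o (fun x => f x * w x)) \_ (cball N))); last first.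
  apply/funext => x; rewrite patchE; case: ifPn => // /negP; rewrite inE /cball /= => xN.
  by rewrite f0 ?mul0r// ltNge; apply/negP.
apply/(integrable_mkcond _ (measurable_cball N)).
rewrite (_ : EFin \o _ = ((EFin \o f) \* (EFin \o w))%E); last first.
  by apply/funext => x /=; rewrite EFinM.
apply: integrableMr => //.
- exact: measurable_cball.
- exact: measurable_funTS.
- by exists C; split=> [|M CM x _ /=]; [exact: num_real | rewrite (le_trans (fC x))// ltW].
Qed.

Lemma test_function_integrable phi w : test_function setT phi -> loc_int w ->
  mu.-integrable setT (EFin \o (fun x => phi x * w x)).
Proof.
move=> tphi lw; have [C _ hC] := test_function_bounded tphi.
have [N _ hN] := test_function_cball tphi.
exact: (bounded_support_integrable (test_function_measurable tphi) hC hN lw).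
Qed.

End test_functions.

(** * Differentiation under the integral sign and integration by parts *)

Section integration.
Context {R : realType} {n : nat}.
Implicit Types (Om K : set 'rV[R]_n) (phi w : 'rV[R]_n -> R) (x y : 'rV[R]_n).
Local Notation mu := (@lebesgue_rV R n).
Local Notation e_ i := (delta_mx ord0 i : 'rV[R]_n).

Lemma norm_delta_rV i : `|e_ i| <= 1.
Proof.
apply/rV_norm_leP => // j; rewrite mxE; case: (_ && _) => /=; rewrite ?normr1 ?normr0//.
Qed.

Lemma is_derive_integral_shift phi w i : test_function setT phi -> loc_int w ->
  is_derive (0 : R) 1 (fun t => \int[mu]_y (phi (t *: e_ i + y) * w y))
    (\int[mu]_y (partial i phi y * w y)).
Proof.
move=> tphi lw; have [sphi _ _] := tphi.
have tpphi := test_function_partial i tphi.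
have [C C0 hC] := test_function_bounded tpphi.
have [N N1 hN] := test_function_cball tpphi.
pose f (t : R) y := phi (t *: e_ i + y) * w y.
have df (t : R) y : is_derive t 1 (f^~ y) (partial i phi (t *: e_ i + y) * w y).
  have h1 : is_derive t 1 (fun t : R => phi (t *: e_ i + y)) (partial i phi (t *: e_ i + y)).
    by apply: is_derive_line; exact: smooth_is_derive.
  apply: (is_derive_eq (is_deriveM h1 (is_derive_cst (w y) t (1 : R)))).
  by rewrite scaler0 add0r mulrC.
(* For [|t| < 1] the translate of the support of [partial i phi] stays in [cball (N + 1)], so [G]
   dominates the derivative uniformly in [t]. *)
pose G := (fun y => C * `|w y|) \_ (cball (N + 1)).
have G0 y : 0 <= G y by rewrite /G patchE; case: ifPn => // _; rewrite mulr_ge0.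
have intG : mu.-integrable setT (EFin \o G).
  rewrite (_ : EFin \o G = (EFin \o (fun y => C * `|w y|)) \_ (cball (N + 1))); last first.
    by rewrite -restrict_EFin.
  apply/(integrable_mkcond _ (measurable_cball _)).
  have /integrable_norm iw := lw.2 (N + 1).
  exact: (integrableZl (measurable_cball _) C iw).
have intf t : `]-1, 1[%classic t -> mu.-integrable setT (EFin \o f t).
  move=> _; apply: (test_function_integrable _ lw).
  rewrite (_ : (fun y => _) = (fun y => phi (y + t *: e_ i))).
    exact: test_function_shift.
  by apply/funext => y; rewrite addrC.
have Gub t y : `]-1, 1[%classic t -> setT y -> `|derive1 (fun s => f s y) t| <= G y.
  move=> t1 _; rewrite /= derive1E.
  have [_ ->] := df t y; rewrite /G patchE; case: ifPn => [_|/negP].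
    by rewrite normrM ler_wpM2r.
  rewrite inE /cball /= => /negP; rewrite -ltNge => Ny.
  rewrite hN ?mul0r ?normr0//.
  have Ny' : N + 1 < `|t *: e_ i + y| + `|t *: e_ i|.
    rewrite (lt_le_trans Ny)//.
    by rewrite -[X in `|X| <= _](addKr (t *: e_ i)) addrC; exact: ler_normB.
  have t1' : `|t *: e_ i| <= 1.
    rewrite normrZ mulr_ile1//; last exact: norm_delta_rV.
    by move: t1; rewrite /= in_itv/= -ltr_norml => /ltW.
  by rewrite -(ltrD2r 1) (lt_le_trans Ny')// lerD2l.
have z1 : `]-1, 1[%classic (0 : R) by rewrite /= in_itv/= ltr01 andbT ltrN10.
have df1 t y : `]-1, 1[%classic t -> setT y -> derivable (fun s => f s y) t 1.
  by move=> _ _; have [] := df t y.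
split.
  exact: (derivable_under_integral measurableT z1 intf df1 G0 intG Gub).
rewrite -derive1E.
rewrite (differentiation_under_integral measurableT z1 intf df1 G0 intG Gub).
apply: eq_Rintegral => y _; rewrite partial1of2E.
by have [_ ->] := df 0 y; rewrite scale0r add0r.
Qed.

(** By translation invariance the integral of [phi (t *: e_ i + y)] over [y] does not depend on [t],
    and its derivative at [t = 0] is the integral in question, by [is_derive_integral_shift] with
    weight 1. *)
Lemma integral_partial0 Om phi i : test_function Om phi ->
  \int[mu]_y partial i phi y = 0.
Proof.
move=> /test_functionT tphi.
have [_ h] := is_derive_integral_shift i tphi (loc_int_cst 1).
have -> : \int[mu]_y partial i phi y = \int[mu]_y (partial i phi y * cst 1 y).
  by apply: eq_Rintegral => y _; rewrite mulr1.
rewrite -h (_ : (fun t => _) = cst (\int[mu]_y phi y)) ?derive_cst//.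
apply/funext => t /=.
rewrite -(Rintegral_rV_shift (t *: e_ i) (test_function_measurable tphi)).
by apply: eq_Rintegral => y _; rewrite mulr1 addrC.
Qed.

(** [integral_partial0] is applied to the product [phi * psi]; integrals over [Om] extend to R^n
    because the first factor vanishes off [Om]. *)
Lemma test_function_by_parts Om phi psi i : test_function Om phi -> test_function Om psi ->
  \int[mu]_(x in Om) (phi x * partial i psi x) =
  - \int[mu]_(x in Om) (partial i phi x * psi x).
Proof.
move=> tphi tpsi.
have toT (f g : 'rV[R]_n -> R) : test_function Om f ->
    \int[mu]_(x in Om) (f x * g x) = \int[mu]_x (f x * g x).
  move=> tf; have [K [cK KOm K0]] := test_function_support tf.
  rewrite Rintegral_mkcond; apply: eq_Rintegral => x _; rewrite patchE.
  case: ifPn => // /negP; rewrite inE => nOm; rewrite K0 ?mul0r// => Kx.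
  exact/nOm/KOm.
rewrite (toT phi)// (toT (partial i phi)); last exact: test_function_partial.
have [sphi _ _] := tphi; have [spsi _ _] := tpsi.
have := integral_partial0 i (test_functionM sphi tpsi).
have tphiT := test_functionT tphi; have tpsiT := test_functionT tpsi.
have I1 : mu.-integrable setT (EFin \o (fun x => phi x * partial i psi x)).
  apply: test_function_integrable => //; apply: integrable_loc_int.
  have := test_function_integrable (test_function_partial i tpsiT) (loc_int_cst 1).
  by under eq_fun do rewrite mulr1.
have I2 : mu.-integrable setT (EFin \o (fun x => partial i phi x * psi x)).
  apply: test_function_integrable; first exact: test_function_partial.
  apply: integrable_loc_int.
  have := test_function_integrable tpsiT (loc_int_cst 1).
  by under eq_fun do rewrite mulr1.
have -> : \int[mu]_y partial i (phi * psi) y =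
    \int[mu]_y (phi y * partial i psi y + partial i phi y * psi y).
  by apply: eq_Rintegral => y _; rewrite partialM// [psi y * _]mulrC.
by rewrite RintegralD// => /eqP; rewrite addr_eq0 => /eqP.
Qed.

(** From [y] to [x] one coordinate is changed at a time, through the hybrid vectors [z k]; each step
    is a mean value estimate along an axis with slope at most [D], whence the constant
    [n%:R * D]. *)
Lemma test_function_lipschitz Om phi : test_function Om phi ->
  exists2 L : R, 0 <= L & forall x y, `|phi x - phi y| <= L * `|x - y|.
Proof.
move=> tphi; have [sphi _ _] := tphi.
have C_ i : exists C : R, 0 <= C /\ forall x, `|partial i phi x| <= C.
  by have [C C0 hC] := test_function_bounded (test_function_partial i tphi); exists C.
pose C i := sval (cid (C_ i)).
have hC i : 0 <= C i /\ forall x, `|partial i phi x| <= C i by rewrite /C; case: cid.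
pose D := \sum_i C i.
have CD i : C i <= D.
  by rewrite /D (bigD1 i)//= lerDl sumr_ge0// => j _; have [] := hC j.
have D0 : 0 <= D by rewrite sumr_ge0// => j _; have [] := hC j.
have step i x (t : R) : `|phi (t *: e_ i + x) - phi x| <= D * `|t|.
  pose g (s : R) := phi (s *: e_ i + x).
  have dg (s : R) : is_derive s 1 g (partial i phi (s *: e_ i + x)).
    by apply: is_derive_line; exact: smooth_is_derive.
  have -> : phi x = g 0 by rewrite /g scale0r add0r.
  rewrite -/(g t).
  have cg : continuous g.
    by move=> s; apply/differentiable_continuous/derivable1_diffP; have [] := dg s.
  have bound (a b : R) : a < b -> `|g b - g a| <= D * `|b - a|.
    move=> ab; have [c _ ->] := @MVT _ g (fun s => partial i phi (s *: e_ i + x)) a b ab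
      (fun s _ => dg s) (continuous_subspaceT cg).
    rewrite normrM ler_wpM2r// (le_trans _ (CD i))//.
    by have [_ h] := hC i; exact: h.
  have [t0|t0|->] := ltgtP t 0.
  - by rewrite distrC (le_trans (bound _ _ t0))// sub0r normrN.
  - by rewrite (le_trans (bound _ _ t0))// subr0.
  - by rewrite subrr !normr0 mulr0.
exists (n%:R * D); first by rewrite mulr_ge0.
move=> x y.
pose z k : 'rV[R]_n := \row_j if (j < k)%N then x ord0 j else y ord0 j.
have zk k : (k <= n)%N -> `|phi (z k) - phi y| <= k%:R * D * `|x - y|.
  elim: k => [_|k IH kn].
    rewrite (_ : z 0 = y) ?subrr ?normr0 ?mul0r//.
    by apply/rowP => j; rewrite mxE.
  pose i := Ordinal kn.
  have zS : z k.+1 = (x ord0 i - y ord0 i) *: e_ i + z k.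
    apply/rowP => j; rewrite !mxE eqxx/= ltnS leq_eqVlt.
    have [/val_inj ->|ji] := eqVneq (j : nat) (i : nat).
      by rewrite eqxx/= ltnn mulr1 subrK.
    rewrite (_ : (j == i) = false) ?mulr0 ?add0r//.
    by apply/negbTE; apply: contra_neq ji => ->.
  rewrite -(subrKA (phi (z k))) (le_trans (ler_normD _ _))//.
  rewrite -natr1 2!mulrDl mul1r addrC lerD//; first by rewrite IH// ltnW.
  rewrite zS (le_trans (step _ _ _))// ler_wpM2l//.
  by have := le_coord_norm (x - y) i; rewrite !mxE.
have -> : x = z n by apply/rowP => j; rewrite mxE ltn_ord.
have zn := zk n (leqnn n); apply: (le_trans zn).
by rewrite (_ : z n = x)//; apply/rowP => j; rewrite mxE ltn_ord.
Qed.

End integration.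

Lemma continuous_dist_le (R : realType) (V : normedModType R) (f : V -> R) :
  (forall x (e : R), 0 < e ->
    exists2 d : R, 0 < d & forall z, `|x - z| < d -> `|f x - f z| <= e) ->
  continuous f.
Proof.
move=> h x; apply/cvgrPdist_le => e e0.
have [d d0 hd] := h x e e0.
by apply/nbhs_ballP; exists d => //= z; rewrite -ball_normE; exact: hd.
Qed.

(** * Convolution with a test function *)

Section convolution.
Context {R : realType} {n : nat}.
Implicit Types (Om K : set 'rV[R]_n) (eta phi w : 'rV[R]_n -> R) (x y : 'rV[R]_n).
Local Notation mu := (@lebesgue_rV R n).
Local Notation e_ i := (delta_mx ord0 i : 'rV[R]_n).

(* For an even eta this is the usual eta * w; differentiating in x produces a sign
   (see is_derive_conv). *)
Definition convol eta w x : R := \int[mu]_y (eta (y - x) * w y).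

Lemma conv_integrable eta w x : test_function setT eta -> loc_int w ->
  mu.-integrable setT (EFin \o (fun y => eta (y - x) * w y)).
Proof.
by move=> teta lw; apply: test_function_integrable => //; exact: test_function_shift.
Qed.

Lemma is_derive_conv eta w x i : test_function setT eta -> loc_int w ->
  is_derive x (e_ i) (convol eta w) (- convol (partial i eta) w x).
Proof.
move=> teta lw; have [seta _ _] := teta; apply: is_derive_lineP.
have tx := test_function_shift (- x) teta.
have dF := is_derive_integral_shift i tx lw.
rewrite (_ : (fun h => _) =
  (fun t : R => \int[mu]_y (eta (t *: e_ i + y - x) * w y)) \o -%R); last first.
  apply/funext => h /=; apply: eq_Rintegral => y _.
  by congr (eta _ * _); rewrite opprD addrA scaleNr [- _ + y]addrC.
have -> : convol (partial i eta) w x =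
    \int[mu]_y (partial i (fun y : 'rV[R]_n => eta (y - x)) y * w y).
  by apply: eq_Rintegral => y _; rewrite partial_shift.
have dN : is_derive (0 : R) (1 : R) (-%R : R -> R) (- 1) by exact: is_deriveNid.
rewrite -mulrN1.
by apply: is_derive1_comp; rewrite oppr0.
Qed.

(** For [z] within 1 of [x] both shifted kernels are supported in [cball B], and there the Lipschitz
    constant of [eta] multiplies the integral of [|w|]. *)
Lemma conv_continuous eta w : test_function setT eta -> loc_int w ->
  continuous (convol eta w).
Proof.
move=> teta lw; apply: continuous_dist_le => x e e0.
have [L L0 hL] := test_function_lipschitz teta.
have [N N1 hN] := test_function_cball teta.
pose B := N + `|x| + 1.
pose I := \int[mu]_(y in cball B) `|w y|.
have I0 : 0 <= I by apply: Rintegral_ge0.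
have mB := @measurable_cball R n B.
have key z : `|x - z| <= 1 -> `|convol eta w x - convol eta w z| <= L * I * `|x - z|.
  move=> xz; have zx : `|z| <= `|x| + 1.
    rewrite -[z](subKr x) (le_trans (ler_normB _ _))// lerD2l//.
  have toB u : `|u| <= `|x| + 1 -> convol eta w u = \int[mu]_(y in cball B) (eta (y - u) * w y).
    move=> ux; rewrite /convol [RHS]Rintegral_mkcond; apply: eq_Rintegral => y _.
    rewrite patchE; case: ifPn => // /negP; rewrite inE /cball /= => /negP.
    rewrite -ltNge => By; rewrite hN ?mul0r//.
    rewrite -(ltrD2r (`|x| + 1)) (lt_le_trans (_ : _ < `|y|))//; first by rewrite addrA.
    rewrite -[X in `|X| <= _](subrK u) (le_trans (ler_normD _ _))// lerD2l//.
  have iB u : mu.-integrable (cball B) (EFin \o (fun y => eta (y - u) * w y)).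
    by apply: integrableS (conv_integrable u teta lw).
  rewrite !toB// ?lerDl// -RintegralB//.
  have iBB : mu.-integrable (cball B) (EFin \o (fun y => eta (y - x) * w y - eta (y - z) * w y)).
    exact: (integrableB mB (iB x) (iB z)).
  rewrite (le_trans (le_normr_Rintegral _ _))//.
  have iw : mu.-integrable (cball B) (EFin \o (fun y => `|w y|)).
    exact: (integrable_norm (lw.2 B)).
  rewrite mulrAC -RintegralZl//; apply: le_Rintegral => //.
  - exact: (integrable_norm iBB).
  - exact: (integrableZl mB (L * `|x - z|) iw).
  - move=> y _; rewrite -mulrBl normrM ler_wpM2r//.
    rewrite (le_trans (hL _ _))// ler_wpM2l//.
    by rewrite opprB addrC addrA subrK distrC.
have LI : 0 < L * I + 1 by rewrite ltr_pwDr// mulr_ge0.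
exists (Num.min 1 (e / (L * I + 1))); first by rewrite lt_min ltr01 divr_gt0.
move=> z; rewrite lt_min => /andP[z1 ze].
rewrite (le_trans (key z (ltW z1)))//.
rewrite (@le_trans _ _ ((L * I + 1) * `|x - z|))//; first by rewrite ler_wpM2r// lerDl.
by rewrite mulrC -ler_pdivlMr// ltW.
Qed.

(** Every derivative falls on the kernel: up to sign it is again a convolution of [w] with a test
    function, so continuity at each order follows from [conv_continuous]. *)
Lemma conv_smooth eta w : test_function setT eta -> loc_int w -> smooth (convol eta w).
Proof.
move=> teta lw; apply/smoothP => k.
elim: k eta teta => [|k IH] eta teta; split; try exact: conv_continuous; try by [].
move=> i; have hd : forall x : 'rV[R]_n, is_derive x (e_ i) (convol eta w)
    ((cst (- 1) * convol (partial i eta) w) x).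
  by move=> x; rewrite fctE mulN1r; exact: is_derive_conv.
have [d ->] := partial_is_derive hd; split=> //.
apply: cont_diffM; first exact: cont_diff_cst.
by apply: IH; exact: test_function_partial.
Qed.

End convolution.

(** * The function [H], Euclidean norms, and mollifiers *)

Section mollifiers.
Context {R : realType}.

(* The j-th derivative of exp(-1/t) 1_(t > 0). *)
Definition flatn (j : nat) : R -> R := flat (iter j (@flat_next R) 1).

Lemma is_derive_flatn j (t : R) : is_derive t 1 (flatn j) (flatn j.+1 t).
Proof. exact: is_derive_flat. Qed.

Lemma flatn0E (t : R) : flatn 0 t = if 0 < t then expR (- t^-1) else 0.
Proof. by rewrite /flatn /flat /= hornerC mul1r. Qed.

Lemma flatn0_ge0 (t : R) : 0 <= flatn 0 t.
Proof. by rewrite flatn0E; case: ifPn => // _; rewrite expR_ge0. Qed.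

Lemma flatn0_le1 (t : R) : flatn 0 t <= 1.
Proof.
rewrite flatn0E; case: ifPn => // t0.
by rewrite -expR0 ler_expR oppr_le0 invr_ge0 ltW.
Qed.

Lemma flatn0_gt0 (t : R) : 0 < t -> 0 < flatn 0 t.
Proof. by move=> t0; rewrite flatn0E t0 expR_gt0. Qed.

Lemma flatn_le0 j (t : R) : t <= 0 -> flatn j t = 0.
Proof. by move=> t0; rewrite /flatn /flat ltNge t0. Qed.

Lemma flatn0_mono (s t : R) : s <= t -> flatn 0 s <= flatn 0 t.
Proof.
move=> st; have [s0|s0] := leP s 0; first by rewrite flatn_le0// flatn0_ge0.
rewrite !flatn0E s0 (lt_le_trans s0 st) ler_expR lerN2 lef_pV2// posrE//.
exact: lt_le_trans st.
Qed.

Lemma flatn1_ge0 (t : R) : 0 <= flatn 1 t.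
Proof.
rewrite /flatn /flat /= /flat_next derivC subr0 mulr1 hornerXn.
by case: ifPn => // _; rewrite mulr_ge0 ?expR_ge0 ?sqr_ge0.
Qed.

Lemma flatn_bounded j : exists2 C : R, 0 <= C & forall t, `|flatn j t| <= C.
Proof. exact: flat_bounded. Qed.

Lemma flatn_lipschitz j : exists2 L : R, 0 <= L &
  forall s t, `|flatn j s - flatn j t| <= L * `|s - t|.
Proof.
have [L L0 hL] := flatn_bounded j.+1; exists L => //.
have ch : continuous (flatn j).
  by move=> s; apply/differentiable_continuous/derivable1_diffP; have [] := is_derive_flatn j s.
have bound (a b : R) : a < b -> `|flatn j b - flatn j a| <= L * `|b - a|.
  move=> ab; have [c _ ->] := @MVT _ (flatn j) (flatn j.+1) a b ab
    (fun s _ => is_derive_flatn j s) (continuous_subspaceT ch).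
  by rewrite normrM ler_wpM2r.
move=> s t; have [st|ts|->] := ltgtP s t.
- by rewrite distrC [X in _ <= _ * X]distrC bound.
- by rewrite bound.
- by rewrite !subrr !normr0 mulr0.
Qed.

Lemma flatn_continuous j : continuous (flatn j).
Proof.
by move=> s; apply/differentiable_continuous/derivable1_diffP; have [] := is_derive_flatn j s.
Qed.

Context {n : nat}.
Implicit Types (eta : 'rV[R]_n -> R) (x y : 'rV[R]_n).
Local Notation mu := (@lebesgue_rV R n).

Lemma dot_ge0 x : 0 <= dot x x.
Proof. by apply: sumr_ge0 => i _; rewrite -expr2 sqr_ge0. Qed.

Lemma enorm_ge0 x : 0 <= enorm x.
Proof. exact: sqrtr_ge0. Qed.

Lemma sqr_enorm x : enorm x ^+ 2 = dot x x.
Proof. by rewrite sqr_sqrtr// dot_ge0. Qed.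

Lemma coord_le_enorm x i : `|x ord0 i| <= enorm x.
Proof.
rewrite -sqrtr_sqr ler_wsqrtr// /dot (bigD1 i)//= expr2 lerDl.
by apply: sumr_ge0 => j _; rewrite -expr2 sqr_ge0.
Qed.

Lemma norm_le_enorm x : `|x| <= enorm x.
Proof. by apply/rV_norm_leP => [|i]; [exact: enorm_ge0 | exact: coord_le_enorm]. Qed.

Lemma dot_le_norm x : dot x x <= n%:R * `|x| ^+ 2.
Proof.
rewrite /dot mulr_natl -[X in _ *+ X](card_ord n) -sumr_const; apply: ler_sum => i _.
by rewrite -expr2 -(real_normK (num_real (x ord0 i))) lerXn2r ?nnegrE// le_coord_norm.
Qed.

Lemma smooth_dot : smooth (fun x => dot x x : R).
Proof.
rewrite (_ : (fun x => _) = \sum_i ((fun x => x ord0 i) * (fun x => x ord0 i))).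
  elim/big_ind : _ => [|f g|i _]; first exact: (smooth_cst 0).
    exact: smoothD.
  by apply: smoothM; exact: smooth_coord.
by apply/funext => x; rewrite fct_sumE.
Qed.

(** The pointwise bound has a constant [C] common to all scales; it is what makes the mollification
    of an L^1 function O(eps^-n). Evenness serves the exchange of integrals in [integral_conv]. *)
Definition mollifier (eps C : R) eta :=
  [/\ test_function setT eta, (forall x, 0 <= eta x), (forall x, eta (- x) = eta x),
     \int[mu]_x eta x = 1 &
   (forall x, eps < `|x| -> eta x = 0) /\ (forall x, eta x <= C / eps ^+ n)].

Lemma mollifier_exists : exists2 C : R, 0 < C &
  forall eps : R, 0 < eps -> exists eta, mollifier eps C eta.
Proof.
pose h0 := flatn 0 (2^-1 : R).
have h00 : 0 < h0 by rewrite flatn0_gt0.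
pose k : R := (n.+1%:R^-1 + n.+1%:R^-1) ^+ n.
have k0 : 0 < k by rewrite exprn_gt0// addr_gt0.
exists (h0 * k)^-1; first by rewrite invr_gt0 mulr_gt0.
move=> eps eps0.
pose g x := flatn 0 (1 - dot x x / eps ^+ 2).
have e2 : 0 < eps ^+ 2 by rewrite exprn_gt0.
have g0 x : eps < `|x| -> g x = 0.
  move=> ex; rewrite /g flatn_le0// subr_le0 ler_pdivlMr// mul1r -sqr_enorm.
  by rewrite lerXn2r ?nnegrE ?enorm_ge0 ?(ltW eps0)// (le_trans (ltW ex))// norm_le_enorm.
have sg : smooth g.
  pose q : 'rV[R]_n -> R := cst 1 + cst (- eps ^- 2) * (fun x => dot x x).
  rewrite (_ : g = flatn 0 \o q); last first.
    by apply/funext => x; rewrite /g/= /q !fctE mulNr mulrC.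
  apply: smooth_comp; first exact: is_derive_flatn.
  apply: smoothD; first exact: smooth_cst.
  by apply: smoothM; [exact: smooth_cst | exact: smooth_dot].
have tg : test_function setT g.
  apply: (test_functionI (K := cball eps) sg) => //; first exact: compact_cball.
  by move=> x /negP; rewrite -ltNge; exact: g0.
have ig : mu.-integrable setT (EFin \o g).
  have := test_function_integrable tg (loc_int_cst 1).
  by under eq_fun do rewrite mulr1.
pose c := \int[mu]_x g x.
(* On the cube of half-side [eps / (n + 1)] one has [dot x x <= n * eps ^+ 2 / (n + 1) ^ 2], which
   AM-GM bounds by [eps ^+ 2 / 4]. So the argument of [flatn 0] is at least 1/2 there and [g >= h0];
   the cube has volume [k * eps ^+ n]. After normalisation this yields the constant
   [(h0 * k)^-1]. *)
have ck : h0 * k * eps ^+ n <= c.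
  pose r := eps / n.+1%:R.
  have r0 : 0 <= r by rewrite divr_ge0// ltW.
  have -> : h0 * k * eps ^+ n = \int[mu]_(x in cball r) h0.
    rewrite Rintegral_cst; last exact: measurable_cball.
    have cr : mu (cball r) = ((r + r) ^+ n)%:E by exact: lebesgue_rV_cball.
    have -> : fine (mu (cball r)) = (r + r) ^+ n by rewrite cr.
    rewrite -mulrA; congr (_ * _).
    by rewrite /k -exprMn /r mulrDl mulrC.
  have mr : measurable (cball r : set 'rV[R]_n) by exact: measurable_cball.
  rewrite Rintegral_mkcond; apply: le_Rintegral => //.
    rewrite (_ : EFin \o _ = (EFin \o cst h0) \_ (cball r)); last by rewrite restrict_EFin.
    apply/(integrable_mkcond _ mr).
    by have [_] := loc_int_cst (R := R) (n := n) h0; apply.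
  move=> x _; rewrite patchE; case: ifPn => [|_]; last exact: flatn0_ge0.
  rewrite inE /cball /= => xr; apply: flatn0_mono.
  rewrite lerBrDr -lerBrDl ler_pdivrMr//.
  apply: (le_trans (dot_le_norm x)).
  apply: (@le_trans _ _ (n%:R * r ^+ 2)).
    by rewrite ler_wpM2l// lerXn2r ?nnegrE.
  rewrite /r expr_div_n mulrCA mulrC ler_wpM2r ?(ltW e2)//.
  rewrite ler_pdivrMr ?exprn_gt0// -natrX.
  have n4 : (4 * n <= n.+1 ^ 2)%N by have [+ _] := nat_AGM2 n 1; rewrite muln1 addn1.
  have : (4 * n)%:R <= (n.+1 ^ 2)%:R :> R by rewrite ler_nat.
  have nn : 0 <= n%:R :> R by [].
  by rewrite natrM; move: (n%:R) ((n.+1 ^ 2)%:R) nn => u s u0 us; lra.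
have c0 : 0 < c by rewrite (lt_le_trans _ ck)// !mulr_gt0// exprn_gt0.
exists (fun x => c^-1 * g x); split.
- exact: (test_functionM (smooth_cst c^-1) tg).
- by move=> x; rewrite mulr_ge0 ?invr_ge0 ?(ltW c0)//; exact: flatn0_ge0.
- move=> x; rewrite /g; congr (_ * flatn 0 (_ - _ / _)).
  by apply: eq_bigr => i _; rewrite !mxE mulrNN.
- by rewrite RintegralZl// mulVf// gt_eqF.
split=> x; first by move=> /g0 ->; rewrite mulr0.
rewrite -invfM (@le_trans _ _ c^-1)//.
  by rewrite ler_piMr ?invr_ge0 ?(ltW c0)//; exact: flatn0_le1.
by rewrite lef_pV2// posrE !mulr_gt0// exprn_gt0.
Qed.

End mollifiers.

(** * Mollification in L^1 *)

Section translation_continuity.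
Context {R : realType} {n : nat}.
Implicit Types (A : set 'rV[R]_n) (x y z : 'rV[R]_n).
Local Notation mu := (@lebesgue_rV R n).

Definition shift_pre z A : set 'rV[R]_n := (fun x => x + z) @^-1` A.

Definition symd A z : set 'rV[R]_n :=
  (A `&` ~` shift_pre z A) `|` (shift_pre z A `&` ~` A).

Lemma measurable_shift_pre z A : measurable A -> measurable (shift_pre z A).
Proof. by move=> mA; rewrite -[X in measurable X]setTI; exact: measurable_rV_shift. Qed.

Lemma measurable_symd A z : measurable A -> measurable (symd A z).
Proof.
move=> mA; have mz := measurable_shift_pre z mA.
by apply: measurableU; apply: measurableI => //; exact: measurableC.
Qed.

(* The sets on which translation is continuous in measure, locally, form a
   sigma-algebra; it contains the half-spaces, hence is everything measurable. *)
Definition transl_cont A := measurable A /\ forall N e : R, 0 < e ->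
  exists2 d : R, 0 < d & forall z, `|z| < d -> (mu (cball N `&` symd A z) <= e%:E)%E.

Let mB (N : R) : measurable (cball N : set 'rV[R]_n).
Proof. exact: measurable_cball. Qed.

Lemma transl_cont_setC A : transl_cont A -> transl_cont (~` A).
Proof.
move=> [mA h]; split; first exact: measurableC.
move=> N e e0; have [d d0 hd] := h N e e0; exists d => // z /hd.
rewrite (_ : symd (~` A) z = symd A z)//.
rewrite /symd (_ : shift_pre z (~` A) = ~` shift_pre z A)//.
by rewrite !setCK setUC; congr (_ `|` _); rewrite setIC.
Qed.

Lemma transl_cont_setU A B : transl_cont A -> transl_cont B -> transl_cont (A `|` B).
Proof.
move=> [mA hA] [mB' hB]; split; first exact: measurableU.
move=> N e e0; have e20 : 0 < e / 2 by rewrite divr_gt0.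
have [d1 d10 h1] := hA N _ e20; have [d2 d20 h2] := hB N _ e20.
exists (Num.min d1 d2); first by rewrite lt_min d10.
move=> z; rewrite lt_min => /andP[z1 z2].
have mAz := measurable_symd z mA; have mBz := measurable_symd z mB'.
have mABz := measurable_symd z (measurableU _ _ mA mB').
rewrite (splitr e) EFinD.
apply: (le_trans _ (leeD (h1 z z1) (h2 z z2))).
apply: (le_trans _ (measureU2 _ _ _)); try exact: measurableI.
apply: le_measure; rewrite ?inE; try exact: measurableI.
  by apply: measurableU; exact: measurableI.
move=> x [Bx]; rewrite /symd/= => h.
have [xA|xA] := pselect (A x); have [xB|xB] := pselect (B x);
have [zA|zA] := pselect (shift_pre z A x); have [zB|zB] := pselect (shift_pre z B x);
rewrite /shift_pre /= in zA zB h *; tauto.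
Qed.

Lemma transl_cont_bigcup (F : nat -> set 'rV[R]_n) :
  (forall k, transl_cont (F k)) -> transl_cont (\bigcup_k F k).
Proof.
move=> hF; have mF k : measurable (F k) by have [] := hF k.
pose A := \bigcup_k F k; pose U J := \big[setU/set0]_(k < J) F k.
have mA : measurable A by exact: bigcupT_measurable.
have cU J : transl_cont (U J).
  elim: J => [|J IH]; rewrite /U ?big_ord0 ?big_ord_recr/=; last first.
    exact: transl_cont_setU.
  split => // N e e0; exists 1 => // z _.
  rewrite (_ : _ `&` _ = set0) ?measure0 ?lee_fin ?ltW//.
  by apply/seteqP; split => // x [_ [[]|[]]].
have mU J : measurable (U J) by have [] := cU J.
split=> // N e e0; have e30 : 0 < e / 3 by rewrite divr_gt0.
(* What the finite union [U J] misses, on a ball large enough to contain [cball N + z] for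
   [|z| < 1]. Its measure tends to 0 by continuity from above. It is counted twice, once translated,
   and the third [e / 3] goes to [U J] itself. *)
pose T J := cball (N + 1) `&` (A `\` U J).
have mT J : measurable (T J) by apply: measurableI => //; exact: measurableD.
have [J TJ] : exists J, (mu (T J) < (e / 3)%:E)%E.
  have T0 : \bigcap_J T J = set0.
    apply/seteqP; split=> // x h.
    have [_ [[k _ Fkx] _]] := h 0 I.
    have [_ [_]] := h k.+1 I; apply.
    by rewrite /U big_ord_recr /=; right.
  have cT : mu \o T @ \oo --> mu (\bigcap_J T J).
    apply: nonincreasing_cvg_mu => //.
    - apply: le_lt_trans (lebesgue_rV_cball_lty (n := n) (N + 1)).
      by apply: le_measure; rewrite ?inE//; exact: subIsetl.
    - by rewrite T0.
    - apply/nonincreasing_seqP => k; apply/subsetPset => x [Bx [Ax nU]].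
      split=> //; split=> // Ukx; apply: nU.
      by rewrite /U big_ord_recr /=; left.
  rewrite T0 measure0 in cT.
  have : nbhs (0%:E : \bar R) [set y | (y < (e / 3)%:E)%E].
    apply: open_nbhs_nbhs; split; first exact: open_ereal_lt_ereal.
    by rewrite /= lte_fin.
  by move/cT => [k _ hk]; exists k; apply: hk => /=.
have [_ /(_ N _ e30) [d d0 hd]] := cU J.
exists (Num.min d 1); first by rewrite lt_min d0 ltr01.
move=> z; rewrite lt_min => /andP[zd z1].
have sub : cball N `&` symd A z `<=`
    (cball N `&` symd (U J) z) `|` (T J `|` shift_pre z (T J)).
  have UA x : U J x -> A x.
    by rewrite /U -bigcup_mkord => -[k _ Fk]; exists k.
  move=> x [Bx]; have Bz : cball (N + 1) (x + z).
    rewrite /cball /= (le_trans (ler_normD _ _))// lerD// ltW//.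
  have Bx1 : cball (N + 1) x by rewrite /cball /= (le_trans Bx)// lerDl.
  rewrite /symd /shift_pre /T /= => -[[Ax nAz]|[Az nAx]].
    have [Ux|nUx] := pselect (U J x); last by right; left.
    by left; split=> //; left; split=> // /UA.
  have [Uz|nUz] := pselect (U J (x + z)); last by right; right.
  by left; split=> //; right; split=> // /UA.
have mUz := measurable_symd z (mU J).
have mTz := measurable_shift_pre z (mT J).
have m1 : measurable (cball N `&` symd (U J) z) by exact: measurableI.
have m2 : measurable (T J `|` shift_pre z (T J)) by exact: measurableU.
apply: (@le_trans _ _ (mu (cball N `&` symd (U J) z) + (mu (T J) + mu (shift_pre z (T J))))%E).
  apply: (@le_trans _ _ (mu ((cball N `&` symd (U J) z) `|` (T J `|` shift_pre z (T J))))).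
    apply: le_measure => //; rewrite inE; last exact: measurableU.
    by apply: measurableI => //; exact: measurable_symd.
  apply: (le_trans (measureU2 _ m1 m2)).
  by apply: leeD => //; exact: measureU2.
have -> : mu (shift_pre z (T J)) = mu (T J) by exact: lebesgue_rV_shift.
have -> : e = e / 3 + (e / 3 + e / 3) by lra.
by rewrite !EFinD; apply: leeD; [exact: hd | apply: leeD; exact: ltW].
Qed.

Let rayE i (b : R) : [set x : 'rV[R]_n | b < x ord0 i] =
  (fun x : 'rV[R]_n => x ord0 i) @^-1` `]b, +oo[%classic.
Proof. by apply/seteqP; split => x /=; rewrite in_itv/= andbT. Qed.

(** Where the half-space and its translate differ, the coordinate [i] is within [|z|] of [a]. Inside
    the cube this confines the point to a thin box of volume [(|z| + |z|) * K], with [K] the product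
    of the other sides. *)
Lemma transl_cont_ray i (a : R) : transl_cont [set x | a < x ord0 i].
Proof.
have mR (b : R) : measurable [set x : 'rV[R]_n | b < x ord0 i].
  rewrite rayE -[X in measurable X]setTI.
  by apply: (measurable_coord (T:=measurableTypeR R) i) => //; exact: measurable_itv.
split; [exact: mR | move=> N e e0].
pose N' := Num.max N 0.
pose K : R := \prod_(j < n | j != i) (N' + N').
have K0 : 0 <= K by apply: prodr_ge0 => j _; rewrite addr_ge0// le_max lexx orbT.
exists (e / ((K + 1) *+ 2)); first by rewrite divr_gt0// pmulrn_lgt0// ltr_pwDr.
move=> z zd.
pose B (t : R) (j : 'I_n) : set R := if j == i then `[a - t, a + t]%classic else `[- N', N']%classic.
have mBj t j : measurable (B t j) by rewrite /B; case: ifPn.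
have Bt (t : R) : 0 <= t -> mu [set x | forall j, B t j (x ord0 j)] = ((t + t) * K)%:E.
  move=> t0; rewrite lebesgue_rV_box//.
  rewrite (bigD1 i)//= {1}/B eqxx.
  rewrite lebesgue_measure_itv/= lte_fin.
  rewrite (_ : (if _ then _ else _) = (t + t)%:E); last first.
    case: ifPn => [_|]; first by rewrite -EFinB; congr EFin; lra.
    by rewrite -leNgt => h; congr EFin; lra.
  rewrite EFinM; congr (_ * _)%E.
  rewrite /K -prodEFin; apply: eq_bigr => j ji.
  rewrite /B (negbTE ji) lebesgue_measure_itv/= lte_fin.
  case: ifPn => [_|]; first by rewrite -EFinB opprK.
  have N0 : 0 <= N' by rewrite le_max lexx orbT.
  by rewrite -leNgt => h; congr EFin; lra.
have mBox : measurable [set x : 'rV[R]_n | forall j, B `|z| j (x ord0 j)].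
  rewrite (_ : mkset _ = \bigcap_(j in [set: 'I_n])
      ((fun x : 'rV[R]_n => x ord0 j) @^-1` B `|z| j)); last first.
    by apply/seteqP; split => x /= h j; [move=> _|]; exact: h.
  apply: fin_bigcap_measurable => //.
  move=> j _; rewrite -[X in measurable X]setTI.
  by apply: (measurable_coord (T:=measurableTypeR R) j) => //; exact: mBj.
apply: (@le_trans _ _ (mu [set x | forall j, B `|z| j (x ord0 j)])).
  apply: le_measure; rewrite ?inE.
  - by apply: measurableI; [exact: mB | apply: measurable_symd; exact: mR].
  - exact: mBox.
  - move=> x [xN]; rewrite /symd /shift_pre /= => h j.
    rewrite /B; case: ifPn => [/eqP ->|ji]; last first.
      rewrite /= in_itv/= -ler_norml (le_trans (le_coord_norm _ _))//.
      by rewrite le_max; apply/orP; left.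
    rewrite /= in_itv/=; have := le_coord_norm z i; rewrite ler_norml => /andP[z1 z2].
    move: h; rewrite !mxE => -[[h1 /negP]|[h1 /negP]]; rewrite -leNgt => h2;
    move: z1 z2 h1 h2; move: (x ord0 i) (z ord0 i) `|z| => u s t z1 z2 h1 h2;
    by apply/andP; split; lra.
rewrite Bt// lee_fin.
have zK : `|z| * ((K + 1) *+ 2) < e by rewrite -ltr_pdivlMr// pmulrn_lgt0// ltr_pwDr.
apply: ltW; apply: le_lt_trans zK.
by move: (normr_ge0 z); move: `|z| => t t0; rewrite mulr2n; nra.
Qed.

Lemma measurable_transl_cont A : measurable A -> transl_cont A.
Proof.
have sG : sigma_algebra setT transl_cont.
  split.
  - split => // N e e0; exists 1 => // z _.
    rewrite (_ : _ `&` _ = set0) ?measure0 ?lee_fin ?ltW//.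
    by apply/seteqP; split => // x [_ [[]|[]]].
  - by move=> B; rewrite setTD; exact: transl_cont_setC.
  - by move=> F; exact: transl_cont_bigcup.
suff : @measurable _ 'rV[R]_n `<=` transl_cont by apply.
apply: smallest_sub => //.
rewrite -bigcup_seq; apply: bigcup_sub => i _ _ [Y mY <-]; rewrite setTI.
suff : @measurable _ (measurableTypeR R) `<=`
    [set Y : set R | transl_cont ((fun x => x ord0 i) @^-1` Y)] by apply.
rewrite RGenOInfty.measurableE; apply: smallest_sub.
  split.
  - by rewrite /= preimage_set0; case: sG.
  - move=> B /= hB; rewrite setTD preimage_setC; exact: transl_cont_setC.
  - by move=> F hF /=; rewrite preimage_bigcup; exact: transl_cont_bigcup.
move=> _ [r ->] /=.
have : transl_cont ((fun x : 'rV[R]_n => x ord0 i) @^-1` `]r, +oo[%classic).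
  by rewrite -rayE; exact: transl_cont_ray.
exact.
Qed.

End translation_continuity.

Section translation_continuity_L1.
Context {R : realType} {n : nat}.
Implicit Types (A : set 'rV[R]_n) (x y z : 'rV[R]_n) (F : 'rV[R]_n -> R).
Local Notation mu := (@lebesgue_rV R n).

Lemma transl_cont_finite (A : nat -> set 'rV[R]_n) (N e : R) J : 0 < e ->
  (forall j, measurable (A j)) ->
  exists2 d : R, 0 < d & forall z, `|z| < d -> forall j, (j < J)%N ->
    (mu (cball N `&` symd (A j) z) <= e%:E)%E.
Proof.
move=> e0 mA; elim: J => [|J [d d0 hd]]; first by exists 1.
have [d' d'0 hd'] := (measurable_transl_cont (mA J)).2 N e e0.
exists (Num.min d d'); first by rewrite lt_min d0.
move=> z; rewrite lt_min => /andP[zd zd'] j; rewrite ltnS leq_eqVlt => /predU1P[->|jJ].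
  exact: hd'.
exact: hd.
Qed.

(** Two values in [[-M, M]] more than [delta] apart are separated by one of finitely many grid
    levels; the first level above [a] is obtained by truncating [(a + M) / delta]. *)
Lemma transl_step (M delta : R) (a b : R) (J : nat) : 0 < delta ->
  M *+ 2 < J%:R * delta ->
  - M <= a -> b <= M -> a + delta < b ->
  exists j : 'I_J, a <= - M + j%:R * delta /\ - M + j%:R * delta < b.
Proof.
move=> d0 MJ Ma bM ab.
have t0 : 0 <= (a + M) / delta by rewrite divr_ge0 ?(ltW d0)//; lra.
have /andP[t1 t2] := truncn_itv t0.
set k := Num.truncn _ in t1 t2.
rewrite ler_pdivlMr// in t1; rewrite ltr_pdivrMr// in t2.
have kk : k.+1%:R * delta = k%:R * delta + delta by rewrite -natr1 mulrDl mul1r.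
have kJ : (k.+1 < J)%N.
  rewrite -(ltr_nat R) -(ltr_pM2r d0) kk; rewrite mulr2n in MJ.
  by move: (k%:R * delta) (J%:R * delta) t1 MJ => u w ? ?; lra.
exists (Ordinal kJ) => /=; rewrite kk; rewrite kk in t2.
by move: (k%:R * delta) t1 t2 => u ? ?; split; lra.
Qed.

(** If [F] jumps by more than [delta] between [x] and [x + z], then by [transl_step] [x] lies in the
    symmetric difference of some level set [A j] with its translate. Hence the integrand is at most
    [delta] on [Q] plus [2 M] on finitely many such sets, whose measures [transl_cont_finite] makes
    small. Outside [Q] both values vanish as [|z| < 1]. *)
Lemma L1_translation_continuity F (M N : R) : measurable_fun setT F ->
  (forall x, `|F x| <= M) -> (forall x, N < `|x| -> F x = 0) ->
  forall e : R, 0 < e -> exists2 d : R, 0 < d & forall z, `|z| < d ->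
    (\int[mu]_x `|F (x + z)%R - F x|%:E <= e%:E)%E.
Proof.
move=> mF FM FN e e0.
have M0 : 0 <= M by rewrite (le_trans _ (FM 0)).
pose Q : set 'rV[R]_n := cball (N + 1).
have mQ : measurable Q by exact: measurable_cball.
have Qfin : mu Q \is a fin_num.
  by rewrite ge0_fin_numE//; exact: lebesgue_rV_cball_lty.
pose v := fine (mu Q).
have v0 : 0 <= v by rewrite fine_ge0.
pose delta := e / 2 / (v + 1).
have d0 : 0 < delta by rewrite !divr_gt0// ltr_pwDr.
pose J := (Num.truncn (M *+ 2 / delta)).+1.
have MJ : M *+ 2 < J%:R * delta.
  rewrite -ltr_pdivrMr//; exact: truncnS_gt.
pose A j := [set x | - M + j%:R * delta < F x].
have mA j : measurable (A j).
  rewrite (_ : A j = F @^-1` [set` `] - M + j%:R * delta, +oo[]); last first.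
    by apply/seteqP; split=> x; rewrite /A /= in_itv/= andbT.
  by rewrite -[X in measurable X]setTI; apply: mF.
pose e' := e / 2 / ((M *+ 2 + 1) * J%:R).
have e'0 : 0 < e'.
  by rewrite !divr_gt0// mulr_gt0// ltr_pwDr// mulrn_wge0.
have [d1 d10 hd1] := @transl_cont_finite A (N + 1) e' J e'0 mA.
exists (Num.min d1 1); first by rewrite lt_min d10 ltr01.
move=> z; rewrite lt_min => /andP[/hd1 {}hd1 z1].
pose S (j : 'I_J) := Q `&` symd (A j) z.
have mS j : measurable (S j) by apply: measurableI => //; exact: measurable_symd.
pose G x : \bar R := (delta%:E * (\1_Q x)%:E + (M *+ 2)%:E * \sum_(j < J) (\1_(S j) x)%:E)%E.
have mF' : measurable_fun setT (fun x => F (x + z)).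
  exact: (measurableT_comp mF (measurable_rV_shift z)).
have m2 j : measurable_fun setT (fun x => (\1_(S j) x)%:E : \bar R).
  by apply/measurable_EFinP; exact: measurable_indic.
have m1 : measurable_fun setT (fun x => (\1_Q x)%:E : \bar R).
  by apply/measurable_EFinP; exact: measurable_indic.
have m3 : measurable_fun setT (fun x => \sum_(j < J) (\1_(S j) x)%:E : \bar R)%E.
  exact: emeasurable_fun_sum.
have M20 : 0 <= M *+ 2 by rewrite mulrn_wge0.
apply: (@le_trans _ _ (\int[mu]_x G x)%E).
  apply: ge0_le_integral => //.
  - by apply/measurable_EFinP; apply: measurableT_comp => //; exact: measurable_funB.
  - by apply: emeasurable_funD; apply: measurable_funeM.
  move=> x _.
  have sum0 : (0 <= \sum_(j < J) \1_(S j) x :> R) by apply: sumr_ge0.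
  rewrite /G sumEFin -!EFinM -EFinD lee_fin.
  have [Qx|nQx] := pselect (Q x); last first.
    have Nx : N + 1 < `|x| by rewrite ltNge; apply/negP.
    rewrite !FN ?subrr ?normr0.
    - by rewrite addr_ge0// mulr_ge0// ltW.
    - by rewrite (lt_trans _ Nx)// ltrDl.
    - rewrite -(ltrD2r 1) (lt_le_trans Nx)//.
      rewrite -[X in `|X| <= _](addrK z) (le_trans (ler_normB _ _))// lerD2l ltW//.
  rewrite indicE mem_set// mulr1.
  have [small|big] := leP `|F (x + z) - F x| delta.
    by rewrite (le_trans small)// lerDl mulr_ge0.
  have dM : `|F (x + z) - F x| <= M *+ 2.
    by rewrite (le_trans (ler_normB _ _))// mulr2n lerD.
  suff [j Sj] : exists j, S j x.
    rewrite (le_trans dM)// ler_wpDl ?(ltW d0)// ler_peMr//.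
    rewrite (bigD1 j)//= indicE mem_set// lerDl; apply: sumr_ge0 => //.
  have FMx y : - M <= F y <= M by rewrite -ler_norml.
  have /andP[x1 x2] := FMx x; have /andP[z2 z3] := FMx (x + z).
  move: big; rewrite lter_normr opprB => /orP[big|big].
    have [|j [j1 j2]] := transl_step d0 MJ x1 z3; first by rewrite addrC -ltrBrDr.
    exists j; split=> //; right; split=> //; rewrite /A /=.
    by apply/negP; rewrite -leNgt.
  have [|j [j1 j2]] := transl_step d0 MJ z2 x2; first by rewrite addrC -ltrBrDr.
  exists j; split=> //; left; split=> //; rewrite /A /shift_pre /=.
  by apply/negP; rewrite -leNgt.
rewrite /G ge0_integralD//; last 4 first.
- by move=> x _; rewrite mule_ge0 ?lee_fin ?(ltW d0).
- exact: measurable_funeM.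
- move=> x _; rewrite mule_ge0 ?lee_fin//.
  by apply: sume_ge0 => j _; rewrite lee_fin.
- exact: measurable_funeM.
rewrite ge0_integralZl_EFin ?(ltW d0)//.
rewrite ge0_integralZl_EFin//; last first.
  by move=> x _; apply: sume_ge0 => j _; rewrite lee_fin.
rewrite ge0_integral_sum//.
rewrite integral_indic// setIT [X in (delta%:E * X)%E](_ : _ = v%:E); last by rewrite /v fineK.
rewrite [X in (_ <= X)%E](_ : _ = ((e / 2)%:E + (e / 2)%:E)%E); last by rewrite -EFinD -splitr.
apply: leeD.
  rewrite -EFinM lee_fin /delta mulrAC ler_pdivrMr ?ltr_pwDr//.
  by rewrite ler_wpM2l ?divr_ge0 ?(ltW e0)// lerDl.
apply: (@le_trans _ _ ((M *+ 2)%:E * \sum_(j < J) e'%:E))%E.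
  rewrite lee_wpmul2l ?lee_fin//; apply: lee_sum => j _.
  by rewrite integral_indic// setIT; exact: hd1.
rewrite sumEFin -EFinM lee_fin sumr_const card_ord -[e' *+ _]mulr_natr.
have -> : e' * J%:R = e / 2 / (M *+ 2 + 1).
  by rewrite /e' invfM !mulrA mulfVK// pnatr_eq0.
rewrite mulrCA ler_piMr ?divr_ge0 ?(ltW e0)//.
by rewrite ler_pdivrMr ?ltr_pwDr// mul1r lerDl.
Qed.

End translation_continuity_L1.

(** * Mollification in the modular *)

Section powers.
Context {R : realType}.
Implicit Types (s t a b q P : R).

Lemma powR_le1 s q : 0 <= s <= 1 -> 0 <= q -> s `^ q <= 1.
Proof.
by move=> /andP[s0 s1] q0; rewrite -[leRHS]/((fun=> 1) q) -powR1 ge0_ler_powR// nnegrE.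
Qed.

Lemma powR_ge1 s q : 1 <= s -> 0 <= q -> 1 <= s `^ q.
Proof. by move=> s1 q0; rewrite -(powRr0 s) ler_powR. Qed.

Lemma powR_scale_le (c t q P : R) : 0 <= c -> 0 <= t -> 1 <= q -> q <= P ->
  (c * t) `^ q <= (1 + c) `^ P * t `^ q.
Proof.
move=> c0 t0 q1 qP; rewrite powRM// ler_wpM2r ?powR_ge0//.
apply: (@le_trans _ _ ((1 + c) `^ q)).
  by rewrite ge0_ler_powR ?nnegrE ?addr_ge0// ?lerDr// (le_trans _ q1).
by rewrite ler_powR// lerDl.
Qed.

Lemma powR_add3_le a b (c : R) q P : 0 <= a -> 0 <= b -> 0 <= c -> 1 <= q -> q <= P ->
  (a + b + c) `^ q <= 3 `^ P * (a `^ q + b `^ q + c `^ q).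
Proof.
move=> a0 b0 c0 q1 qP.
have q0 : 0 <= q by rewrite (le_trans _ q1).
have h (m : R) : 0 <= m -> a <= m -> b <= m -> c <= m ->
    m `^ q <= a `^ q + b `^ q + c `^ q ->
    (a + b + c) `^ q <= 3 `^ P * (a `^ q + b `^ q + c `^ q).
  move=> m0 am bm cm hm.
  apply: (@le_trans _ _ ((3 * m) `^ q)).
    by rewrite ge0_ler_powR ?nnegrE ?addr_ge0 ?mulr_ge0//; lra.
  rewrite powRM// (@le_trans _ _ (3 `^ P * m `^ q))//.
    by rewrite ler_wpM2r ?powR_ge0// ler_powR// ler1n.
  by rewrite ler_wpM2l// powR_ge0.
have ha := powR_ge0 a q; have hb := powR_ge0 b q; have hc := powR_ge0 c q.
have [ab|/ltW ba] := leP a b; have [bc|/ltW cb] := leP b c; have [ac|/ltW ca] := leP a c.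
- by apply: (h c) => //; lra.
- by apply: (h c) => //; lra.
- by apply: (h b) => //; lra.
- by apply: (h b) => //; lra.
- by apply: (h c) => //; lra.
- by apply: (h a) => //; lra.
- by apply: (h a) => //; lra.
- by apply: (h a) => //; lra.
Qed.

Lemma powR_add_le a b q P : 0 <= a -> 0 <= b -> 1 <= q -> q <= P ->
  (a + b) `^ q <= 3 `^ P * (a `^ q + b `^ q).
Proof.
move=> a0 b0 q1 qP; have := powR_add3_le a0 b0 (lexx 0) q1 qP.
by rewrite !addr0 [0 `^ q]powR0 ?addr0// gt_eqF// (lt_le_trans _ q1).
Qed.

(* The variable-exponent substitute for Jensen's inequality: taking T = T(y),
   s = (eta * T)(x) and averaging over y bounds s `^ q by the average of
   T(y) `^ q', as soon as s `^ `|q - q'| stays bounded. *)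
Lemma powR_young_variable s t q q' P (C : R) : 0 <= s -> t = 0 \/ 1 <= t ->
  1 < q -> 1 < q' -> q <= P -> q' <= P -> 1 <= C ->
  (1 <= s -> s `^ `|q - q'| <= C) ->
  t * s `^ (q - 1) <= s `^ q / 2 + C * 2 `^ P * t `^ q'.
Proof.
move=> s0 [->|t1] q1 q'1 qP q'P C1 hC.
  rewrite mul0r addr_ge0 ?divr_ge0 ?mulr_ge0 ?powR_ge0//.
  exact: le_trans C1.
have t0 : 0 <= t by rewrite (le_trans _ t1).
have P0 : 1 <= 2 `^ P by apply: powR_ge1; [rewrite ler1n|lra].
have C0 : 0 <= C by rewrite (le_trans _ C1).
(* If [t <= s / 2] the first summand suffices. Otherwise [s < 2 * t]: for [s <= 1] the bound
   [t <= t]^ q'[is enough, and for]s >= 1[the splitting]q - 1 = (q - q') + (q' -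
   1)[leaves a factor at most]C[times](2 * t) [^ (q' - 1)]. *)
have [ts|st] := leP t (s / 2).
  rewrite ler_wpDr ?mulr_ge0 ?powR_ge0//.
  rewrite -(mulr_powRB1 s0 (lt_trans ltr01 q1)) mulrAC ler_wpM2r ?powR_ge0//.
rewrite ler_wpDl ?divr_ge0 ?powR_ge0//.
have tq : t `^ q' = t * t `^ (q' - 1) by rewrite mulr_powRB1// (lt_trans ltr01).
have [s1|/ltW s1] := leP s 1.
  apply: (@le_trans _ _ t).
    by rewrite ler_piMr// powR_le1 ?s0// subr_ge0 ltW.
  apply: (@le_trans _ _ (t `^ q')); first exact: (le1r_powR t1 (ltW q'1)).
  by rewrite ler_peMl ?powR_ge0// mulr_ege1.
have -> : q - 1 = (q - q') + (q' - 1) by rewrite addrA subrK.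
have sn0 : s != 0 by rewrite gt_eqF// (lt_le_trans ltr01).
rewrite powRD; last by rewrite sn0 implybT.
rewrite tq [X in _ <= X]mulrCA ler_wpM2l//.
rewrite -!mulrA ler_pM ?powR_ge0//.
  by apply: le_trans (hC s1); apply: ler_powR => //; exact: ler_norm.
apply: (@le_trans _ _ ((2 * t) `^ (q' - 1))).
  by rewrite ge0_ler_powR ?nnegrE ?subr_ge0 ?(ltW q'1) ?mulr_ge0//; lra.
rewrite powRM// ler_wpM2r ?powR_ge0// ler_powR ?ler1n//; lra.
Qed.

(** The power of [eps] stays bounded because [eps * ln (eps^-1) <= 1], an instance of
    [ln (1 + x) <= x]. *)
Lemma powR_eps_bounded (A L eps : R) (n : nat) : 1 <= A -> 0 <= L ->
  0 < eps -> eps <= 1 ->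
  (A / eps ^+ n) `^ (L * eps) <= A `^ L * expR (L * n%:R).
Proof.
move=> A1 L0 e0 e1; have A0 : 0 <= A by rewrite (le_trans _ A1).
rewrite powRM//; last by rewrite invr_ge0 exprn_ge0// ltW.
rewrite ler_pM ?powR_ge0//.
  by rewrite ler_powR// ler_piMr.
rewrite /powR gt_eqF ?invr_gt0 ?exprn_gt0// ler_expR.
rewrite lnV ?posrE ?exprn_gt0// lnXn// -mulrA ler_wpM2l// -mulNrn mulrnAr -mulr_natl ler_piMr//.
rewrite -lnV// mulrC -ler_pdivlMr// mul1r.
have -> : eps^-1 = 1 + (eps^-1 - 1) by rewrite addrC subrK.
apply: (le_trans (le_ln1Dx _)); last by rewrite lerDr.
by rewrite ltrBrDl subrr invr_gt0.
Qed.

(** Turns L^1 convergence of uniformly bounded functions into convergence in the modular. *)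
Lemma powR_le_linear (t M q P : R) : 1 <= M -> 0 <= t -> t <= M -> 1 < q -> q <= P ->
  t `^ q <= M `^ P * t.
Proof.
move=> M1 t0 tM q1 qP.
rewrite -(mulr_powRB1 t0 (lt_trans ltr01 q1)) mulrC ler_wpM2r//.
apply: (@le_trans _ _ (M `^ (q - 1))).
  by rewrite ge0_ler_powR ?nnegrE ?subr_ge0 ?(ltW q1)// (le_trans t0).
by rewrite ler_powR//; lra.
Qed.

End powers.

Section mollification.
Context {R : realType} {n : nat}.
Implicit Types (eta w F T : 'rV[R]_n -> R) (x y z : 'rV[R]_n) (eps C : R).
Local Notation mu := (@lebesgue_rV R n).

Lemma measurable_rV_sub :
  measurable_fun setT (fun q : 'rV[R]_n * 'rV[R]_n => q.2 - q.1).
Proof.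
apply: measurable_fun_coordP => i; under eq_fun do rewrite !mxE.
apply: measurable_funB.
  exact: (measurableT_comp (measurable_coord (T:=measurableTypeR R) i) measurable_snd).
exact: (measurableT_comp (measurable_coord (T:=measurableTypeR R) i) measurable_fst).
Qed.

Lemma measurable_rV_add :
  measurable_fun setT (fun q : 'rV[R]_n * 'rV[R]_n => q.2 + q.1).
Proof.
apply: measurable_fun_coordP => i; under eq_fun do rewrite !mxE.
apply: measurable_funD.
  exact: (measurableT_comp (measurable_coord (T:=measurableTypeR R) i) measurable_snd).
exact: (measurableT_comp (measurable_coord (T:=measurableTypeR R) i) measurable_fst).
Qed.

Lemma conv_measurable eta w : test_function setT eta -> loc_int w ->
  measurable_fun setT (convol eta w).
Proof. by move=> teta lw; apply: continuous_rV_measurable; exact: conv_continuous. Qed.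

Lemma EFin_conv eta w x : test_function setT eta -> loc_int w ->
  ((convol eta w x)%:E = \int[mu]_y (eta (y - x) * w y)%:E)%E.
Proof.
move=> teta lw; rewrite /convol /Rintegral fineK//.
by apply: integrable_fin_num => //; exact: conv_integrable.
Qed.

Lemma mollifier_integrable eps C eta : mollifier eps C eta ->
  mu.-integrable setT (EFin \o eta).
Proof.
move=> [teta _ _ _ _].
have := test_function_integrable teta (loc_int_cst 1).
by under eq_fun do rewrite mulr1.
Qed.

Lemma EFin_mollifier eps C eta : mollifier eps C eta ->
  (\int[mu]_y (eta y)%:E = 1%:E)%E.
Proof.
move=> me; have [_ _ _ h _] := me.
rewrite -h /Rintegral fineK//.
by apply: integrable_fin_num => //; exact: mollifier_integrable me.
Qed.

Lemma EFin_mollifier_shift eps C eta x : mollifier eps C eta ->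
  (\int[mu]_y (eta (y - x))%:E = 1%:E)%E.
Proof.
move=> me; rewrite -(EFin_mollifier me).
have [teta e0 _ _ _] := me.
apply: (ge0_integral_rV_shift (- x) (f := EFin \o eta)).
  by apply/measurable_EFinP; exact: test_function_measurable teta.
by move=> y; rewrite lee_fin.
Qed.

(** Tonelli; evenness of [eta] identifies the inner integral over [x] with a translated integral of
    [eta], which is 1. *)
Lemma integral_conv eps C eta w : mollifier eps C eta -> loc_int w ->
  (forall y, 0 <= w y) ->
  (\int[mu]_x (convol eta w x)%:E = \int[mu]_y (w y)%:E)%E.
Proof.
move=> me lw w0; have [teta e0 ev _ _] := me.
have [mw _] := lw.
have meta := test_function_measurable teta.
under eq_integral do rewrite EFin_conv//.
pose f (q : 'rV[R]_n * 'rV[R]_n) := (eta (q.2 - q.1) * w q.2)%:E : \bar R.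
have mf : measurable_fun setT f.
  apply/measurable_EFinP; apply: measurable_funM.
    exact: (measurableT_comp meta measurable_rV_sub).
  exact: (measurableT_comp mw measurable_snd).
have f0 q : (0 <= f q)%E by rewrite lee_fin mulr_ge0.
transitivity (\int[mu]_y \int[mu]_x f (x, y))%E.
  exact: (fubini_tonelli f mf f0).
apply: eq_integral => y _; rewrite /f /=.
under eq_integral do rewrite EFinM muleC -opprB ev.
rewrite ge0_integralZl_EFin//.
- by rewrite (EFin_mollifier_shift y me) mule1.
- by move=> x _; rewrite lee_fin.
- apply/measurable_EFinP.
  exact: (measurableT_comp meta (measurable_rV_shift (- y))).
Qed.

Lemma conv_ge0 eps C eta w x : mollifier eps C eta -> (forall y, 0 <= w y) ->
  0 <= convol eta w x.
Proof. by move=> [_ e0 _ _ _] w0; apply: Rintegral_ge0 => y _; rewrite mulr_ge0. Qed.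

Lemma conv_norm_le eps C eta w x : mollifier eps C eta -> loc_int w ->
  `|convol eta w x| <= convol eta (fun y => `|w y|) x.
Proof.
move=> [teta e0 _ _ _] lw.
rewrite (le_trans (le_normr_Rintegral _ (conv_integrable x teta lw)))//.
by rewrite le_eqVlt; apply/orP; left; apply/eqP; apply: eq_Rintegral => y _; rewrite normrM ger0_norm.
Qed.

Lemma convD eta w1 w2 x : test_function setT eta -> loc_int w1 -> loc_int w2 ->
  convol eta (fun y => w1 y + w2 y) x = convol eta w1 x + convol eta w2 x.
Proof.
move=> teta l1 l2; rewrite /convol -RintegralD//; try exact: conv_integrable.
by apply: eq_Rintegral => y _; rewrite mulrDr.
Qed.

(** [convol eta F - F] is an average, with weight [eta z], of the differences [F (x + z) - F x].
    After Tonelli each [z] in the support contributes at most [e * eta z], by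
    [L1_translation_continuity]. *)
Lemma mollify_bounded C F (M N : R) : measurable_fun setT F ->
  (forall x, `|F x| <= M) -> (forall x, N < `|x| -> F x = 0) ->
  forall e : R, 0 < e -> exists2 d : R, 0 < d & forall eps eta, eps < d ->
    mollifier eps C eta -> (\int[mu]_x `|convol eta F x - F x|%:E <= e%:E)%E.
Proof.
move=> mF FM FN e e0.
have [d d0 hd] := L1_translation_continuity mF FM FN e0.
exists d => // eps eta epsd me.
have [teta eta0 ev int1 [sup _]] := me.
have meta := test_function_measurable teta.
have lF : loc_int F.
  split=> // K; apply: measurable_bounded_integrable => //.
  - exact: measurable_cball.
  - exact: lebesgue_rV_cball_lty.
  - exact: measurable_funTS.
  - by exists M; split=> [|M' MM' y _ /=]; [exact: num_real | rewrite (le_trans (FM y))// ltW].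
pose f (q : 'rV[R]_n * 'rV[R]_n) := (eta q.2 * `|F (q.2 + q.1) - F q.1|)%:E : \bar R.
have mf : measurable_fun setT f.
  apply/measurable_EFinP; apply: measurable_funM.
    exact: (measurableT_comp meta measurable_snd).
  apply: measurableT_comp => //; apply: measurable_funB.
    exact: (measurableT_comp mF measurable_rV_add).
  exact: (measurableT_comp mF measurable_fst).
have f0 q : (0 <= f q)%E by rewrite lee_fin mulr_ge0.
have step x : (`|convol eta F x - F x|%:E <= \int[mu]_z f (x, z))%E.
  have i1 := conv_integrable x teta lF.
  have i2 : mu.-integrable setT (EFin \o (fun y => eta (y - x) * F x)).
    exact: (conv_integrable x teta (loc_int_cst (F x))).
  have i3 : mu.-integrable setT (EFin \o (fun y => eta (y - x) * F y - eta (y - x) * F x)).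
    exact: (integrableB measurableT i1 i2).
  have FE : F x = \int[mu]_y (eta (y - x) * F x).
    rewrite RintegralZr//; last first.
      have := conv_integrable x teta (loc_int_cst 1).
      by under eq_fun do rewrite mulr1.
    by rewrite /Rintegral (EFin_mollifier_shift x me)/= mul1r.
  have -> : convol eta F x - F x = \int[mu]_y (eta (y - x) * F y - eta (y - x) * F x).
    by rewrite RintegralB// -FE.
  rewrite EFin_normr_Rintegral//.
  apply: (le_trans (le_abse_integral _ _ _)) => //.
    exact: (measurable_int mu i3).
  have mh := measurableT_comp (@abse_measurable R setT) (measurable_int mu i3).
  rewrite -(ge0_integral_rV_shift x mh)//.
    rewrite le_eqVlt; apply/orP; left; apply/eqP; apply: eq_integral => z _.
    by rewrite /f /= addrK -mulrBr normrM ger0_norm.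
  by move=> y; exact: abse_ge0.
apply: (@le_trans _ _ (\int[mu]_x \int[mu]_z f (x, z))%E).
  apply: ge0_le_integral => //.
  - apply/measurable_EFinP; apply: measurableT_comp => //; apply: measurable_funB => //.
    exact: conv_measurable.
  - by apply: measurable_fun_fubini_tonelli_F.
rewrite fubini_tonelli//.
apply: (@le_trans _ _ (\int[mu]_z (e%:E * (eta z)%:E))%E); last first.
  rewrite ge0_integralZl_EFin ?(ltW e0)//.
  - by rewrite (EFin_mollifier me) mule1.
  - by move=> z _; rewrite lee_fin.
  - exact/measurable_EFinP.
apply: ge0_le_integral => //.
- by move=> z _; apply: integral_ge0.
- by apply: measurable_fun_fubini_tonelli_G.
- by apply: measurable_funeM; exact/measurable_EFinP.
move=> z _; rewrite /f /=.
have [zd|dz] := ltP `|z| d; last first.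
  rewrite sup ?(lt_le_trans epsd)// mule0.
  by under eq_integral do rewrite mul0r; rewrite integral0.
under eq_integral do rewrite EFinM [z + _]addrC.
rewrite ge0_integralZl_EFin//.
- by rewrite muleC lee_wpmul2r ?lee_fin//; exact: hd.
- apply/measurable_EFinP; apply: measurableT_comp => //; apply: measurable_funB => //.
  exact: (measurableT_comp mF (measurable_rV_shift z)).
Qed.

End mollification.

(** Dominated convergence, the truncated integrands vanishing eventually at each point. The function
    [h] that sets the level is kept apart from the integrand [G]: one is a size, the other a power
    of it or a sum of powers. *)
Lemma integral_tail d (T : measurableType d) (R : realType)
    (mu : {measure set T -> \bar R}) (D : set T) (G h : T -> R) (tau : R) :
  measurable D -> mu.-integrable D (EFin \o G) -> (forall x, 0 <= G x) ->
  measurable_fun D h -> 0 < tau ->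
  exists2 M : R, 1 <= M &
    (\int[mu]_(x in D) (if M < h x then G x else 0)%:E <= tau%:E)%E.
Proof.
move=> mD iG G0 mh tau0.
pose f_ (k : nat) (x : T) : \bar R := (if k.+1%:R < h x then G x else 0)%:E.
have mG : measurable_fun D G by apply/measurable_EFinP; exact: (measurable_int mu iG).
have mf k : measurable_fun D (f_ k).
  apply/measurable_EFinP; apply: measurable_fun_if => //.
  - exact: measurable_fun_ltr.
  - by apply: (measurable_funS mD) => //; exact: subIsetl.
have f0 k x : (0 <= f_ k x)%E by rewrite lee_fin; case: ifPn.
have [] := @dominated_convergence _ _ _ mu D mD f_ (cst 0%E) (EFin \o G) mf.
- exact: measurable_cst.
- apply: aeW => x _; apply: (cvg_near_cst).
  exists (Num.truncn `|h x|) => // k /= hk; rewrite /f_ ifF//.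
  apply/negbTE; rewrite -leNgt (le_trans (ler_norm _))// ltW//.
  by rewrite (lt_le_trans (truncnS_gt _))// ler_nat ltnS.
- exact: iG.
- apply: aeW => x k _; rewrite gee0_abs// lee_fin; case: ifPn => // _; exact: G0.
move=> _ _; rewrite integral0 => cv.
have : nbhs (0%:E : \bar R) [set y | (y < tau%:E)%E].
  apply: open_nbhs_nbhs; split; first exact: open_ereal_lt_ereal.
  by rewrite /= lte_fin.
move=> /cv [k _ hk]; exists k.+1%:R; first by rewrite ler1n.
by apply: ltW; exact: (hk k (leqnn k)).
Qed.

Lemma measurable_powR_fun d (T : measurableType d) (R : realType) (D : set T)
    (g q : T -> R) : measurable D ->
  measurable_fun D g -> measurable_fun D q -> measurable_fun D (fun x => g x `^ q x).
Proof.
move=> mD mg mq; rewrite /powR.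
apply: measurable_fun_if => //.
- exact: measurable_fun_eqr.
- apply: (measurable_funS mD); first exact: subIsetl.
  rewrite (_ : (fun t => _) = (fun t => if q t == 0 then 1 else 0 : R)); last first.
    by apply/funext => t; case: (_ == _).
  by apply: measurable_fun_if => //; exact: measurable_fun_eqr.
- apply: (measurable_funS mD); first exact: subIsetl.
  apply: (measurableT_comp (@measurable_expR R)); apply: measurable_funM => //.
  exact: (measurableT_comp (@measurable_ln R)).
Qed.

Section mollify_modular.
Context {R : realType} {n : nat}.
Implicit Types (eta w F T : 'rV[R]_n -> R) (x y z : 'rV[R]_n) (eps C : R).
Local Notation mu := (@lebesgue_rV R n).
Variables (Om : set 'rV[R]_n) (q : 'rV[R]_n -> R) (P L : R).
Hypotheses (mOm : measurable Om) (mq : measurable_fun setT q)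
  (q1 : forall x, 1 < q x) (qP : forall x, q x <= P) (L0 : 0 <= L)
  (qL : forall x y, Om x -> Om y -> `|q x - q y| <= L * `|x - y|).

Let q0 x : 0 < q x. Proof. exact: lt_trans (q1 x). Qed.

(* At scale eps the mollification of an L^1 function is at most A / eps ^+ n, and
   the exponent oscillates by at most L * eps, so powR_eps_bounded supplies the
   constant required by powR_young_variable. *)
Lemma mollify_large_pointwise (A eps C : R) eta T x : 1 <= A ->
  0 < eps -> eps <= 1 -> mollifier eps C eta ->
  loc_int T -> loc_int (fun y => T y `^ q y) ->
  (forall y, T y = 0 \/ 1 <= T y) -> (forall y, T y != 0 -> Om y) ->
  convol eta T x <= A / eps ^+ n -> Om x ->
  convol eta T x `^ q x <=
    (A `^ L * expR (L * n%:R) * 2 `^ P) *+ 2 * convol eta (fun y => T y `^ q y) x.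
Proof.
move=> A1 e0 e1 me lT lTq T1 TOm sA Omx.
have [teta eta0 ev int1 [sup _]] := me.
have T0 y : 0 <= T y by have [->//|] := T1 y; exact: le_trans.
set s := convol eta T x; set C' := _ * expR _.
have s0 : 0 <= s by exact: conv_ge0 me T0.
have C'1 : 1 <= C'.
  by rewrite mulr_ege1 ?powR_ge1// -expR0 ler_expR mulr_ge0.
have key y : eta (y - x) * T y * s `^ (q x - 1) <=
    eta (y - x) * (s `^ q x / 2 + C' * 2 `^ P * T y `^ q y).
  rewrite -mulrA.
  have [yx|yx] := ltP eps `|y - x|; first by rewrite sup// !mul0r.
  rewrite ler_wpM2l//.
  have [->|Ty] := eqVneq (T y) 0.
    by rewrite mul0r addr_ge0// ?divr_ge0 ?mulr_ge0 ?powR_ge0// (le_trans ler01).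
  apply: powR_young_variable => // s1.
  apply: le_trans (powR_eps_bounded n A1 L0 e0 e1).
  apply: (@le_trans _ _ (s `^ (L * eps))).
    apply: ler_powR => //; apply: (le_trans (qL Omx (TOm _ Ty))).
    by rewrite ler_wpM2l// distrC.
  apply: ge0_ler_powR; rewrite ?nnegrE//; first by rewrite mulr_ge0// ltW.
  exact: le_trans sA.
have iT := conv_integrable x teta lT.
have iTq := conv_integrable x teta lTq.
have i1 : mu.-integrable setT (EFin \o (fun y => eta (y - x))).
  have := conv_integrable x teta (loc_int_cst 1).
  by under eq_fun do rewrite mulr1.
set a := s `^ q x / 2; set b := C' * 2 `^ P.
have iR : mu.-integrable setT (EFin \o (fun y => eta (y - x) * a + (eta (y - x) * T y `^ q y) * b)).
  apply: (integrableD measurableT (f := EFin \o (fun y => eta (y - x) * a))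
    (g := EFin \o (fun y => (eta (y - x) * T y `^ q y) * b))).
    exact: (integrableZr measurableT a i1).
  exact: (integrableZr measurableT b iTq).
have : s * s `^ (q x - 1) <= a + b * convol eta (fun y => T y `^ q y) x.
  rewrite {1}/s /convol -RintegralZr//.
  apply: (@le_trans _ _ (\int[mu]_y (eta (y - x) * a + (eta (y - x) * T y `^ q y) * b))).
    apply: le_Rintegral => //.
      exact: (integrableZr measurableT _ iT).
    by move=> y _; apply: (le_trans (key y)); rewrite mulrDr lerD2l mulrCA mulrC.
  rewrite RintegralD//.
  - rewrite !RintegralZr// lerD//; last by rewrite mulrC.
    by rewrite /Rintegral (EFin_mollifier_shift x me)/= mul1r.
  - exact: (integrableZr measurableT a i1).
  - exact: (integrableZr measurableT b iTq).
rewrite mulr_powRB1//.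
rewrite /a; move: (s `^ q x) (convol _ _ _) => u w; rewrite mulrnAl [X in _ -> _ <= X]mulr2n.
by move: (b * w) => bw; lra.
Qed.

(** The constant [K] depends on [T] only through the bound [m]. It can thus be fixed before [T] is
    taken to be the part of a function above a high level. *)
Lemma mollify_large (m C : R) : 0 <= m -> 0 < C ->
  exists2 K : R, 0 <= K & forall eps eta T, 0 < eps -> eps <= 1 -> mollifier eps C eta ->
  measurable_fun setT T ->
  (forall y, T y = 0 \/ 1 <= T y) -> (forall y, T y != 0 -> Om y) ->
  (\int[mu]_y (T y `^ q y)%:E <= m%:E)%E ->
  (\int[mu]_(x in Om) (convol eta T x `^ q x)%:E <=
   K%:E * \int[mu]_y (T y `^ q y)%:E)%E.
Proof.
move=> m0 C0.
pose A := 1 + C * m.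
have A1 : 1 <= A by rewrite lerDl mulr_ge0// ltW.
pose K := (A `^ L * expR (L * n%:R) * 2 `^ P) *+ 2.
have K0 : 0 <= K by rewrite mulrn_wge0// !mulr_ge0 ?powR_ge0 ?expR_ge0.
exists K => // eps eta T e0 e1 me mT T1 TOm Tm.
have [teta eta0 ev int1 [sup etaC]] := me.
have T0 y : 0 <= T y by have [->//|] := T1 y; exact: le_trans.
have mTq : measurable_fun setT (fun y => T y `^ q y) by exact: measurable_powR_fun.
have iTq : mu.-integrable setT (EFin \o (fun y => T y `^ q y)).
  apply/integrableP; split; first exact/measurable_EFinP.
  apply: (le_lt_trans _ (ltry m)); apply: le_trans Tm.
  by under eq_integral do rewrite /= ger0_norm ?powR_ge0//.
have TTq y : T y <= T y `^ q y.
  have [->|Ty] := T1 y; first exact: powR_ge0.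
  exact: (le1r_powR Ty (ltW (q1 y))).
have iT : mu.-integrable setT (EFin \o T).
  apply: (le_integrable measurableT _ _ iTq); first exact/measurable_EFinP.
  by move=> y _ /=; rewrite lee_fin !ger0_norm ?powR_ge0.
have lT := integrable_loc_int iT; have lTq := integrable_loc_int iTq.
have sA x : convol eta T x <= A / eps ^+ n.
  apply: (@le_trans _ _ (\int[mu]_y (C / eps ^+ n * T y))).
    apply: le_Rintegral => //.
    - exact: conv_integrable.
    - exact: (integrableZl measurableT (C / eps ^+ n) iT).
    - by move=> y _; rewrite ler_wpM2r.
  rewrite RintegralZl// mulrAC ler_wpM2r ?invr_ge0 ?exprn_ge0 ?(ltW e0)//.
  apply: (@le_trans _ _ (C * m)); last by rewrite lerDr.
  rewrite ler_wpM2l ?(ltW C0)//.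
  rewrite -lee_fin; apply: le_trans Tm; rewrite /Rintegral fineK; last exact: integrable_fin_num.
  apply: ge0_le_integral => //; first by move=> y _; rewrite lee_fin.
  - exact/measurable_EFinP.
  - exact/measurable_EFinP.
  - by move=> y _; rewrite lee_fin.
have Tq0 y : 0 <= T y `^ q y by exact: powR_ge0.
rewrite -(integral_conv me lTq Tq0).
have mc := conv_measurable teta lTq.
have c0 x := conv_ge0 x me Tq0.
rewrite -ge0_integralZl_EFin//; [|by move=> x _; rewrite lee_fin|exact/measurable_EFinP].
apply: (@le_trans _ _ (\int[mu]_(x in Om) (K%:E * (convol eta (fun y => T y `^ q y) x)%:E))%E).
  apply: ge0_le_integral => //.
  - by move=> x _; rewrite lee_fin powR_ge0.
  - apply/measurable_EFinP; apply: measurable_funTS; apply: measurable_powR_fun => //.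
    exact: conv_measurable.
  - by apply: measurable_funTS; apply: measurable_funeM; exact/measurable_EFinP.
  - move=> x Ox; rewrite -EFinM lee_fin.
    exact: (mollify_large_pointwise A1 e0 e1 me lT lTq T1 TOm (sA x) Ox).
apply: ge0_subset_integral => //.
- by apply: measurable_funeM; exact/measurable_EFinP.
- by move=> x _; rewrite mule_ge0 ?lee_fin.
Qed.

Lemma conv_bounded eps C eta w M x : mollifier eps C eta -> measurable_fun setT w ->
  loc_int w -> (forall y, `|w y| <= M) -> `|convol eta w x| <= M.
Proof.
move=> me mw lw wM; have [teta eta0 _ _ _] := me.
apply: (le_trans (conv_norm_le x me lw)).
have lnw : loc_int (fun y => `|w y|).
  split; first exact: measurableT_comp.
  by move=> N; exact: (integrable_norm (lw.2 N)).
apply: (@le_trans _ _ (convol eta (cst M) x)).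
  apply: le_Rintegral => //; try exact: conv_integrable.
    exact: (conv_integrable x teta (loc_int_cst M)).
  by move=> y _; rewrite ler_wpM2l.
rewrite /convol RintegralZr//.
  by rewrite /Rintegral (EFin_mollifier_shift x me)/= mul1r.
have := conv_integrable x teta (loc_int_cst 1).
by under eq_fun do rewrite mulr1.
Qed.

(** [F] is split at a level [M]. The bounded part [B] converges in L^1, hence in the modular. The
    rest, of absolute value [T], has modular at most [tau], and its mollification at most [K * tau]
    by [mollify_large]. *)
Lemma mollify_modular_cvg C F (N0 : R) : 0 < C -> measurable_fun setT F ->
  (forall x, F x != 0 -> Om x /\ `|x| <= N0) ->
  (\int[mu]_x (`|F x| `^ q x)%:E < +oo)%E ->
  forall e : R, 0 < e -> exists2 d : R, 0 < d & forall eps eta, 0 < eps -> eps < d ->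
    mollifier eps C eta ->
    (\int[mu]_(x in Om) (`|convol eta F x - F x| `^ q x)%:E <= e%:E)%E.
Proof.
move=> C0 mF FOm Foo e e0.
have mnF : measurable_fun setT (fun x => `|F x|) by exact: measurableT_comp.
have mFq : measurable_fun setT (fun x => `|F x| `^ q x) by exact: measurable_powR_fun.
have Fq0 x : 0 <= `|F x| `^ q x by exact: powR_ge0.
have iFq : mu.-integrable setT (EFin \o (fun x => `|F x| `^ q x)).
  apply/integrableP; split; first exact/measurable_EFinP.
  by under eq_integral do rewrite /= ger0_norm//.
pose m := fine (\int[mu]_x (`|F x| `^ q x)%:E).
have mE : (\int[mu]_x (`|F x| `^ q x)%:E = m%:E)%E.
  by rewrite /m fineK//; exact: integrable_fin_num.
have m0 : 0 <= m by rewrite /m fine_ge0// integral_ge0// => x _; rewrite lee_fin.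
have [K K0 hK] := mollify_large m0 C0.
pose c3 : R := 3 `^ P.
have c30 : 0 < c3 by rewrite powR_gt0.
pose tau := e / 2 / (c3 * (K + 1)).
have K1 : 0 < K + 1 by rewrite ltr_pwDr.
have tau0 : 0 < tau by rewrite !divr_gt0// mulr_gt0.
have [M M1 tail] := integral_tail measurableT iFq Fq0 mnF tau0.
have M0 : 0 <= M by exact: le_trans M1.
(* Because [1 <= M], the function [T] below takes only the value 0 and values above 1, as
   [powR_young_variable] requires. *)
pose B x : R := if M < `|F x| then 0 else F x.
pose T x : R := if M < `|F x| then `|F x| else 0.
have mb : measurable_fun setT (fun x => M < `|F x|) by exact: measurable_fun_ltr.
have mB : measurable_fun setT B by apply: measurable_fun_ifT.
have mT : measurable_fun setT T by apply: measurable_fun_ifT.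
have BM x : `|B x| <= M.
  by rewrite /B; case: ltP => //; rewrite normr0.
have BN x : N0 < `|x| -> B x = 0.
  move=> Nx; rewrite /B; case: ifPn => // _; apply/eqP; apply: contraLR Nx => /FOm[_].
  by rewrite -leNgt.
have T1 y : T y = 0 \/ 1 <= T y.
  by rewrite /T; case: ltP => [MF|_]; [right; rewrite (le_trans M1)// ltW | left].
have T0 y : 0 <= T y by rewrite /T; case: ifPn.
have TOm y : T y != 0 -> Om y.
  rewrite /T; case: ifPn => [_|_]; last by rewrite eqxx.
  by rewrite normr_eq0 => /FOm[].
have TqE : (\int[mu]_y (T y `^ q y)%:E =
    \int[mu]_x (if M < `|F x| then `|F x| `^ q x else 0)%:E)%E.
  apply: eq_integral => y _; rewrite /T; case: ifPn => // _.
  by rewrite powR0// gt_eqF.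
have Ttau : (\int[mu]_y (T y `^ q y)%:E <= tau%:E)%E by rewrite TqE.
have mTq : measurable_fun setT (fun y => T y `^ q y) by exact: measurable_powR_fun.
have Tm : (\int[mu]_y (T y `^ q y)%:E <= m%:E)%E.
  rewrite -mE; apply: ge0_le_integral => //.
  - by move=> y _; rewrite lee_fin powR_ge0.
  - exact/measurable_EFinP.
  - exact/measurable_EFinP.
  - move=> y _; rewrite lee_fin /T; case: ifPn => // _.
    by rewrite powR0// gt_eqF.
have TTq y : T y <= T y `^ q y.
  have [->|Ty] := T1 y; first exact: powR_ge0.
  exact: (le1r_powR Ty (ltW (q1 y))).
have iT : mu.-integrable setT (EFin \o T).
  apply/integrableP; split; first exact/measurable_EFinP.
  apply: (@le_lt_trans _ _ m%:E); last exact: ltry.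
  apply: le_trans Tm; apply: ge0_le_integral => //.
  - by apply/measurable_EFinP; exact: measurableT_comp.
  - exact/measurable_EFinP.
  - by move=> y _; rewrite lee_fin ger0_norm.
have nFB x : `|F x - B x| = T x.
  by rewrite /T /B; case: ifPn => _; rewrite ?subr0// subrr normr0.
have mFB : measurable_fun setT (fun x => F x - B x) by exact: measurable_funB.
have iFB : mu.-integrable setT (EFin \o (fun x => F x - B x)).
  apply: (le_integrable measurableT _ _ iT); first exact/measurable_EFinP.
  by move=> x _ /=; rewrite lee_fin nFB ger0_norm.
have lFB := integrable_loc_int iFB.
have lT := integrable_loc_int iT.
have lB : loc_int B.
  split=> // N; apply: measurable_bounded_integrable => //.
  - exact: measurable_cball.
  - exact: lebesgue_rV_cball_lty.
  - exact: measurable_funTS.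
  - by exists M; split=> [|M' MM' y _ /=]; [exact: num_real | rewrite (le_trans (BM y))// ltW].
(* [|convol eta B - B| <= 2 M], so [powR_le_linear] bounds its power by [c2] times itself. *)
pose c2 : R := (M *+ 2) `^ P.
have M2 : 1 <= M *+ 2 by rewrite mulr2n; lra.
have c20 : 0 < c2 by rewrite powR_gt0// (lt_le_trans ltr01).
pose e1 := e / 2 / (c3 * c2).
have e10 : 0 < e1 by rewrite !divr_gt0// mulr_gt0.
have [d d0 hd] := @mollify_bounded R n C B M N0 mB BM BN e1 e10.
exists (Num.min d 1); first by rewrite lt_min d0 ltr01.
move=> eps eta eps0; rewrite lt_min => /andP[epsd eps1] me.
have [teta eta0 _ _ _] := me.
have large := hK eps eta T eps0 (ltW eps1) me mT T1 TOm Tm.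
have small := hd eps eta epsd me.
have cT0 x : 0 <= convol eta T x by exact: conv_ge0 me T0.
have lF : loc_int F.
  rewrite (_ : F = (fun x => B x + (F x - B x))); last first.
    by apply/funext => x; rewrite addrC subrK.
  split; first exact: measurable_funD.
  move=> N; exact: (integrableD (measurable_cball N) (lB.2 N) (lFB.2 N)).
have split3 x : `|convol eta F x - F x| <= `|convol eta B x - B x| + convol eta T x + T x.
  have -> : convol eta F x = convol eta B x + convol eta (fun y => F y - B y) x.
    rewrite -convD//; congr convol; apply/funext => y; by rewrite addrC subrK.
  have -> : convol eta B x + convol eta (fun y => F y - B y) x - F x =
      (convol eta B x - B x) + convol eta (fun y => F y - B y) x - (F x - B x).
    by move: (convol _ _ _) (convol _ _ _) => u w; lra.
  rewrite (le_trans (ler_normB _ _))// nFB lerD2r (le_trans (ler_normD _ _))// lerD2l.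
  rewrite (le_trans (conv_norm_le x me lFB))//.
  by under eq_fun do rewrite nFB.
have mcB := conv_measurable teta lB; have mcT := conv_measurable teta lT.
have mcF := conv_measurable teta lF.
have mB1 : measurable_fun setT (fun x => `|convol eta B x - B x|).
  by apply: measurableT_comp => //; exact: measurable_funB.
have pt x : `|convol eta F x - F x| `^ q x <=
    c3 * c2 * `|convol eta B x - B x| + c3 * (convol eta T x `^ q x + T x `^ q x).
  apply: (@le_trans _ _ ((`|convol eta B x - B x| + convol eta T x + T x) `^ q x)).
    by rewrite ge0_ler_powR ?nnegrE ?addr_ge0// ltW.
  apply: (le_trans (powR_add3_le _ _ _ (ltW (q1 x)) (qP x))) => //.
  rewrite -/c3 -mulrA -mulrDr ler_wpM2l ?(ltW c30)// addrA !lerD2r.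
  apply: powR_le_linear => //.
  by rewrite (le_trans (ler_normB _ _))// mulr2n lerD// (conv_bounded x me).
have mcTq : measurable_fun setT (fun x => convol eta T x `^ q x) by exact: measurable_powR_fun.
apply: (@le_trans _ _ (\int[mu]_(x in Om) ((c3 * c2)%:E * `|convol eta B x - B x|%:E +
    c3%:E * ((convol eta T x `^ q x)%:E + (T x `^ q x)%:E)))%E).
  apply: ge0_le_integral => //.
  - apply/measurable_EFinP; apply: measurable_funTS; apply: measurable_powR_fun => //.
    by apply: measurableT_comp => //; exact: measurable_funB.
  - apply: measurable_funTS; apply: emeasurable_funD; apply: measurable_funeM.
      exact/measurable_EFinP.
    by apply: emeasurable_funD; exact/measurable_EFinP.
  - by move=> x _; exact: (pt x).
have mE1 : measurable_fun Om (fun x => `|convol eta B x - B x|%:E : \bar R).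
  by apply: measurable_funTS; exact/measurable_EFinP.
have mE2 : measurable_fun Om (fun x => (convol eta T x `^ q x)%:E : \bar R).
  by apply: measurable_funTS; exact/measurable_EFinP.
have mE3 : measurable_fun Om (fun x => (T x `^ q x)%:E : \bar R).
  by apply: measurable_funTS; exact/measurable_EFinP.
have c32 : 0 <= c3 * c2 by rewrite mulr_ge0// ltW.
rewrite ge0_integralD//; last 4 first.
- by move=> x _; rewrite mule_ge0// lee_fin.
- exact: measurable_funeM.
- by move=> x _; rewrite mule_ge0// ?adde_ge0 ?lee_fin ?powR_ge0// ltW.
- by apply: measurable_funeM; exact: emeasurable_funD.
rewrite ge0_integralZl_EFin//.
rewrite ge0_integralZl_EFin ?(ltW c30)//; last 2 first.
- by move=> x _; rewrite adde_ge0// lee_fin powR_ge0.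
- exact: emeasurable_funD.
rewrite ge0_integralD//; last 2 first.
- by move=> x _; rewrite lee_fin powR_ge0.
- by move=> x _; rewrite lee_fin powR_ge0.
rewrite [X in (_ <= X)%E](_ : _ = ((e / 2)%:E + (e / 2)%:E)%E); last by rewrite -EFinD -splitr.
apply: leeD.
  apply: (@le_trans _ _ ((c3 * c2)%:E * e1%:E)%E).
    rewrite lee_wpmul2l// ?lee_fin//; apply: le_trans small.
    apply: ge0_subset_integral => //; exact/measurable_EFinP.
  by rewrite -EFinM lee_fin /e1 mulrC divfK// gt_eqF// mulr_gt0.
apply: (@le_trans _ _ (c3%:E * (K%:E * tau%:E + tau%:E))%E).
  rewrite lee_wpmul2l ?lee_fin ?(ltW c30)//; apply: leeD.
    by apply: (le_trans large); rewrite lee_wpmul2l ?lee_fin.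
  apply: le_trans Ttau; apply: ge0_subset_integral => //.
    exact/measurable_EFinP.
  by move=> x _; rewrite lee_fin powR_ge0.
suff h : c3 * (K * tau + tau) <= e / 2 by exact: h.
rewrite -[X in _ * (_ + X)]mul1r -mulrDl mulrA.
by rewrite /tau mulrC divfK// gt_eqF// mulr_gt0.
Qed.

End mollify_modular.

(** * Modulars and zero boundary values *)

Section modular_theory.
Context {R : realType} {n : nat}.
Implicit Types (f g u : 'rV[R]_n -> R) (G : 'rV[R]_n -> 'rV[R]_n).
Local Notation mu := (@lebesgue_rV R n).
Variables (Om : set 'rV[R]_n) (p : 'rV[R]_n -> R) (P : R).
Hypotheses (mOm : measurable Om) (mp : measurable_fun Om p)
  (p1 : forall x, Om x -> 1 < p x) (pP : forall x, Om x -> p x <= P).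
Local Notation rho := (modular Om p).

Lemma measurable_modular f : measurable_fun Om f ->
  measurable_fun Om (fun x => (`|f x| `^ p x)%:E : \bar R).
Proof.
move=> mf; apply/measurable_EFinP; apply: measurable_powR_fun => //.
exact: measurableT_comp.
Qed.

Lemma le_modular f g : measurable_fun Om f -> measurable_fun Om g ->
  {ae mu, forall x, Om x -> `|f x| <= `|g x|} -> (rho f <= rho g)%E.
Proof.
move=> mf mg fg; apply: ae_ge0_le_integral => //.
- exact: measurable_modular.
- exact: measurable_modular.
apply: filterS fg => x fg Ox; rewrite lee_fin ge0_ler_powR ?nnegrE//; last exact: fg.
by rewrite ltW// (lt_trans _ (p1 Ox)).
Qed.

Lemma modularD f g : measurable_fun Om f -> measurable_fun Om g ->
  (rho (fun x => f x + g x)%R <= (3 `^ P)%:E * (rho f + rho g))%E.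
Proof.
move=> mf mg; rewrite /modular -ge0_integralD//; last 2 first.
- exact: measurable_modular.
- exact: measurable_modular.
rewrite -ge0_integralZl_EFin//; last 2 first.
- by move=> x Ox; rewrite adde_ge0// lee_fin powR_ge0.
- by apply: emeasurable_funD; exact: measurable_modular.
apply: ge0_le_integral => //.
- by apply: measurable_modular; exact: measurable_funD.
- by apply: measurable_funeM; apply: emeasurable_funD; exact: measurable_modular.
move=> x Ox; suff h : `|f x + g x| `^ p x <= 3 `^ P * (`|f x| `^ p x + `|g x| `^ p x) by exact: h.
apply: le_trans (powR_add_le _ _ (ltW (p1 Ox)) (pP Ox)) => //.
rewrite ge0_ler_powR ?nnegrE ?addr_ge0//; last exact: ler_normD.
by rewrite ltW// (lt_trans _ (p1 Ox)).
Qed.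

Lemma modularZ (c : R) f : measurable_fun Om f ->
  (rho (fun x => c * f x)%R <= ((1 + `|c|) `^ P)%:E * rho f)%E.
Proof.
move=> mf; rewrite /modular -ge0_integralZl_EFin ?powR_ge0//; last exact: measurable_modular.
apply: ge0_le_integral => //.
- by apply: measurable_modular; exact: measurable_funM.
- by apply: measurable_funeM; exact: measurable_modular.
move=> x Ox; suff h : `|c * f x| `^ p x <= (1 + `|c|) `^ P * `|f x| `^ p x by exact: h.
by rewrite normrM; apply: powR_scale_le; rewrite ?pP// ltW// p1.
Qed.

Lemma modularZ_lty (c : R) f : measurable_fun Om f -> (rho f < +oo)%E ->
  (rho (fun x => c * f x)%R < +oo)%E.
Proof.
move=> mf foo; apply: le_lt_trans (modularZ c mf) _.
by rewrite lte_mul_pinfty ?lee_fin ?powR_ge0.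
Qed.

Lemma modularD_lty f g : measurable_fun Om f -> measurable_fun Om g ->
  (rho f < +oo)%E -> (rho g < +oo)%E -> (rho (fun x => f x + g x)%R < +oo)%E.
Proof.
move=> mf mg foo goo; apply: le_lt_trans (modularD mf mg) _.
have fgoo := lte_add_pinfty foo goo.
by rewrite lte_mul_pinfty ?lee_fin ?powR_ge0.
Qed.

(** As [p <= P], rescaling changes the modular at most by a constant factor, so the scale [l] may be
    taken to be 1. *)
Lemma variable_LebesgueP f :
  variable_Lebesgue Om p f <-> measurable_fun Om f /\ (rho f < +oo)%E.
Proof.
split=> [[mf [l l0 hl]]|[mf foo]]; last first.
  split; first exact: mf.
  exists 1; first exact: ltr01.
  rewrite (_ : (fun x => f x / 1) = f)//.
  by apply/funext => x; rewrite divr1.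
split; first exact: mf.
have m1 : measurable_fun Om (fun x => f x / l).
  by apply: measurable_funM => //; exact: measurable_cst.
have := modularZ_lty l m1 hl.
rewrite /modular; under eq_integral do rewrite mulrC divfK ?gt_eqF//.
by [].
Qed.

Lemma luxemburg_ge0 f : (0 <= luxemburg_norm Om p f)%E.
Proof. by apply/ereal_infP => _ [l [l0 _] <-]; rewrite lee_fin ltW. Qed.

Lemma luxemburg_small (e : R) : 0 < e -> exists2 d : R, 0 < d &
  forall f, measurable_fun Om f -> (rho f <= d%:E)%E -> (luxemburg_norm Om p f < e%:E)%E.
Proof.
move=> e0; pose l := e / 2; have l0 : 0 < l by rewrite divr_gt0.
pose c := (1 + `|l^-1|) `^ P; have c0 : 0 < c by rewrite powR_gt0// ltr_pwDl.
exists c^-1; first by rewrite invr_gt0.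
move=> f mf fd; apply: (@le_lt_trans _ _ l%:E); last by rewrite lte_fin /l; lra.
apply: ereal_inf_lbound; exists l => //; split => //.
have := modularZ l^-1 mf; rewrite (_ : (fun x => l^-1 * f x) = (fun x => f x / l)); last first.
  by apply/funext => x; rewrite mulrC.
move=> h; apply: (le_trans h); apply: (@le_trans _ _ (c%:E * c^-1%:E)%E).
  by rewrite lee_wpmul2l// lee_fin ltW.
by rewrite -EFinM divff// gt_eqF.
Qed.

Lemma modular_luxemburg f (e : R) : measurable_fun Om f -> e <= 1 ->
  (luxemburg_norm Om p f < e%:E)%E -> (rho f <= e%:E)%E.
Proof.
move=> mf e1 /ereal_inf_lt[_ [l [l0 fl] <-]]; rewrite lte_fin => le.
have m1 : measurable_fun Om (fun x => f x / l).
  by apply: measurable_funM => //; exact: measurable_cst.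
apply: (@le_trans _ _ (l%:E * rho (fun x => f x / l)%R)%E); last first.
  apply: (@le_trans _ _ (l%:E * 1%:E)%E); first by rewrite lee_wpmul2l// lee_fin ltW.
  by rewrite -EFinM mulr1 lee_fin ltW.
rewrite /modular -ge0_integralZl_EFin ?(ltW l0)//; last first.
- exact: measurable_modular.
apply: ge0_le_integral => //.
- exact: measurable_modular.
- by apply: measurable_funeM; exact: measurable_modular.
move=> x Ox; suff h : `|f x| `^ p x <= l * `|f x / l| `^ p x by exact: h.
rewrite -{1}[f x](divfK (lt0r_neq0 l0)) normrM powRM// mulrC ler_wpM2r ?powR_ge0//.
rewrite gtr0_norm//.
apply: ge1r_powR; last exact: ltW (p1 Ox).
by rewrite l0 (le_trans (ltW le)).
Qed.

Lemma Sobolev_norm_lt u G (e : R) : (Sobolev_norm Om p u G < e%:E)%E ->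
  (luxemburg_norm Om p u < e%:E)%E /\ (luxemburg_norm Om p (enorm \o G) < e%:E)%E.
Proof.
move=> h; split; apply: le_lt_trans h; rewrite /Sobolev_norm.
  by rewrite leeDl// luxemburg_ge0.
by rewrite leeDr// luxemburg_ge0.
Qed.

End modular_theory.

(** * Approximation by test functions and passage to the limit in weak gradients *)

Section zero_trace.
Context {R : realType} {n : nat}.
Implicit Types (f g u phi : 'rV[R]_n -> R) (G : 'rV[R]_n -> 'rV[R]_n).
Local Notation mu := (@lebesgue_rV R n).
Variables (Om : set 'rV[R]_n) (p : 'rV[R]_n -> R) (P : R).
Hypotheses (mOm : measurable Om) (mp : measurable_fun Om p)
  (p1 : forall x, Om x -> 1 < p x) (pP : forall x, Om x -> p x <= P).
Local Notation rho := (modular Om p).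

(** For [t > delta] the ratio [t / delta] is at least 1, hence below its own power of order [q].
    Integrated over a set of finite measure, this bounds the L^1 norm by the modular up to an
    arbitrarily small error. *)
Lemma le_delta_powR (delta t q : R) : 0 < delta -> delta <= 1 -> 0 <= t ->
  1 < q -> q <= P -> t <= delta + (1 + delta^-1) `^ P * t `^ q.
Proof.
move=> d0 d1 t0 q1 qP; have [td|dt] := leP t delta.
  by rewrite ler_wpDr// mulr_ge0 ?powR_ge0.
rewrite ler_wpDl ?(ltW d0)//.
have dV0 : 0 <= delta^-1 by rewrite invr_ge0 ltW.
apply: le_trans (powR_scale_le dV0 t0 (ltW q1) qP).
have h1 : 1 <= delta^-1 * t by rewrite ler_pdivlMl// mulr1 ltW.
apply: le_trans (le1r_powR h1 (ltW q1)).
by rewrite ler_peMl// invf_ge1.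
Qed.

Lemma integrable_modular f : measurable_fun Om f -> (rho f < +oo)%E ->
  mu.-integrable Om (EFin \o (fun x => `|f x| `^ p x)).
Proof.
move=> mf foo; apply/integrableP; split; first exact: measurable_modular.
by under eq_integral do rewrite /= ger0_norm ?powR_ge0//.
Qed.

Lemma modular_loc_integrable f : measurable_fun Om f -> (rho f < +oo)%E ->
  loc_integrable Om f.
Proof.
move=> mf foo; split=> // K cK KOm.
have mK := compact_rV_measurable cK.
have iK := integrableS mOm mK KOm (integrable_modular mf foo).
have i1 : mu.-integrable K (EFin \o cst (1 : R)).
  apply: measurable_bounded_integrable => //; first exact: compact_lebesgue_rV_lty.
  by exists 1; split=> // M M1 x _ /=; rewrite normr1 ltW.
have i2 := integrableZl mK ((1 + 1^-1) `^ P) iK.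
have i3 := integrableD mK i1 i2.
apply: (le_integrable mK _ _ i3).
  by apply/measurable_EFinP; exact: measurable_funS KOm mf.
move=> x Kx; have Ox := KOm x Kx.
suff h : `|f x| <= `|1 + (1 + 1^-1) `^ P * `|f x| `^ p x| by exact: h.
rewrite [leRHS]ger0_norm ?addr_ge0 ?mulr_ge0 ?powR_ge0//.
by apply: le_delta_powR => //; [exact: p1|exact: pP].
Qed.

Lemma test_function_modular_lty phi : test_function Om phi -> (rho phi < +oo)%E.
Proof.
move=> tphi; have [C C0 hC] := test_function_bounded tphi.
have [K [cK KOm K0]] := test_function_support tphi.
have mK := compact_rV_measurable cK.
apply: (@le_lt_trans _ _ (\int[mu]_(x in Om) (((1 + C) `^ P)%:E * (\1_K x)%:E))%E).
  apply: ge0_le_integral => //.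
  - by apply: measurable_modular => //; apply: measurable_funTS; exact: test_function_measurable tphi.
  - apply: measurable_funeM; apply: measurable_funTS; apply/measurable_EFinP; exact: measurable_indic.
  - move=> x Ox; suff h : `|phi x| `^ p x <= (1 + C) `^ P * \1_K x by exact: h.
    have px := p1 Ox; have px0 : 0 < p x by exact: lt_trans px.
    have [Kx|nKx] := pselect (K x); last first.
      rewrite K0// normr0 powR0 ?gt_eqF// mulr_ge0 ?powR_ge0//.
    rewrite indicE mem_set// mulr1.
    apply: (@le_trans _ _ ((1 + C) `^ p x)).
      by apply: ge0_ler_powR; rewrite ?nnegrE ?addr_ge0 ?(ltW px0)// (le_trans (hC x))// lerDr.
    by apply: ler_powR; [rewrite lerDl|exact: pP].
rewrite ge0_integralZl_EFin ?powR_ge0//; last first.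
  by apply: measurable_funTS; apply/measurable_EFinP; exact: measurable_indic.
rewrite integral_indic// lte_mul_pinfty ?lee_fin ?powR_ge0//.
apply: (le_lt_trans _ (compact_lebesgue_rV_lty cK)).
by apply: le_measure; rewrite ?inE//; exact: measurableI.
Qed.

Lemma pairing_loc_integrable f phi : loc_integrable Om f ->
  test_function Om phi -> mu.-integrable Om (EFin \o (fun x => f x * phi x)).
Proof.
move=> [mf lf] tphi; have [C C0 hC] := test_function_bounded tphi.
have [K [cK KOm K0]] := test_function_support tphi.
have mK := compact_rV_measurable cK; have iK := lf K cK KOm.
rewrite (_ : EFin \o _ = (EFin \o (fun x => f x * phi x)) \_ K); last first.
  apply/funext => x; rewrite patchE; case: ifPn => // /negP; rewrite inE => nK.
  by rewrite /= K0// mulr0.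
apply/(integrable_restrict mu mK mOm); rewrite setIidr//.
rewrite (_ : EFin \o _ = ((EFin \o f) \* (EFin \o phi))%E); last first.
  by apply/funext => x /=; rewrite EFinM.
apply: integrableMl => //.
  by apply: measurable_funTS; exact: test_function_measurable tphi.
by exists C; split=> [|M CM x _ /=]; [exact: num_real | rewrite (le_trans (hC x))// ltW].
Qed.

Lemma pairing_integrable f phi : measurable_fun Om f -> (rho f < +oo)%E ->
  test_function Om phi -> mu.-integrable Om (EFin \o (fun x => f x * phi x)).
Proof.
move=> mf foo; apply: pairing_loc_integrable; exact: modular_loc_integrable.
Qed.

(** Continuity of the pairing with a fixed test function under modular convergence: [le_delta_powR]
    on the support [K], with [delta] small against the measure of [K]. *)
Lemma pairing_small phi (e : R) : test_function Om phi -> 0 < e ->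
  exists2 d : R, 0 < d & forall f, measurable_fun Om f -> (rho f <= d%:E)%E ->
    `|\int[mu]_(x in Om) (f x * phi x)| <= e.
Proof.
move=> tphi e0; have [C C0 hC] := test_function_bounded tphi.
have [K [cK KOm K0]] := test_function_support tphi.
have mK := compact_rV_measurable cK.
pose v := fine (mu K).
have vE : mu K = v%:E.
  by rewrite /v fineK// ge0_fin_numE//; exact: compact_lebesgue_rV_lty.
have v0 : 0 <= v by rewrite fine_ge0.
pose delta := Num.min 1 (e / 2 / ((C + 1) * (v + 1))).
have C1 : 0 < C + 1 by rewrite ltr_pwDr.
have v1 : 0 < v + 1 by rewrite ltr_pwDr.
have d0 : 0 < delta by rewrite lt_min ltr01 !divr_gt0// mulr_gt0.
have d1 : delta <= 1 by rewrite ge_min lexx.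
pose c := (1 + delta^-1) `^ P.
have c0 : 0 < c by rewrite powR_gt0// addr_gt0// invr_gt0.
exists (e / 2 / ((C + 1) * c)); first by rewrite !divr_gt0// mulr_gt0.
move=> f mf fd.
have foo : (rho f < +oo)%E by rewrite (le_lt_trans fd)// ltry.
have ifp := pairing_integrable mf foo tphi.
rewrite -lee_fin EFin_normr_Rintegral//.
apply: (le_trans (le_abse_integral _ _ (measurable_int mu ifp))) => //.
have mi : measurable_fun Om (fun x => (\1_K x)%:E : \bar R).
  by apply: measurable_funTS; apply/measurable_EFinP; exact: measurable_indic.
have mr : measurable_fun Om (fun x => (`|f x| `^ p x)%:E : \bar R).
  exact: measurable_modular.
apply: (@le_trans _ _ (\int[mu]_(x in Om) ((C * delta)%:E * (\1_K x)%:E +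
    (C * c)%:E * (`|f x| `^ p x)%:E))%E).
  apply: ge0_le_integral => //.
  - exact: (measurableT_comp (@abse_measurable R setT) (measurable_int mu ifp)).
  - by apply: emeasurable_funD; apply: measurable_funeM.
  - move=> x Ox.
    suff h : `|f x * phi x| <= C * delta * \1_K x + C * c * `|f x| `^ p x by exact: h.
    have [Kx|nKx] := pselect (K x); last first.
      rewrite K0// mulr0 normr0 addr_ge0// mulr_ge0 ?mulr_ge0 ?powR_ge0 ?(ltW d0) ?(ltW c0)//.
    rewrite indicE mem_set// mulr1 -!mulrA -mulrDr normrM mulrC ler_pM//.
    by apply: le_delta_powR => //; [exact: p1|exact: pP].
have Cd : 0 <= C * delta by rewrite mulr_ge0 ?(ltW d0).
have Cc : 0 <= C * c by rewrite mulr_ge0 ?(ltW c0).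
rewrite ge0_integralD//; last 4 first.
- by move=> x _; rewrite mule_ge0 ?lee_fin.
- exact: measurable_funeM.
- by move=> x _; rewrite mule_ge0 ?lee_fin ?powR_ge0.
- exact: measurable_funeM.
rewrite ge0_integralZl_EFin// ge0_integralZl_EFin//.
rewrite integral_indic// setIidl//.
rewrite [X in (_ <= X)%E](_ : _ = ((e / 2)%:E + (e / 2)%:E)%E); last by rewrite -EFinD -splitr.
apply: leeD.
  rewrite [X in (_ * X <= _)%E](_ : _ = v%:E)//.
  suff h : C * delta * v <= e / 2 by exact: h.
  apply: (@le_trans _ _ ((C + 1) * (v + 1) * (e / 2 / ((C + 1) * (v + 1))))).
    rewrite mulrAC ler_pM ?mulr_ge0 ?(ltW d0)//; last by rewrite ge_min lexx orbT.
    by rewrite ler_pM// lerDl.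
  by rewrite mulrC divfK// gt_eqF// mulr_gt0.
apply: (@le_trans _ _ ((C * c)%:E * (e / 2 / ((C + 1) * c))%:E)%E).
  by rewrite lee_wpmul2l.
suff h : C * c * (e / 2 / ((C + 1) * c)) <= e / 2 by exact: h.
rewrite mulrA ler_pdivrMr ?mulr_gt0// mulrC ler_wpM2l ?divr_ge0 ?(ltW e0)//.
by rewrite ler_wpM2r ?(ltW c0)// lerDl.
Qed.

(* Approximation by test functions in the modular, componentwise in the gradient;
   for exponents bounded by P it is equivalent to approximation in the norm. *)
Definition W0_approx u G := [/\ measurable_fun Om u,
  (forall i, measurable_fun Om (fun x => G x ord0 i)) &
  forall e : R, 0 < e -> exists2 phi, test_function Om phi &
    (rho (fun x => u x - phi x)%R <= e%:E)%E /\
    forall i, (rho (fun x => G x ord0 i - partial i phi x)%R <= e%:E)%E].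

Lemma W0_approx_lty u G : W0_approx u G ->
  (rho u < +oo)%E /\ forall i, (rho (fun x => G x ord0 i) < +oo)%E.
Proof.
move=> [mu_ mG h]; have [phi tphi [h1 h2]] := h 1 ltr01.
have mphi : measurable_fun Om phi by apply: measurable_funTS; exact: test_function_measurable tphi.
split.
  rewrite (_ : u = (fun x => (u x - phi x) + phi x)); last first.
    by apply/funext => x; rewrite subrK.
  apply: (modularD_lty mOm mp p1 pP) => //; first exact: measurable_funB.
    by rewrite (le_lt_trans h1)// ltry.
  exact: test_function_modular_lty.
move=> i; have tp := test_function_partial i tphi.
have mpp : measurable_fun Om (partial i phi).
  by apply: measurable_funTS; exact: test_function_measurable tp.
rewrite (_ : (fun x => G x ord0 i) = (fun x => (G x ord0 i - partial i phi x) + partial i phi x)); last first.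
  by apply/funext => x; rewrite subrK.
apply: (modularD_lty mOm mp p1 pP) => //; first exact: measurable_funB.
  by rewrite (le_lt_trans (h2 i))// ltry.
exact: test_function_modular_lty.
Qed.

(** In [W0_approx] the field [G] is merely a limit of gradients of test functions. The integration
    by parts formula holds for these and passes to the limit by [pairing_small]. *)
Lemma W0_approx_weak_gradient u G : W0_approx u G -> weak_gradient Om u G.
Proof.
move=> W; have [uoo Goo] := W0_approx_lty W; have [mu_ mG h] := W.
split; first exact: modular_loc_integrable.
move=> i; split; first exact: (modular_loc_integrable (mG i) (Goo i)).
move=> psi tpsi; have tppsi := test_function_partial i tpsi.
set A := Rintegral _ _ _; set B := Rintegral _ _ _.
apply/eqP; rewrite -addr_eq0 -normr_le0; apply/ler_addgt0Pl => e e0.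
rewrite addr0.
have e20 : 0 < e / 2 by rewrite divr_gt0.
have [d1 d10 hd1] := pairing_small tppsi e20.
have [d2 d20 hd2] := pairing_small tpsi e20.
have d0 : 0 < Num.min d1 d2 by rewrite lt_min d10.
have [phi tphi [h1 h2]] := h _ d0.
have tpphi := test_function_partial i tphi.
have mphi : measurable_fun Om phi by apply: measurable_funTS; exact: test_function_measurable tphi.
have mpphi : measurable_fun Om (partial i phi).
  by apply: measurable_funTS; exact: test_function_measurable tpphi.
have := test_function_by_parts i tphi tpsi.
move/eqP; rewrite -addr_eq0 => /eqP ibp.
have -> : A + B = \int[mu]_(x in Om) ((u x - phi x) * partial i psi x) +
    \int[mu]_(x in Om) ((G x ord0 i - partial i phi x) * psi x).
  under [X in _ = X + _]eq_Rintegral do rewrite mulrBl.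
  under [X in _ = _ + X]eq_Rintegral do rewrite mulrBl.
  have phoo := test_function_modular_lty tphi.
  have pphoo := test_function_modular_lty tpphi.
  rewrite (RintegralB mOm (pairing_integrable mu_ uoo tppsi)
    (pairing_integrable mphi phoo tppsi)).
  rewrite (RintegralB mOm (pairing_integrable (mG i) (Goo i) tpsi)
    (pairing_integrable mpphi pphoo tpsi)).
  by rewrite -[A + B]subr0 -ibp /A /B opprD addrACA.
rewrite (splitr e) (le_trans (ler_normD _ _))// lerD//.
  apply: hd1; first exact: measurable_funB.
  by rewrite (le_trans h1)// lee_fin ge_min lexx.
apply: hd2; first exact: measurable_funB.
by rewrite (le_trans (h2 i))// lee_fin ge_min lexx orbT.
Qed.

End zero_trace.

Section zero_trace_spaces.
Context {R : realType} {n : nat}.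
Implicit Types (f g u phi : 'rV[R]_n -> R) (G : 'rV[R]_n -> 'rV[R]_n).
Local Notation mu := (@lebesgue_rV R n).

Lemma enorm_le_norm (x : 'rV[R]_n) : enorm x <= Num.sqrt n%:R * `|x|.
Proof.
rewrite -[X in _ * X]ger0_norm// -sqrtr_sqr -sqrtrM// ler_wsqrtr//.
exact: dot_le_norm.
Qed.

Lemma measurable_enorm (Om : set 'rV[R]_n) G : measurable Om ->
  (forall i, measurable_fun Om (fun x => G x ord0 i)) ->
  measurable_fun Om (enorm \o G).
Proof.
move=> mOm mG; rewrite /enorm /dot /=.
apply: (measurableT_comp (continuous_measurable_fun (@sqrt_continuous R))).
apply: measurable_sum => i; apply: measurable_funM; exact: mG.
Qed.

Lemma exists_delta_all m (Q : 'I_m -> R -> Prop) :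
  (forall i, exists2 d : R, 0 < d & forall e, 0 < e -> e < d -> Q i e) ->
  exists2 d : R, 0 < d & forall e, 0 < e -> e < d -> forall i, Q i e.
Proof.
move=> h; pose d i := s2val (cid2 (h i)).
have hd i : 0 < d i /\ forall e, 0 < e -> e < d i -> Q i e by rewrite /d; case: cid2.
exists (\big[Num.min/1]_i d i).
  by apply: lt_bigmin => // i _; have [] := hd i.
move=> e e0 ed i; have [_ hi] := hd i; apply: hi => //.
by rewrite (lt_le_trans ed)// bigmin_le.
Qed.

Variables (Om : set 'rV[R]_n) (p : 'rV[R]_n -> R) (P : R).
Hypotheses (mOm : measurable Om) (mp : measurable_fun Om p)
  (p1 : forall x, Om x -> 1 < p x) (pP : forall x, Om x -> p x <= P).
Local Notation rho := (modular Om p).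

Lemma modular_coord_le G i : (forall i, measurable_fun Om (fun x => G x ord0 i)) ->
  (rho (fun x => G x ord0 i) <= rho (enorm \o G))%E.
Proof.
move=> mG; apply: le_modular => //; first exact: measurable_enorm.
by apply: aeW => x _; rewrite /= [leRHS]ger0_norm ?enorm_ge0// coord_le_enorm.
Qed.

Lemma norm_powR_le (x : 'rV[R]_n) (q : R) : 0 < q ->
  `|x| `^ q <= \sum_i `|x ord0 i| `^ q.
Proof.
move=> q0; set S := \sum_i _.
have S0 : 0 <= S by apply: sumr_ge0 => i _; exact: powR_ge0.
have xS : `|x| <= S `^ q^-1.
  apply/rV_norm_leP; first exact: powR_ge0.
  move=> i; rewrite -[leLHS]powRr1// -(mulfV (lt0r_neq0 q0)) powRrM.
  apply: ge0_ler_powR; rewrite ?nnegrE ?powR_ge0 ?invr_ge0 ?(ltW q0)//.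
  by rewrite /S (bigD1 i)//= lerDl sumr_ge0// => j _; exact: powR_ge0.
apply: (@le_trans _ _ ((S `^ q^-1) `^ q)).
  by apply: ge0_ler_powR; rewrite ?nnegrE ?powR_ge0 ?(ltW q0).
by rewrite -powRrM mulVf ?gt_eqF// powRr1.
Qed.

Lemma modular_enorm_le G : (forall i, measurable_fun Om (fun x => G x ord0 i)) ->
  (rho (enorm \o G) <= ((1 + Num.sqrt n%:R) `^ P)%:E *
     \sum_i rho (fun x => G x ord0 i))%E.
Proof.
move=> mG; rewrite /modular -ge0_integral_sum//; last by move=> i; exact: measurable_modular.
rewrite -ge0_integralZl_EFin ?powR_ge0//; last 2 first.
- by move=> x _; apply: sume_ge0 => i _; rewrite lee_fin powR_ge0.
- by apply: emeasurable_sum => i; exact: measurable_modular.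
apply: ge0_le_integral => //.
- by apply: measurable_modular => //; exact: measurable_enorm.
- apply: measurable_funeM; apply: emeasurable_sum => i; exact: measurable_modular.
move=> x Ox; have px := p1 Ox; have px0 : 0 < p x by exact: lt_trans px.
rewrite sumEFin.
suff h : `|enorm (G x)| `^ p x <= (1 + Num.sqrt n%:R) `^ P * \sum_i `|G x ord0 i| `^ p x by exact: h.
apply: (@le_trans _ _ ((1 + Num.sqrt n%:R) `^ P * `|G x| `^ p x)); last first.
  by rewrite ler_wpM2l ?powR_ge0//; exact: norm_powR_le.
apply: (@le_trans _ _ ((Num.sqrt n%:R * `|G x|) `^ p x)); last first.
  by apply: powR_scale_le; rewrite ?sqrtr_ge0 ?(ltW px) ?pP.
apply: ge0_ler_powR; rewrite ?nnegrE ?mulr_ge0 ?sqrtr_ge0 ?(ltW px0)//.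
by rewrite ger0_norm ?enorm_ge0// enorm_le_norm.
Qed.

Lemma modular_components_enorm G : (forall i, measurable_fun Om (fun x => G x ord0 i)) ->
  (forall i, rho (fun x => G x ord0 i) < +oo)%E -> (rho (enorm \o G) < +oo)%E.
Proof.
move=> mG Goo; apply: le_lt_trans (modular_enorm_le mG) _.
rewrite lte_mul_pinfty ?lee_fin ?powR_ge0//.
by apply: lte_sum_pinfty => i _; exact: Goo.
Qed.

Lemma Sobolev0_W0_approx u : variable_Sobolev0 Om p u ->
  exists2 G, weak_gradient Om u G & W0_approx Om p u G.
Proof.
move=> [[[mu_ _] _] [G wG h]]; exists G => //; have [_ hG] := wG.
have mG i : measurable_fun Om (fun x => G x ord0 i) by have [[]] := hG i.
(* The minimum with 1 makes [modular_luxemburg] applicable. *)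
split=> // e e0; have e'0 : 0 < Num.min e 1 by rewrite lt_min e0 ltr01.
have e'1 : Num.min e 1 <= 1 by rewrite ge_min lexx orbT.
have e'e : Num.min e 1 <= e by rewrite ge_min lexx.
have [phi tphi /Sobolev_norm_lt[h1 h2]] := h _ e'0.
exists phi => //.
have mphi : measurable_fun Om phi by apply: measurable_funTS; exact: test_function_measurable tphi.
have mD i : measurable_fun Om (fun x => (G x - gradient phi x) ord0 i).
  under eq_fun do rewrite !mxE.
  apply: measurable_funB => //; apply: measurable_funTS.
  exact: (test_function_measurable (test_function_partial i tphi)).
split.
  apply: (@le_trans _ _ (Num.min e 1)%:E); last by rewrite lee_fin.
  by apply: (modular_luxemburg mOm mp p1) => //; exact: measurable_funB.
move=> i; apply: (@le_trans _ _ (Num.min e 1)%:E); last by rewrite lee_fin.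
have mE : measurable_fun Om (enorm \o (fun x => G x - gradient phi x)) by exact: measurable_enorm.
have := modular_luxemburg mOm mp p1 mE e'1 h2.
apply: le_trans; apply: le_trans (modular_coord_le i mD).
rewrite le_eqVlt; apply/orP; left; apply/eqP; apply: eq_integral => x _.
by rewrite !mxE.
Qed.

Lemma W0_approx_Sobolev0 u G : W0_approx Om p u G -> variable_Sobolev0 Om p u.
Proof.
move=> W; have [uoo Goo] := W0_approx_lty mOm mp p1 pP W; have [mu_ mG h] := W.
have wG := W0_approx_weak_gradient mOm mp p1 pP W.
split.
  split; first exact/(variable_LebesgueP mOm mp p1 pP).
  exists G => //; apply/(variable_LebesgueP mOm mp p1 pP); split.
    exact: measurable_enorm.
  exact: modular_components_enorm.
exists G => // e e0; have e20 : 0 < e / 2 by rewrite divr_gt0.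
have [d d0 hd] := luxemburg_small mOm mp p1 pP e20.
(* The factor lost in [modular_enorm_le] when [n] components are each bounded by the same number;
   adding 1 keeps it positive. *)
pose c := (1 + Num.sqrt n%:R : R) `^ P * n%:R + 1.
have c0 : 0 < c by rewrite ltr_pwDr// mulr_ge0 ?powR_ge0.
have d'0 : 0 < Num.min d (d / c) by rewrite lt_min d0 divr_gt0.
have [phi tphi [h1 h2]] := h _ d'0; exists phi => //.
have mphi : measurable_fun Om phi by apply: measurable_funTS; exact: test_function_measurable tphi.
have mD i : measurable_fun Om (fun x => (G x - gradient phi x) ord0 i).
  under eq_fun do rewrite !mxE.
  apply: measurable_funB => //; apply: measurable_funTS.
  exact: (test_function_measurable (test_function_partial i tphi)).
rewrite (splitr e) EFinD /Sobolev_norm; apply: lteD.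
- apply: hd; first exact: measurable_funB.
  by apply: (le_trans h1); rewrite lee_fin ge_min lexx.
apply: hd; first exact: measurable_enorm.
apply: (le_trans (modular_enorm_le mD)).
apply: (@le_trans _ _ (((1 + Num.sqrt n%:R) `^ P)%:E * \sum_(i < n) (d / c)%:E)%E).
  rewrite lee_wpmul2l ?lee_fin ?powR_ge0//; apply: lee_sum => i _.
  apply: (@le_trans _ _ (Num.min d (d / c))%:E); last by rewrite lee_fin ge_min lexx orbT.
  apply: le_trans (h2 i); rewrite le_eqVlt; apply/orP; left; apply/eqP.
  by apply: eq_integral => x _; rewrite !mxE.
rewrite sumEFin sumr_const card_ord.
suff h' : (1 + Num.sqrt n%:R) `^ P * ((d / c) *+ n) <= d by exact: h'.
rewrite -[d / c *+ n]mulr_natl mulrA mulrCA ler_piMr ?(ltW d0)//.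
by rewrite ler_pdivrMr// mul1r lerDl.
Qed.

Lemma W0_approxB u1 u2 G1 G2 : W0_approx Om p u1 G1 -> W0_approx Om p u2 G2 ->
  W0_approx Om p (fun x => u1 x - u2 x) (fun x => G1 x - G2 x).
Proof.
move=> [m1 mG1 h1] [m2 mG2 h2]; split.
- exact: measurable_funB.
- by move=> i; under eq_fun do rewrite !mxE; exact: measurable_funB.
move=> e e0; pose c : R := 3 `^ P; have c0 : 0 < c by rewrite powR_gt0.
pose d := e / 2 / c; have d0 : 0 < d by rewrite !divr_gt0.
have cde : c * (d + d) <= e by rewrite /d -mulrDl -splitr mulrC divfK// gt_eqF.
have [phi1 t1 [a1 b1]] := h1 d d0; have [phi2 t2 [a2 b2]] := h2 d d0.
have tN : test_function Om (cst (- 1) * phi2) := test_functionM (smooth_cst (- 1)) t2.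
have key (v1 v2 f1 f2 : 'rV[R]_n -> R) : measurable_fun Om v1 -> measurable_fun Om v2 ->
    measurable_fun Om f1 -> measurable_fun Om f2 ->
    (rho (fun x => v1 x - f1 x)%R <= d%:E)%E -> (rho (fun x => v2 x - f2 x)%R <= d%:E)%E ->
    (rho (fun x => (v1 x - v2 x) - (f1 x - f2 x))%R <= e%:E)%E.
  move=> mv1 mv2 mf1 mf2.
  have mm : measurable_fun Om (fun x => - (v2 x - f2 x)).
    by apply: measurableT_comp => //; exact: measurable_funB.
  move=> r1 r2.
  have e1 : rho (fun x => v2 x - f2 x) = rho (fun x => - (v2 x - f2 x)).
    by apply: eq_integral => x _; rewrite normrN.
  rewrite e1 in r2.
  have -> : (fun x => (v1 x - v2 x) - (f1 x - f2 x)) = (fun x => (v1 x - f1 x) + - (v2 x - f2 x)).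
    by apply/funext => x; move: (v1 x) (v2 x) (f1 x) (f2 x) => s t s1 t1'; ring.
  apply: le_trans (modularD mOm mp p1 pP (measurable_funB mv1 mf1) mm) _.
  apply: (@le_trans _ _ (c%:E * (d%:E + d%:E))%E); last exact: cde.
  apply: lee_wpmul2l; first by rewrite lee_fin ltW.
  exact: (leeD r1 r2).
have mt (f : 'rV[R]_n -> R) : test_function Om f -> measurable_fun Om f.
  by move=> tf; apply: measurable_funTS; exact: test_function_measurable tf.
have mpt (f : 'rV[R]_n -> R) i : test_function Om f -> measurable_fun Om (partial i f).
  by move=> tf; apply: mt; exact: test_function_partial.
have N2 x : (phi1 + cst (- 1) * phi2) x = phi1 x - phi2 x by rewrite !fctE mulN1r.
exists (phi1 + cst (- 1) * phi2); first exact: test_functionD.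
split.
  rewrite (_ : (fun x => _) = (fun x => (u1 x - u2 x) - (phi1 x - phi2 x))).
    exact: (key _ _ _ _ m1 m2 (mt _ t1) (mt _ t2) a1 a2).
  by apply/funext => x; rewrite N2.
move=> i.
have [s1 _ _] := t1; have [s2 _ _] := t2; have [sN _ _] := tN.
rewrite (_ : (fun x => _) = (fun x => (G1 x ord0 i - G2 x ord0 i) - (partial i phi1 x - partial i phi2 x))).
  exact: (key _ _ _ _ (mG1 i) (mG2 i) (mpt _ i t1) (mpt _ i t2) (b1 i) (b2 i)).
apply/funext => x; rewrite !mxE (partialD i x s1 sN) (partialM i x (smooth_cst (- 1)) s2).
rewrite (_ : partial i (cst (-1)) x = 0); last exact: derive_cst.
by rewrite mulr0 addr0 fctE mulN1r.
Qed.

End zero_trace_spaces.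

(** * The test function *)

Section truncated_mollification.
Context {R : realType} {n : nat}.
Implicit Types (f g u phi eta F : 'rV[R]_n -> R) (G : 'rV[R]_n -> 'rV[R]_n).
Local Notation mu := (@lebesgue_rV R n).
Variables (Om : set 'rV[R]_n) (p : 'rV[R]_n -> R) (P L : R).
Hypotheses (oOm : open Om) (mp : measurable_fun Om p)
  (p1 : forall x, Om x -> 1 < p x) (pP : forall x, Om x -> p x <= P)
  (P2 : 2 <= P) (L0 : 0 <= L)
  (pL : forall x y, Om x -> Om y -> `|p x - p y| <= L * `|x - y|).
Local Notation rho := (modular Om p).

Let mOm : measurable Om. Proof. exact: open_rV_measurable. Qed.

(** Values off [Om] are arbitrary and must be discarded before convolving. The ball is there because
    finite modular gives integrability only on sets of finite measure. *)
Definition cutoff N F : 'rV[R]_n -> R := F \_ (Om `&` cball N).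

Let mON N : measurable (Om `&` cball N).
Proof. by apply: measurableI => //; exact: measurable_cball. Qed.

Lemma measurable_cut N F : measurable_fun Om F -> measurable_fun setT (cutoff N F).
Proof.
move=> mF; apply/(measurable_restrictT _ (mON N)).
by apply: measurable_funS mF => //; exact: subIsetl.
Qed.

Lemma cutE N F x : Om x -> `|x| <= N -> cutoff N F x = F x.
Proof. by move=> Ox xN; rewrite /cutoff patchE mem_set. Qed.

Lemma cut_neq0 N F x : cutoff N F x != 0 -> Om x /\ `|x| <= N.
Proof. by rewrite /cutoff patchE; case: ifPn => [|_ /eqP//]; rewrite inE. Qed.

Lemma cut_loc_int N F : measurable_fun Om F -> (rho F < +oo)%E -> loc_int (cutoff N F).
Proof.
move=> mF Foo; apply: integrable_loc_int.
rewrite (_ : EFin \o _ = (EFin \o F) \_ (Om `&` cball N)); last by rewrite restrict_EFin.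
apply/(integrable_mkcond _ (mON N)).
have mI := mON N.
have iK : mu.-integrable (Om `&` cball N) (EFin \o (fun x => `|F x| `^ p x)).
  by apply: integrableS (integrable_modular mOm mp mF Foo).
have i1 : mu.-integrable (Om `&` cball N) (EFin \o cst (1 : R)).
  apply: measurable_bounded_integrable => //.
    apply: le_lt_trans (lebesgue_rV_cball_lty (n := n) N).
    by apply: le_measure; rewrite ?inE//; exact: measurable_cball.
  by exists 1; split=> // M M1 x _ /=; rewrite normr1 ltW.
have i2 := integrableZl mI ((1 + 1^-1) `^ P) iK.
have i3 := integrableD mI i1 i2.
apply: (le_integrable mI _ _ i3).
  by apply/measurable_EFinP; apply: measurable_funS mF => //; exact: subIsetl.
move=> x [Ox _].
suff h : `|F x| <= `|1 + (1 + 1^-1) `^ P * `|F x| `^ p x| by exact: h.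
rewrite [leRHS]ger0_norm ?addr_ge0 ?mulr_ge0 ?powR_ge0//.
by apply: le_delta_powR => //; [exact: p1|exact: pP].
Qed.

Lemma mollify_cut C F N (e : R) : 0 < C -> measurable_fun Om F -> (rho F < +oo)%E ->
  0 < e -> exists2 d : R, 0 < d & forall eps eta, 0 < eps -> eps < d ->
    mollifier eps C eta ->
    (rho (fun x => convol eta (cutoff N F) x - cutoff N F x)%R <= e%:E)%E.
Proof.
move=> C0 mF Foo e0.
(* Outside Om the exponent is irrelevant, but it must lie in ]1, P]. *)
pose q x := 2 + ((fun y => p y - 2) \_ Om) x.
have qE x : Om x -> q x = p x.
  by move=> Ox; rewrite /q patchE mem_set// addrC subrK.
have qN x : ~ Om x -> q x = 2.
  by move=> Ox; rewrite /q patchE memNset// addr0.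
have mq : measurable_fun setT q.
  apply: measurable_funD => //; apply/(measurable_restrictT _ mOm).
  exact: measurable_funB.
have q1 x : 1 < q x.
  have [Ox|nOx] := pselect (Om x); first by rewrite qE// p1.
  by rewrite qN// ltr1n.
have qP x : q x <= P.
  by have [Ox|nOx] := pselect (Om x); [rewrite qE// pP | rewrite qN].
have qL x y : Om x -> Om y -> `|q x - q y| <= L * `|x - y|.
  by move=> Ox Oy; rewrite !qE// pL.
have Fq : (\int[mu]_x (`|cutoff N F x| `^ q x)%:E < +oo)%E.
  apply: le_lt_trans Foo; rewrite /modular [leRHS]integral_mkcond.
  apply: ge0_le_integral => //.
  - apply/measurable_EFinP; apply: measurable_powR_fun => //.
    by apply: measurableT_comp => //; exact: measurable_cut.
  - apply/(measurable_restrictT _ mOm); exact: measurable_modular.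
  - move=> x _; have q0 : 0 < q x by exact: lt_trans (q1 x).
    have [cx|/cut_neq0[Ox xN]] := eqVneq (cutoff N F x) 0.
      rewrite cx normr0 powR0 ?gt_eqF// patchE; case: ifPn => // _.
      by rewrite lee_fin powR_ge0.
    by rewrite patchE mem_set// cutE// qE.
have [d d0 hd] := mollify_modular_cvg mOm mq q1 qP L0 qL C0 (measurable_cut N mF)
  (@cut_neq0 N F) Fq e0.
exists d; first exact: d0.
move=> eps eta e'0 ed me; have := hd eps eta e'0 ed me; apply: le_trans.
rewrite le_eqVlt; apply/orP; left; apply/eqP; apply: eq_integral => x.
by rewrite inE => Ox; rewrite qE.
Qed.

(** The weak gradient of [h] is tested with [eta (y - x)], which is a test function on [Om] because
    the ball of radius [eps] about [x] lies in [Om]; within radius [N] the cutoff is invisible. The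
    sign of [is_derive_conv] cancels that of the weak gradient. *)
Lemma partial_convol_cut h K eps C eta N x i : weak_gradient Om h K ->
  (rho h < +oo)%E -> mollifier eps C eta ->
  (forall y, `|y - x| <= eps -> Om y /\ `|y| <= N) ->
  partial i (convol eta (cutoff N h)) x = convol eta (cutoff N (fun y => K y ord0 i)) x.
Proof.
move=> [[mh _] wh] hoo me xO; have [teta _ _ _ [sup _]] := me; have [seta _ _] := teta.
have lh := cut_loc_int N mh hoo.
have [_ dE] := is_derive_conv x i teta lh; rewrite [LHS]dE.
pose psi := fun y => eta (y - x).
have tpsi : test_function Om psi.
  apply: (@test_functionI _ _ _ [set y | `|y - x| <= eps]).
  - exact: smooth_shift.
  - apply: bounded_closed_compact.
      exists (eps + `|x|); split=> [|M hM y /= yx]; first exact: num_real.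
      rewrite -[y](subrK x) (le_trans (ler_normD _ _))// (le_trans _ (ltW hM))// lerD2r//.
    rewrite (_ : mkset _ = (fun y => y - x) @^-1` cball eps)//.
    apply: closed_comp; last exact: closed_cball.
    move=> y _; apply: continuousB; [exact: cvg_id|exact: cst_continuous].
  - by move=> y /= /xO[].
  - by move=> y /negP; rewrite -ltNge; exact: sup.
have [_ /(_ psi tpsi)] := wh i.
have toOm (zeta F : 'rV[R]_n -> R) : (forall y, eps < `|y - x| -> zeta y = 0) ->
    \int[mu]_(y in Om) (F y * zeta y) = \int[mu]_y (zeta y * cutoff N F y).
  move=> z0; rewrite Rintegral_mkcond; apply: eq_Rintegral => y _; rewrite patchE.
  have [xy|xy] := ltP eps `|y - x|; first by rewrite z0// mulr0 mul0r if_same.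
  by have [Oy yN] := xO y xy; rewrite mem_set// cutE// mulrC.
have psi0 y : eps < `|y - x| -> psi y = 0 by exact: sup.
have ppsi y : partial i psi y = partial i eta (y - x) by exact: partial_shift.
have ppsi0 y : eps < `|y - x| -> partial i psi y = 0.
  move=> xy; rewrite ppsi.
  have e0 z : ~ cball eps z -> eta z = 0 by move=> /negP; rewrite -ltNge; exact: sup.
  by apply: (partial_supported i (@closed_cball R n eps) e0); apply/negP; rewrite -ltNge.
rewrite (toOm _ _ ppsi0) (toOm _ _ psi0) => E.
have -> : convol eta (cutoff N (fun y => K y ord0 i)) x =
    \int[mu]_y (psi y * cutoff N (fun y => K y ord0 i) y) by [].
have -> : convol (partial i eta) (cutoff N h) x =
    \int[mu]_y (partial i psi y * cutoff N h y).
  by apply: eq_Rintegral => y _; rewrite ppsi.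
by rewrite E opprK.
Qed.

Lemma convol_cut_le0 h eps C eta N x : measurable_fun Om h -> (rho h < +oo)%E ->
  mollifier eps C eta ->
  {ae mu, forall x, Om x -> h x <= 0} -> convol eta (cutoff N h) x <= 0.
Proof.
move=> mh hoo me h0; have [teta eta0 _ _ _] := me.
have lh := cut_loc_int N mh hoo.
have ih := conv_integrable x teta lh.
rewrite -oppr_ge0 -mulN1r -RintegralZl//.
rewrite /Rintegral fine_ge0//.
rewrite (@ae_eq_integral _ _ _ mu setT (fun y => `|eta (y - x) * cutoff N h y|%:E))//.
- by apply: integral_ge0 => y _; rewrite lee_fin.
- exact: (measurable_int mu (integrableZl measurableT (- 1) ih)).
- apply/measurable_EFinP; apply: measurableT_comp => //.
  by apply/measurable_EFinP; exact: (measurable_int mu ih).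
apply: filterS h0 => y hy _; rewrite mulN1r; congr EFin.
rewrite ler0_norm//; apply: mulr_ge0_le0 => //.
rewrite /cutoff patchE; case: ifPn => //; rewrite inE => -[Oy _].
exact: hy.
Qed.

(** Each point of [K] admits a radius valid for all nearby points as well; compactness makes it
    uniform. *)
Lemma compact_thickening K : compact K -> K `<=` Om ->
  exists2 r : R, 0 < r & forall x, K x -> forall y, `|y - x| <= r -> Om y.
Proof.
move=> cK KOm.
have /compact_near_coveringP nc := cK.
have [] := nc R (0^'+) (fun r x => forall y, `|y - x| <= r -> Om y) _.
  move=> x Kx; have /nbhs_ballP[e /= e0 xeO] : nbhs x Om.
    by apply: open_nbhs_nbhs; split => //; exact: KOm.
  exists (ball x (e / 2), [set r | r < e / 2]).
    split => /=.
      by apply: nbhsx_ballx; rewrite divr_gt0.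
    by apply: nbhs_right_lt; rewrite divr_gt0.
  move=> [x' r] /= [xx' re] y yx'; apply: xeO.
  rewrite -ball_normE /ball_ /= in xx' *.
  rewrite -(subrKA x') (le_lt_trans (ler_normD _ _))// (splitr e) ltr_leD//.
  by rewrite distrC (le_trans yx')// ltW.
move=> d /= d0 hd; exists (d / 2); first by rewrite divr_gt0.
move=> x Kx; apply: (hd (d / 2)) => //=.
  by rewrite sub0r normrN gtr0_norm ?divr_gt0// ltr_pdivrMr// ltr_pMr// ltr1n.
by rewrite divr_gt0.
Qed.

End truncated_mollification.

(** * Composition with [H] preserves zero boundary values *)

Section truncation.
Context {R : realType} {n : nat}.
Implicit Types (f g u phi eta F : 'rV[R]_n -> R) (G : 'rV[R]_n -> 'rV[R]_n).
Local Notation mu := (@lebesgue_rV R n).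

Lemma flatn_value_bound (La w h phi he : R) :
  (forall s t, `|flatn 0 s - flatn 0 t| <= La * `|s - t|) -> 0 <= La ->
  `|flatn 0 (w + h) - flatn 0 (phi + he)| <= La * (`|w - phi| + `|h - he|).
Proof.
move=> hL La0; apply: (le_trans (hL _ _)); rewrite ler_wpM2l//.
by rewrite opprD addrACA ler_normD.
Qed.

(** The difference is written [(a - b) * (W + K) + b * (...)]. As [W + K] is unbounded, the
    Lipschitz bound on [a - b] is used only where [s <= M]; elsewhere [a - b] is bounded by [2 C1].
    The number [s] stands for the size of the full gradient, so that the splitting is the same for
    all components. *)
Lemma flatn_gradient_bound (C1 Lb M s w h W K phi he dphi Ke : R) :
  (forall t, `|flatn 1 t| <= C1) ->
  (forall s t, `|flatn 1 s - flatn 1 t| <= Lb * `|s - t|) -> 0 <= Lb -> 0 <= M ->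
  `|W + K| <= s ->
  `|flatn 1 (w + h) * (W + K) - flatn 1 (phi + he) * (dphi + Ke)| <=
  (C1 *+ 2) * `|if M < s then W + K else 0| +
  (M * Lb + C1) * (`|w - phi| + `|h - he| + `|W - dphi| + `|K - Ke|).
Proof.
move=> hC hL Lb0 M0 Ds.
have C10 : 0 <= C1 by exact: le_trans (hC 0).
set a := flatn 1 (w + h); set b := flatn 1 (phi + he).
have -> : a * (W + K) - b * (dphi + Ke) =
    (a - b) * (W + K) + b * ((W - dphi) + (K - Ke)) by ring.
rewrite (le_trans (ler_normD _ _))//.
have hb : `|b * (W - dphi + (K - Ke))| <= C1 * (`|W - dphi| + `|K - Ke|).
  by rewrite normrM ler_pM ?hC// ler_normD.
have hab : `|(a - b) * (W + K)| <=
    C1 *+ 2 * `|if M < s then W + K else 0| + M * Lb * (`|w - phi| + `|h - he|).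
  rewrite normrM; case: ltP => [Ms|sM].
    rewrite ler_wpDr ?mulr_ge0 ?addr_ge0// ler_wpM2r//.
    by rewrite (le_trans (ler_normB _ _))// mulr2n lerD//; exact: hC.
  rewrite normr0 mulr0 add0r mulrC -mulrA ler_pM//; first exact: le_trans sM.
  apply: (le_trans (hL _ _)); rewrite ler_wpM2l//.
  by rewrite opprD addrACA ler_normD.
apply: (le_trans (lerD hab hb)); rewrite -addrA lerD2l.
have m1 : 0 <= M * Lb by rewrite mulr_ge0.
move: (normr_ge0 (w - phi)) (normr_ge0 (h - he)) (normr_ge0 (W - dphi)) (normr_ge0 (K - Ke)).
move: `|w - phi| `|h - he| `|W - dphi| `|K - Ke| => r1 r2 r3 r4 g1 g2 g3 g4.
rewrite mulrDl -!addrA lerD//.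
  by rewrite ler_wpM2l// addrA lerDl addr_ge0.
by rewrite ler_wpM2l// addrA lerDr addr_ge0.
Qed.

Variables (Om : set 'rV[R]_n) (p : 'rV[R]_n -> R) (P L : R).
Hypotheses (oOm : open Om) (mp : measurable_fun Om p)
  (p1 : forall x, Om x -> 1 < p x) (pP : forall x, Om x -> p x <= P)
  (P2 : 2 <= P) (L0 : 0 <= L)
  (pL : forall x y, Om x -> Om y -> `|p x - p y| <= L * `|x - y|).
Local Notation rho := (modular Om p).

Let mOm : measurable Om. Proof. exact: open_rV_measurable. Qed.
Let P0 : 0 <= P. Proof. exact: le_trans P2. Qed.
Let c : R := 3 `^ P.
Let c1 : 1 <= c. Proof. by rewrite /c powR_ge1// ler1n. Qed.
Let c0 : 0 <= c. Proof. exact: le_trans c1. Qed.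

Lemma modularD_le f g (a b : R) : measurable_fun Om f -> measurable_fun Om g ->
  (rho f <= a%:E)%E -> (rho g <= b%:E)%E ->
  (rho (fun x => f x + g x)%R <= (c * (a + b))%:E)%E.
Proof.
move=> mf mg fa gb; apply: (le_trans (modularD mOm mp p1 pP mf mg)).
by rewrite EFinM lee_wpmul2l ?lee_fin// EFinD leeD.
Qed.

Lemma modularZ_le (k a : R) f : 0 <= k -> measurable_fun Om f -> (rho f <= a%:E)%E ->
  (rho (fun x => k * f x)%R <= ((1 + k) `^ P * a)%:E)%E.
Proof.
move=> k0 mf fa; apply: (le_trans (modularZ mOm mp p1 pP k mf)).
by rewrite ger0_norm// EFinM lee_wpmul2l ?lee_fin ?powR_ge0.
Qed.

Lemma modular_norm f : rho (fun x => `|f x|) = rho f.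
Proof. by apply: eq_integral => x _; rewrite normr_id. Qed.

Lemma measurable_flatn j f : measurable_fun Om f -> measurable_fun Om (fun x => flatn j (f x)).
Proof.
by move=> mf; apply: measurableT_comp mf => //; apply: continuous_measurable_fun; exact: flatn_continuous.
Qed.

Lemma measurable_sum_norm G : (forall i, measurable_fun Om (fun x => G x ord0 i)) ->
  measurable_fun Om (fun x => \sum_i `|G x ord0 i|).
Proof. by move=> mG; apply: measurable_sum => i; exact: measurableT_comp. Qed.

(** One level for all components: the threshold is on the sum of the absolute values, and
    [integral_tail] is applied to the sum of the powers, which dominates each of them. *)
Lemma gradient_tail G (tau : R) : (forall i, measurable_fun Om (fun x => G x ord0 i)) ->
  (forall i, rho (fun x => G x ord0 i) < +oo)%E -> 0 < tau ->
  exists2 M : R, 1 <= M & forall i,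
    (rho (fun x => if M < \sum_j `|G x ord0 j| then G x ord0 i else 0)%R <= tau%:E)%E.
Proof.
move=> mG Goo tau0.
pose S x := \sum_i `|G x ord0 i| `^ p x.
have S0 x : 0 <= S x by apply: sumr_ge0 => i _; exact: powR_ge0.
have iS : mu.-integrable Om (EFin \o S).
  rewrite (_ : EFin \o S = (fun x => \sum_i (`|G x ord0 i| `^ p x)%:E)%E); last first.
    by apply/funext => x; rewrite /= /S sumEFin.
  apply: (integrable_sum mOm) => i _; exact: (integrable_modular mOm mp (mG i) (Goo i)).
have mS := measurable_sum_norm mG.
have [M M1 hM] := integral_tail mOm iS S0 mS tau0.
exists M => // i; apply: le_trans hM; apply: ge0_le_integral => //.
- apply: measurable_modular => //; apply: measurable_fun_if => //.
  + exact: measurable_fun_ltr.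
  + by apply: measurable_funS (mG i) => //; exact: subIsetl.
- apply/measurable_EFinP; apply: measurable_fun_if => //.
  + exact: measurable_fun_ltr.
  + apply: (measurable_funS mOm); first exact: subIsetl.
    by apply/measurable_EFinP; exact: (measurable_int mu iS).
move=> x Ox; have px0 : 0 < p x by exact: lt_trans (p1 Ox).
rewrite lee_fin; case: ifPn => _; last by rewrite normr0 powR0// gt_eqF.
by rewrite /S (bigD1 i)//= lerDl sumr_ge0// => j _; exact: powR_ge0.
Qed.

(* Approximate w by a test function phi and h by its mollification he. As h <= 0,
   also he <= 0, so flatn 0 (phi + he) vanishes off the support of phi: it is a
   test function although h has no prescribed boundary values. *)
Lemma truncation_W0_approx w W h K : W0_approx Om p w W -> weak_gradient Om h K ->
  (rho h < +oo)%E -> (forall i, rho (fun x => K x ord0 i) < +oo)%E ->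
  {ae mu, forall x, Om x -> h x <= 0} ->
  W0_approx Om p (fun x => flatn 0 (w x + h x))
    (fun x => flatn 1 (w x + h x) *: (W x + K x)).
Proof.
move=> W0w wh hoo Koo h0.
have [woo Woo] := W0_approx_lty mOm mp p1 pP W0w; have [mw mW apw] := W0w.
have [[mh _] hK] := wh.
have mK i : measurable_fun Om (fun x => K x ord0 i) by have [[]] := hK i.
have mwh : measurable_fun Om (fun x => w x + h x) by exact: measurable_funD.
have mD i : measurable_fun Om (fun x => (W x + K x) ord0 i).
  by under eq_fun do rewrite mxE; exact: measurable_funD.
have Doo i : (rho (fun x => (W x + K x) ord0 i)%R < +oo)%E.
  rewrite (_ : (fun x => _) = (fun x => W x ord0 i + K x ord0 i)).
    exact: (modularD_lty mOm mp p1 pP (mW i) (mK i) (Woo i) (Koo i)).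
  by apply/funext => x; rewrite mxE.
split; first exact: measurable_flatn.
  move=> i; under eq_fun do rewrite mxE.
  by apply: measurable_funM => //; exact: measurable_flatn.
move=> e e0.
have [C C0 hC] := @mollifier_exists R n.
have [C1 C10 hC1] := @flatn_bounded R 1.
have [La La0 hLa] := @flatn_lipschitz R 0.
have [Lb Lb0 hLb] := @flatn_lipschitz R 1.
have e20 : 0 < e / 2 by rewrite divr_gt0.
pose k1 := (1 + C1 *+ 2) `^ P.
have k10 : 0 < k1 by rewrite powR_gt0// ltr_pwDl// mulrn_wge0.
have cgt0 : 0 < c by exact: lt_le_trans c1.
(* [tau] is spent on large gradients and determines the level [M]. Only then can [e1] be chosen,
   since it must compensate the factor [A], which grows with [M]. *)
pose tau := e / 2 / (c * k1).
have tau0 : 0 < tau by rewrite !divr_gt0// mulr_gt0.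
have [M M1 hM] := gradient_tail mD Doo tau0.
have M0 : 0 <= M by exact: le_trans M1.
pose A := M * Lb + C1.
have A0 : 0 <= A by rewrite addr_ge0// mulr_ge0.
pose k2 := (1 + A) `^ P; pose k3 := (1 + La) `^ P.
have k20 : 0 < k2 by rewrite powR_gt0// ltr_pwDl.
have k30 : 0 < k3 by rewrite powR_gt0// ltr_pwDl.
(* The constant accumulated when four errors of size [e1] are added by three uses of
   [modularD_le]. *)
pose c4 := c * (c * (c * (1 + 1) + 1) + 1).
have c40 : 0 < c4 by rewrite mulr_gt0// addr_gt0// mulr_gt0// addr_gt0// mulr_gt0// addr_gt0.
pose e1 := Num.min (e / (k3 * (c * (1 + 1)))) (e / 2 / (c * k2 * c4)).
have e10 : 0 < e1.
  have c20 : 0 < c * (1 + 1) by rewrite mulr_gt0// addr_gt0.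
  by rewrite lt_min; apply/andP; split; apply: divr_gt0 => //; [exact: mulr_gt0 | exact: (mulr_gt0 (mulr_gt0 cgt0 k20) c40)].
have [phi tphi [ap1 ap2]] := apw e1 e10.
have [sphi _ _] := tphi.
have [S [cS SOm S0]] := test_function_support tphi.
have [N0 N01 SN] := compact_sub_cball cS.
have [r r0 hr] := compact_thickening oOm cS SOm.
(* Since [eps < 1], the [eps]-neighbourhood of [S] stays in [cball N], as [partial_convol_cut]
   requires. *)
pose N := N0 + 1.
pose ht := cutoff Om N h; pose Kt i := cutoff Om N (fun x => K x ord0 i).
have [d1 d10 hd1] := mollify_cut oOm mp p1 pP P2 L0 pL N C0 mh hoo e10.
have [d2 d20 hd2] : exists2 d : R, 0 < d & forall eps, 0 < eps -> eps < d -> forall i eta,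
    mollifier eps C eta -> (rho (fun x => convol eta (Kt i) x - Kt i x)%R <= e1%:E)%E.
  apply: (@exists_delta_all _ n (fun i eps => forall eta, mollifier eps C eta ->
    (rho (fun x => convol eta (Kt i) x - Kt i x)%R <= e1%:E)%E)) => i.
  have [d d0 hd] := mollify_cut oOm mp p1 pP P2 L0 pL N C0 (mK i) (Koo i) e10.
  exists d; first exact: d0.
  by move=> eps eps0 epsd eta me; exact: (hd eps eta eps0 epsd me).
pose D := Num.min (Num.min d1 d2) (Num.min r 1).
have D0 : 0 < D by rewrite !lt_min d10 d20 r0 ltr01.
pose eps := D / 2.
have eps0 : 0 < eps by rewrite divr_gt0.
have epsD : eps < D by rewrite ltr_pdivrMr// ltr_pMr// ltr1n.
move: (epsD); rewrite !lt_min => /andP[/andP[epsd1 epsd2] /andP[epsr eps1]].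
have [eta me] := hC eps eps0.
have mol1 := hd1 eps eta eps0 epsd1 me.
have mol2 i := hd2 eps eps0 epsd2 i eta me.
have [teta _ _ _ _] := me.
have lht := cut_loc_int oOm mp p1 pP N mh hoo.
have lKt i := cut_loc_int oOm mp p1 pP N (mK i) (Koo i).
pose he := convol eta ht.
have she : smooth he by exact: conv_smooth.
pose psi := flatn 0 \o (phi + he).
have sps : smooth (phi + he) by exact: smoothD.
have spsi : smooth psi by apply: smooth_comp; [exact: is_derive_flatn|].
have he0 x : he x <= 0.
  by apply: (convol_cut_le0 oOm mp p1 pP N x mh hoo me h0).
have psi0 x : ~ S x -> psi x = 0.
  by move=> nS; rewrite /psi /= fctE S0// add0r flatn_le0.
have tpsi : test_function Om psi by exact: (test_functionI spsi cS SOm psi0).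
have clS : closed S by apply: compact_closed => //; exact: norm_hausdorff.
have SO x : S x -> Om x /\ `|x| <= N.
  by move=> Sx; split; [exact: SOm | rewrite (le_trans (SN x Sx))// lerDl].
have dpsi x i : S x -> partial i psi x =
    flatn 1 (phi x + he x) * (partial i phi x + convol eta (Kt i) x).
  move=> Sx; rewrite /psi (@partial_comp R n (@flatn R) 0 (phi + he) i x (@is_derive_flatn R) sps).
  rewrite partialD// (partial_convol_cut oOm mp p1 pP i wh hoo me)//.
  move=> y yx; split; first by apply: (hr x Sx); exact: le_trans (ltW epsr).
  rewrite -[y](subrK x) (le_trans (ler_normD _ _))// addrC lerD//; first exact: SN.
  by rewrite (le_trans yx)// ltW.
exists psi => //.
have mphi : measurable_fun Om phi by apply: measurable_funTS; exact: test_function_measurable tphi.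
have mpsi : measurable_fun Om psi by apply: measurable_funTS; exact: test_function_measurable tpsi.
have mht : measurable_fun Om ht by apply: measurable_funTS; exact: lht.1.
have mhe : measurable_fun Om he.
  by apply: measurable_funTS; exact: conv_measurable.
have mr1 : measurable_fun Om (fun x => `|w x - phi x|).
  by apply: measurableT_comp => //; exact: measurable_funB.
have mr2 : measurable_fun Om (fun x => `|ht x - he x|).
  by apply: measurableT_comp => //; exact: measurable_funB.
have r1 : (rho (fun x => `|w x - phi x|)%R <= e1%:E)%E.
  by rewrite (modular_norm (fun x => w x - phi x)); exact: ap1.
have r2 : (rho (fun x => `|ht x - he x|)%R <= e1%:E)%E.
  rewrite (_ : (fun x => _) = (fun x => `|he x - ht x|)).
    by rewrite (modular_norm (fun x => he x - ht x)); exact: mol1.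
  by apply/funext => x; rewrite distrC.
have mr12 := measurable_funD mr1 mr2.
have r12 := modularD_le mr1 mr2 r1 r2.
split.
  apply: (@le_trans _ _ (rho (fun x => La * (`|w x - phi x| + `|ht x - he x|)))).
    apply: le_modular => //.
    - by apply: measurable_funB => //; exact: measurable_flatn.
    - by apply: measurable_funM => //; exact: measurable_cst.
    apply: filterS h0 => x hx Ox; have {}hx := hx Ox.
    rewrite [leRHS]ger0_norm ?mulr_ge0 ?addr_ge0//.
    have [Sx|nSx] := pselect (S x).
      have -> : ht x = h x by have [? ?] := SO x Sx; exact: cutE.
      exact: flatn_value_bound.
    (* Off [S] the value 0 of [psi] is also [flatn 0 (0 + h x)], because [h x <= 0]. So [h x] can
       take the place of [he x], and only [|w - phi|] remains, even where the cutoff differs from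
       [h]. *)
    rewrite psi0// -(flatn_le0 0 hx) -{2}[h x]add0r (S0 x)//.
    apply: (le_trans (flatn_value_bound _ _ _ _ hLa La0)).
    by rewrite ler_wpM2l// lerD2l subrr normr0.
  apply: le_trans (modularZ_le La0 mr12 r12) _; rewrite -/k3.
  suff h' : k3 * (c * (e1 + e1)) <= e by exact: h'.
  have -> : k3 * (c * (e1 + e1)) = k3 * (c * (1 + 1)) * e1 by ring.
  have kk : 0 < k3 * (c * (1 + 1)) by rewrite !mulr_gt0// addr_gt0.
  by rewrite mulrC -ler_pdivlMr// ge_min lexx.
move=> i.
have tpphi := test_function_partial i tphi.
have mpphi : measurable_fun Om (partial i phi).
  by apply: measurable_funTS; exact: test_function_measurable tpphi.
have mppsi : measurable_fun Om (partial i psi).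
  by apply: measurable_funTS; exact: (test_function_measurable (test_function_partial i tpsi)).
have mKt : measurable_fun Om (Kt i) by apply: measurable_funTS; exact: (lKt i).1.
have mKe : measurable_fun Om (convol eta (Kt i)).
  by apply: measurable_funTS; apply: conv_measurable => //; exact: lKt.
have mr3 : measurable_fun Om (fun x => `|W x ord0 i - partial i phi x|).
  by apply: measurableT_comp => //; exact: measurable_funB.
have mr4 : measurable_fun Om (fun x => `|Kt i x - convol eta (Kt i) x|).
  by apply: measurableT_comp => //; exact: measurable_funB.
have r3 : (rho (fun x => `|W x ord0 i - partial i phi x|)%R <= e1%:E)%E.
  by rewrite (modular_norm (fun x => W x ord0 i - partial i phi x)); exact: ap2.
have r4 : (rho (fun x => `|Kt i x - convol eta (Kt i) x|)%R <= e1%:E)%E.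
  rewrite (_ : (fun x => _) = (fun x => `|convol eta (Kt i) x - Kt i x|)).
    by rewrite (modular_norm (fun x => convol eta (Kt i) x - Kt i x)); exact: mol2.
  by apply/funext => x; rewrite distrC.
have mr123 := measurable_funD mr12 mr3.
have r123 := modularD_le mr12 mr3 r12 r3.
have mr1234 := measurable_funD mr123 mr4.
have r1234 := modularD_le mr123 mr4 r123 r4.
pose t x := if M < \sum_j `|(W x + K x) ord0 j| then (W x + K x) ord0 i else 0.
have mt : measurable_fun Om t.
  apply: measurable_fun_if => //.
    by apply: measurable_fun_ltr => //; exact: measurable_sum_norm.
  by apply: measurable_funS (mD i) => //; exact: subIsetl.
have mnt : measurable_fun Om (fun x => `|t x|) by exact: measurableT_comp.
have rt : (rho (fun x => `|t x|)%R <= tau%:E)%E by rewrite (modular_norm t); exact: hM.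
have C120 : 0 <= C1 *+ 2 by rewrite mulrn_wge0.
have mZt : measurable_fun Om (fun x => C1 *+ 2 * `|t x|).
  by apply: measurable_funM => //; exact: measurable_cst.
have mZr : measurable_fun Om (fun x => A * (`|w x - phi x| + `|ht x - he x| +
    `|W x ord0 i - partial i phi x| + `|Kt i x - convol eta (Kt i) x|)).
  by apply: measurable_funM => //; exact: measurable_cst.
have rZt := modularZ_le C120 mnt rt.
have rZr := modularZ_le A0 mr1234 r1234.
have fin := modularD_le mZt mZr rZt rZr.
apply: (@le_trans _ _ (rho (fun x => C1 *+ 2 * `|t x| +
    A * (`|w x - phi x| + `|ht x - he x| +
    `|W x ord0 i - partial i phi x| + `|Kt i x - convol eta (Kt i) x|)))); last first.
  apply: (le_trans fin); rewrite lee_fin -/k1 -/k2.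
  have -> : c * (k1 * tau + k2 * (c * (c * (c * (e1 + e1) + e1) + e1))) =
      tau * (c * k1) + (c * k2 * c4) * e1 by rewrite /c4; ring.
  rewrite [leRHS]splitr lerD//.
    by rewrite /tau divfK// gt_eqF// mulr_gt0.
  have kk2 : 0 < c * k2 * c4 := mulr_gt0 (mulr_gt0 cgt0 k20) c40.
  by rewrite mulrC -(ler_pdivlMr _ _ kk2) ge_min lexx orbT.
apply: le_modular => //.
- apply: measurable_funB => //; under eq_fun do rewrite mxE.
  by apply: measurable_funM => //; exact: measurable_flatn.
- exact: measurable_funD.
apply: filterS h0 => x hx Ox; have {}hx := hx Ox.
have MLb0 : 0 <= M * Lb by rewrite mulr_ge0.
rewrite [leRHS]ger0_norm ?addr_ge0 ?mulr_ge0 ?addr_ge0//.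
have Ds : `|W x ord0 i + K x ord0 i| <= \sum_j `|(W x + K x) ord0 j|.
  by rewrite (bigD1 i)//= [X in `|X| + _]mxE lerDl sumr_ge0.
rewrite /t /A !mxE.
have [Sx|nSx] := pselect (S x).
  have [Ox' xN] := SO x Sx.
  have -> : ht x = h x by exact: cutE.
  have -> : Kt i x = K x ord0 i by exact: cutE.
  by rewrite dpsi//; exact: flatn_gradient_bound.
(* The same device for the gradient: off [S] the bound is used with [0], [h x], [0], [K x ord0 i]
   for [phi], [he], [dphi], [Ke], and [flatn 1 (0 + h x) = 0]. *)
rewrite (partial_supported i clS psi0 nSx) subr0.
rewrite (partial_supported i clS S0 nSx) (S0 x nSx).
have := flatn_gradient_bound (w x) (h x) 0 (h x) 0 (K x ord0 i) hC1 hLb Lb0 M0 Ds.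
rewrite [0 + h x]add0r (flatn_le0 1 hx) mul0r !subr0 !subrr normr0 !addr0 => /le_trans; apply.
apply: lerD => //; rewrite ler_wpM2l//.
by rewrite -[leRHS]addrA lerD ?lerDl.
Qed.

End truncation.

(** * Comparison *)

Section weak_gradients.
Context {R : realType} {n : nat}.
Implicit Types (f g u phi : 'rV[R]_n -> R) (G F : 'rV[R]_n -> 'rV[R]_n).
Local Notation mu := (@lebesgue_rV R n).
Variable Om : set 'rV[R]_n.
Hypothesis mOm : measurable Om.

Lemma loc_integrable_lincomb f g (k : R) : loc_integrable Om f -> loc_integrable Om g ->
  loc_integrable Om (fun x => f x + k * g x).
Proof.
move=> [mf lf] [mg lg]; split.
  by apply: measurable_funD => //; apply: measurable_funM.
move=> K cK KOm; have mK := compact_rV_measurable cK.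
exact: (integrableD mK (lf K cK KOm) (integrableZl mK k (lg K cK KOm))).
Qed.

Lemma weak_gradient_lincomb f g F G (k : R) : weak_gradient Om f F -> weak_gradient Om g G ->
  weak_gradient Om (fun x => f x + k * g x) (fun x => F x + k *: G x).
Proof.
move=> [lf hF] [lg hG]; split; first exact: loc_integrable_lincomb.
move=> i; have [lFi wF] := hF i; have [lGi wG] := hG i.
have lE : (fun x => (F x + k *: G x) ord0 i) = (fun x => F x ord0 i + k * G x ord0 i).
  by apply/funext => x; rewrite !mxE.
split; first by rewrite lE; exact: loc_integrable_lincomb.
move=> phi tphi; have tp := test_function_partial i tphi.
have lin (f1 f2 psi : 'rV[R]_n -> R) : loc_integrable Om f1 -> loc_integrable Om f2 ->
    test_function Om psi ->
    \int[mu]_(x in Om) ((f1 x + k * f2 x) * psi x) =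
    \int[mu]_(x in Om) (f1 x * psi x) + k * \int[mu]_(x in Om) (f2 x * psi x).
  move=> l1 l2 tpsi.
  have i1 := pairing_loc_integrable mOm l1 tpsi.
  have i2 := pairing_loc_integrable mOm l2 tpsi.
  rewrite -RintegralZl// -(RintegralD mOm i1 (integrableZl mOm k i2)).
  by apply: eq_Rintegral => x _; rewrite mulrDl mulrA.
rewrite lin// wF// wG// mulrN -opprD; congr (- _).
by rewrite -lin//; apply: eq_Rintegral => x _; rewrite !mxE.
Qed.

Lemma weak_gradientD f g F G : weak_gradient Om f F -> weak_gradient Om g G ->
  weak_gradient Om (fun x => f x + g x) (fun x => F x + G x).
Proof.
move=> wf wg; have := weak_gradient_lincomb 1 wf wg.
by under eq_fun do rewrite mul1r; under [X in weak_gradient _ _ X]eq_fun do rewrite scale1r.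
Qed.

Lemma weak_gradientB f g F G : weak_gradient Om f F -> weak_gradient Om g G ->
  weak_gradient Om (fun x => f x - g x) (fun x => F x - G x).
Proof.
move=> wf wg; have := weak_gradient_lincomb (- 1) wf wg.
by under eq_fun do rewrite mulN1r; under [X in weak_gradient _ _ X]eq_fun do rewrite scaleN1r.
Qed.

End weak_gradients.

(** * Monotonicity of the p-Laplace field and Young inequalities *)

Section monotonicity.
Context {R : realType} {n : nat}.
Implicit Types (x y z : 'rV[R]_n) (s t q : R).

Lemma dotC x y : dot x y = dot y x.
Proof. by apply: eq_bigr => i _; rewrite mulrC. Qed.

Lemma dotBr x y z : dot x (y - z) = dot x y - dot x z.
Proof. by rewrite -sumrB; apply: eq_bigr => i _; rewrite !mxE mulrBr. Qed.

Lemma dotZr x y (k : R) : dot x (k *: y) = k * dot x y.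
Proof. by rewrite mulr_sumr; apply: eq_bigr => i _; rewrite !mxE mulrCA. Qed.

(** Cauchy-Schwarz, from expanding the square of [dot y y *: x - dot x y *: y]. *)
Lemma dot_le_enorm x y : `|dot x y| <= enorm x * enorm y.
Proof.
have key : dot x y ^+ 2 <= dot x x * dot y y.
  have [y0|y0] := eqVneq (dot y y) 0.
    have yi i : y ord0 i = 0.
      have := coord_le_enorm y i; rewrite /enorm y0 sqrtr0.
      by rewrite normr_le0 => /eqP.
    have -> : dot x y = 0 by rewrite /dot big1// => i _; rewrite yi mulr0.
    by rewrite y0 mulr0 expr0n.
  have yy : 0 < dot y y by rewrite lt_def y0 dot_ge0.
  have := dot_ge0 (dot y y *: x - dot x y *: y).
  rewrite dotBr !dotZr dotC dotBr !dotZr (dotC (dot y y *: x - _)) dotBr !dotZr (dotC y x).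
  set a := dot x x; set b := dot x y; set c := dot y y => h.
  have h' : 0 <= c * (a * c - b ^+ 2).
    by apply: le_trans h _; rewrite le_eqVlt; apply/orP; left; apply/eqP; ring.
  by rewrite pmulr_rge0// subr_ge0 in h'.
by rewrite -[leLHS]sqrtr_sqr -sqrtrM ?dot_ge0// ler_wsqrtr.
Qed.

Lemma mul_powRB2 s q : 0 <= s -> 1 < q -> s * s `^ (q - 2) = s `^ (q - 1).
Proof.
rewrite le_eqVlt => /predU1P[<- q1|s0 q1].
  by rewrite mul0r powR0// gt_eqF// subr_gt0.
rewrite -{1}[s]powRr1 ?(ltW s0)// -powRD ?(gt_eqF s0) ?implybT//.
by congr (_ `^ _); lra.
Qed.

Lemma powR_monotone s t q : 0 <= s -> 0 <= t -> 0 <= q ->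
  0 <= (s `^ q - t `^ q) * (s - t).
Proof.
move=> s0 t0 q0; have [st|ts] := leP s t.
  rewrite mulr_le0// ?subr_le0//.
  by apply: ge0_ler_powR; rewrite ?nnegrE.
rewrite mulr_ge0// ?subr_ge0 ?(ltW ts)//.
by apply: ge0_ler_powR; rewrite ?nnegrE// ltW.
Qed.

(** With [s], [t] the Euclidean norms, the expression exceeds [(s]^ (q - 1) - t
    [^ (q - 1)) * (s - t)] by [(a + b) * (s * t - dot x y)], where [a], [b] are the powers of order
    [q - 2]. Cauchy-Schwarz makes this excess nonnegative. *)
Lemma p_laplace_monotone x y q : 1 < q ->
  0 <= enorm x `^ (q - 2) * dot x (x - y) - enorm y `^ (q - 2) * dot y (x - y).
Proof.
move=> q1; have sx := enorm_ge0 x; have sy := enorm_ge0 y.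
have h : 0 <= (enorm x `^ (q - 1) - enorm y `^ (q - 1)) * (enorm x - enorm y).
  by apply: powR_monotone => //; rewrite subr_ge0 ltW.
apply: (le_trans h); rewrite -!mul_powRB2// !dotBr -!sqr_enorm (dotC y x).
have ds : dot x y <= enorm x * enorm y.
  exact: le_trans (ler_norm _) (dot_le_enorm x y).
have a0 := powR_ge0 (enorm x) (q - 2); have b0 := powR_ge0 (enorm y) (q - 2).
move: (enorm x `^ (q - 2)) (enorm y `^ (q - 2)) a0 b0 => a b a0 b0.
move: (enorm x) (enorm y) (dot x y) ds => s t d ds.
rewrite -subr_ge0.
have -> : a * (s ^+ 2 - d) - b * (d - t ^+ 2) - (s * a - t * b) * (s - t) =
  (a + b) * (s * t - d) by ring.
by apply: mulr_ge0; [exact: addr_ge0 | rewrite subr_ge0].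
Qed.

Lemma p_power_increasing s t q : 1 < q -> s < t ->
  `|s| `^ (q - 2) * s < `|t| `^ (q - 2) * t.
Proof.
move=> q1 st; have q0 : 0 < q - 1 by rewrite subr_gt0.
have pos r : 0 <= r -> `|r| `^ (q - 2) * r = r `^ (q - 1).
  by move=> r0; rewrite ger0_norm// mulrC mul_powRB2.
have neg r : r <= 0 -> `|r| `^ (q - 2) * r = - (- r) `^ (q - 1).
  by move=> r0; rewrite ler0_norm// -[in LHS](opprK r) mulrN opprK mulrC mul_powRB2// oppr_ge0.
have [s0|s0] := leP 0 s.
  have t0 : 0 <= t by rewrite ltW// (le_lt_trans s0).
  by rewrite !pos// gt0_ltr_powR// nnegrE.
have [t0|t0] := leP 0 t.
  rewrite (pos t)// (neg s (ltW s0)).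
  apply: (@lt_le_trans _ _ 0); last exact: powR_ge0.
  by rewrite oppr_lt0 powR_gt0// oppr_gt0.
rewrite (neg t (ltW t0)) (neg s (ltW s0)) ltrN2.
by apply: gt0_ltr_powR => //; rewrite ?nnegrE ?oppr_ge0 ?(ltW t0) ?(ltW s0) ?ltrN2.
Qed.

(** The product is bounded by the power of the larger of [s] and [t]; sharp constants are
    immaterial, as only integrability is drawn from it. *)
Lemma powR_young_le s t q : 0 <= s -> 0 <= t -> 1 < q ->
  s `^ (q - 1) * t <= s `^ q + t `^ q.
Proof.
move=> s0 t0 q1; have q0 : 0 < q by exact: lt_trans q1.
have [ts|st] := leP t s.
  apply: ler_wpDr (powR_ge0 _ _) _.
  by rewrite -(mulr_powRB1 s0 q0) mulrC ler_wpM2r ?powR_ge0.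
apply: ler_wpDl (powR_ge0 _ _) _.
rewrite -(mulr_powRB1 t0 q0) mulrC; apply: ler_wpM2l => //.
by apply: ge0_ler_powR; rewrite ?nnegrE ?subr_ge0// ltW.
Qed.

Lemma conjugate_young_le s t q : 0 <= s -> 0 <= t -> 1 < q ->
  s * t <= s `^ (q / (q - 1)) + t `^ q.
Proof.
move=> s0 t0 q1; have q0 : 0 < q by exact: lt_trans q1.
have q10 : 0 < q - 1 by rewrite subr_gt0.
have sE : (s `^ (q - 1)^-1) `^ (q - 1) = s.
  by rewrite -powRrM mulVf ?gt_eqF// powRr1.
have := powR_young_le (powR_ge0 s (q - 1)^-1) t0 q1.
by rewrite sE -powRrM [(q - 1)^-1 * q]mulrC.
Qed.

End monotonicity.

(** * Integrability of the terms in the weak formulation *)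

Section duality_integrability.
Context {R : realType} {n : nat}.
Implicit Types (f g u psi : 'rV[R]_n -> R) (F G : 'rV[R]_n -> 'rV[R]_n).
Local Notation mu := (@lebesgue_rV R n).
Variables (Om : set 'rV[R]_n) (p : 'rV[R]_n -> R) (P : R).
Hypotheses (mOm : measurable Om) (mp : measurable_fun Om p)
  (p1 : forall x, Om x -> 1 < p x) (pP : forall x, Om x -> p x <= P).
Local Notation rho := (modular Om p).

Lemma modularB_lty f g : measurable_fun Om f -> measurable_fun Om g ->
  (rho f < +oo)%E -> (rho g < +oo)%E -> (rho (fun x => f x - g x)%R < +oo)%E.
Proof.
move=> mf mg foo goo.
have mNg : measurable_fun Om (fun x => - 1 * g x) by exact: measurable_funM.
have := modularD_lty mOm mp p1 pP mf mNg foo (modularZ_lty mOm mp p1 pP (- 1) mg goo).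
by under [X in modular _ _ X]eq_fun do rewrite mulN1r.
Qed.

Lemma Sobolev_gradient u : variable_Sobolev Om p u -> exists G,
  [/\ weak_gradient Om u G, (rho u < +oo)%E & forall i, (rho (fun x => G x ord0 i) < +oo)%E].
Proof.
move=> [hu [G wG hG]]; have [_ uoo] := (variable_LebesgueP mOm mp p1 pP u).1 hu.
have [_ Goo] := (variable_LebesgueP mOm mp p1 pP (enorm \o G)).1 hG.
exists G; split; [exact: wG | exact: uoo | move=> i].
apply: le_lt_trans Goo; apply: (modular_coord_le mOm mp p1).
by move=> j; have [_ /(_ j)[[]]] := wG.
Qed.

Lemma modular_dominated_integrable (k : 'rV[R]_n -> R) f g : measurable_fun Om k ->
  measurable_fun Om f -> measurable_fun Om g -> (rho f < +oo)%E -> (rho g < +oo)%E ->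
  (forall x, Om x -> `|k x| <= `|f x| `^ p x + `|g x| `^ p x) ->
  mu.-integrable Om (EFin \o k).
Proof.
move=> mk mf mg foo goo h.
have i1 := integrable_modular mOm mp mf foo.
have i2 := integrable_modular mOm mp mg goo.
apply: (le_integrable mOm _ _ (integrableD mOm i1 i2)); first exact/measurable_EFinP.
move=> x Ox /=; rewrite lee_fin [leRHS]ger0_norm; first exact: h.
by rewrite addr_ge0 ?powR_ge0.
Qed.

Lemma measurable_p_power (c : R) f : measurable_fun Om f ->
  measurable_fun Om (fun x => `|f x| `^ (p x - c)).
Proof.
move=> mf; apply: measurable_powR_fun => //; first exact: measurableT_comp.
exact: measurable_funB.
Qed.

Lemma p_power_pairing_integrable u psi : measurable_fun Om u -> measurable_fun Om psi ->
  (rho u < +oo)%E -> (rho psi < +oo)%E ->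
  mu.-integrable Om (EFin \o (fun x => `|u x| `^ (p x - 2) * u x * psi x)).
Proof.
move=> mu_ mpsi uoo psioo; apply: (modular_dominated_integrable _ mu_ mpsi uoo psioo).
  by apply: measurable_funM => //; apply: measurable_funM => //; exact: measurable_p_power.
move=> x Ox; apply: le_trans (powR_young_le _ _ (p1 Ox)) => //.
rewrite !normrM (ger0_norm (powR_ge0 _ _)) [X in X * _]mulrC.
by rewrite mul_powRB2//; exact: p1.
Qed.

Lemma p_laplace_pairing_integrable F G :
  (forall i, measurable_fun Om (fun x => F x ord0 i)) ->
  (forall i, measurable_fun Om (fun x => G x ord0 i)) ->
  (forall i, rho (fun x => F x ord0 i) < +oo)%E ->
  (forall i, rho (fun x => G x ord0 i) < +oo)%E ->
  mu.-integrable Om (EFin \o (fun x => enorm (F x) `^ (p x - 2) * dot (F x) (G x))).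
Proof.
move=> mF mG Foo Goo.
have mnF := measurable_enorm mOm mF; have mnG := measurable_enorm mOm mG.
apply: (modular_dominated_integrable _ mnF mnG (modular_components_enorm mOm mp p1 pP mF Foo)
  (modular_components_enorm mOm mp p1 pP mG Goo)).
  apply: measurable_funM; last first.
    by apply: measurable_sum => i; exact: measurable_funM.
  have := measurable_p_power 2 mnF.
  by under eq_fun do rewrite /= ger0_norm ?enorm_ge0//.
move=> x Ox /=; rewrite !(ger0_norm (enorm_ge0 _)).
apply: le_trans (powR_young_le (enorm_ge0 _) (enorm_ge0 _) (p1 Ox)).
rewrite normrM (ger0_norm (powR_ge0 _ _)) -(mul_powRB2 (enorm_ge0 _) (p1 Ox)).
rewrite mulrAC [enorm _ * _ * _]mulrC ler_wpM2l ?powR_ge0//.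
exact: dot_le_enorm.
Qed.

Lemma conjugate_pairing_integrable f psi :
  variable_Lebesgue Om (conjugate_exponent p) f -> measurable_fun Om psi ->
  (rho psi < +oo)%E -> mu.-integrable Om (EFin \o (fun x => f x * psi x)).
Proof.
move=> [mf [l l0 foo]] mpsi psioo.
have mq : measurable_fun Om (conjugate_exponent p).
  (* On [Om], where [p x - 1 > 0], the inverse is the power [- 1], whose measurability is covered by
     [measurable_powR_fun]. *)
  apply: (eq_measurable_fun (fun x => p x * (p x - 1) `^ (- 1))).
    by move=> x /set_mem /p1 px; rewrite powR_inv1// subr_ge0 ltW.
  apply: measurable_funM => //; apply: measurable_powR_fun => //.
  exact: measurable_funB.
have mfl : measurable_fun Om (fun x => f x / l) by apply: measurable_funM => //.
have i1 := integrable_modular mOm mq mfl foo.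
have i2 := integrable_modular mOm mp (measurable_funM (measurable_cst l) mpsi) 
  (modularZ_lty mOm mp p1 pP l mpsi psioo).
apply: (le_integrable mOm _ _ (integrableD mOm i1 i2)).
  by apply/measurable_EFinP; exact: measurable_funM.
move=> x Ox /=; rewrite lee_fin [leRHS]ger0_norm; last by rewrite addr_ge0 ?powR_ge0.
(* The bound [P] concerns [p] and not its conjugate, so the scale [l] of [f] is moved to [psi],
   where [modularZ_lty] absorbs it. *)
have -> : f x * psi x = (f x / l) * (l * psi x) by rewrite mulrA divfK ?gt_eqF.
by rewrite normrM; apply: conjugate_young_le => //; exact: p1.
Qed.

End duality_integrability.

Lemma lipschitz_continuous_at (R : realType) (V : normedModType R) (D : set V)
    (f : V -> R) (L : R) : open D ->
  (forall x y, D x -> D y -> `|f x - f y| <= L * `|x - y|) ->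
  forall x, D x -> {for x, continuous f}.
Proof.
move=> oD hL x Dx.
have L0 : 0 < `|L| + 1 by rewrite ltr_wpDl.
have /nbhs_ballP[r /= r0 xrD] : nbhs x D by exact: open_nbhs_nbhs.
apply/cvgrPdist_le => /= e e0; apply/nbhs_ballP.
exists (Num.min r (e / (`|L| + 1))) => /=; first by rewrite lt_min r0 divr_gt0.
move=> y; rewrite -ball_normE /= lt_min => /andP[xyr xye].
have Dy : D y by apply: xrD; rewrite -ball_normE.
apply: (le_trans (hL x y Dx Dy)).
apply: (@le_trans _ _ ((`|L| + 1) * `|x - y|)).
  by rewrite ler_wpM2r// (le_trans (ler_norm _))// lerDl.
by rewrite mulrC -ler_pdivlMr// ltW.
Qed.

Section exponents.
Context {R : realType} {n : nat}.
Implicit Types (p : 'rV[R]_n -> R).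
Variable Om : set 'rV[R]_n.

Lemma exponent_inf_gt1 p x : (1 < exponent_inf Om p)%E -> Om x -> 1 < p x.
Proof.
move=> h Ox; rewrite -lte_fin; apply: (lt_le_trans h).
by apply: ereal_inf_lbound; exists x.
Qed.

Lemma exponent_sup_bounded p : (exponent_sup Om p < +oo)%E ->
  exists2 P : R, 2 <= P & forall x, Om x -> p x <= P.
Proof.
(* The bound is at least 2 because [mollify_cut] extends the exponent by the value 2 off [Om]. *)
move=> h; exists (Num.max 2 (fine (exponent_sup Om p))); first by rewrite le_max lexx.
move=> x Ox; rewrite le_max; apply/orP; right.
have px : ((p x)%:E <= exponent_sup Om p)%E by apply: ereal_sup_ubound; exists x.
rewrite -lee_fin fineK// fin_numElt h andbT.
by apply: lt_le_trans px; exact: ltNyr.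
Qed.

Lemma lipschitz_max_norm p : lipschitz_continuous_in Om p ->
  exists2 L : R, 0 <= L & forall x y, Om x -> Om y -> `|p x - p y| <= L * `|x - y|.
Proof.
(* The hypothesis uses the Euclidean norm and leaves the sign of [L] open; [Num.sqrt n%:R] is the
   cost of passing to the maximum norm. *)
move=> [L hL]; exists (`|L| * Num.sqrt n%:R); first by rewrite mulr_ge0.
move=> x y Ox Oy; apply: (le_trans (hL x y Ox Oy)).
rewrite -mulrA; apply: (le_trans (ler_norm _)).
rewrite normrM (ger0_norm (enorm_ge0 _)); apply: ler_wpM2l => //.
exact: enorm_le_norm.
Qed.

Lemma lipschitz_measurable p (L : R) : open Om ->
  (forall x y, Om x -> Om y -> `|p x - p y| <= L * `|x - y|) -> measurable_fun Om p.
Proof.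
move=> oOm hL; apply: (continuous_in_rV_measurable oOm).
exact: lipschitz_continuous_at hL.
Qed.

End exponents.

(** The common integral is nonnegative because of [A] and nonpositive because of [B], so the
    integral of [|B|] is 0. *)
Lemma ae_eq0_of_opposite_signs d (T : measurableType d) (R : realType)
    (mu : {measure set T -> \bar R}) (D : set T) (A B : T -> R) :
  measurable D -> mu.-integrable D (EFin \o A) -> mu.-integrable D (EFin \o B) ->
  (forall x, D x -> 0 <= A x) -> {ae mu, forall x, D x -> B x <= 0} ->
  \int[mu]_(x in D) A x = \int[mu]_(x in D) B x ->
  {ae mu, forall x, D x -> B x = 0}.
Proof.
move=> mD iA iB A0 B0 AB.
have hA : 0 <= \int[mu]_(x in D) A x by exact: Rintegral_ge0.
have mB : measurable_fun D (EFin \o B) := measurable_int _ iB.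
have I0 : (\int[mu]_(x in D) `|(B x)%:E| = 0)%E.
  apply/eqP; rewrite eq_le; apply/andP; split; last exact: integral_ge0.
  have -> : (\int[mu]_(x in D) `|(B x)%:E| = \int[mu]_(x in D) (- (B x)%:E))%E.
    apply: ae_eq_integral => //.
    - exact: measurableT_comp.
    - exact: measurableT_comp.
    apply: filterS B0 => x h Dx; have := h Dx => Bx.
    by rewrite lee0_abs ?lee_fin.
  rewrite integralN/=; last exact: integrable_add_def.
  have := integrable_fin_num mD iB => /= /fineK <-.
  by rewrite -EFinN lee_fin oppr_le0 -/(Rintegral mu D B) -AB.
have := (ae_eq_integral_abs mu mD mB).1 I0.
by apply: filterS => x h Dx; have [] := h Dx.
Qed.

Unset Implicit Arguments.

Theorem theorem2 (R : realType) (n : nat) (hn : (0 < n)%N)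
    (Om : set 'rV[R]_n) (hOm : domain Om)
    (p : 'rV[R]_n -> R) (hp : lipschitz_continuous_in Om p)
    (hp_inf : (1 < exponent_inf Om p)%E)
    (hp_sup : (exponent_sup Om p < +oo)%E)
    (a : R) (ha : a < 0)
    (u v f f' g g' : 'rV[R]_n -> R)
    (hg : variable_Sobolev Om p g) (hg' : variable_Sobolev Om p g')
    (hf : variable_Lebesgue Om (conjugate_exponent p) f)
    (hf' : variable_Lebesgue Om (conjugate_exponent p) f')
    (hu : weak_solution Om p a f u)
    (hug : variable_Sobolev0 Om p (fun x => u x - g x))
    (hv : weak_solution Om p a f' v)
    (hvg' : variable_Sobolev0 Om p (fun x => v x - g' x))
    (hff' : {ae lebesgue_rV n, forall x, Om x -> f x <= f' x})
    (hgg' : {ae lebesgue_rV n, forall x, Om x -> g x <= g' x}) :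
  {ae lebesgue_rV n, forall x, Om x -> u x <= v x}.
Proof.
have [oOm _ _] := hOm; have mOm := open_rV_measurable oOm.
have p1 x : Om x -> 1 < p x by exact: exponent_inf_gt1.
have [P P2 pP] := exponent_sup_bounded hp_sup.
have [L L0 pL] := lipschitz_max_norm hp.
have mp := lipschitz_measurable oOm pL.
have [_ weak_u] := hu; have [_ weak_v] := hv.
have [mu_ uoo] := (variable_LebesgueP mOm mp p1 pP u).1 hu.1.1.
have [mv voo] := (variable_LebesgueP mOm mp p1 pP v).1 hv.1.1.
have [Dg [wDg goo Dgoo]] := Sobolev_gradient mOm mp p1 pP hg.
have [Dg' [wDg' g'oo Dg'oo]] := Sobolev_gradient mOm mp p1 pP hg'.
have [G1 wG1 aG1] := Sobolev0_W0_approx mOm mp p1 hug.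
have [G2 wG2 aG2] := Sobolev0_W0_approx mOm mp p1 hvg'.
have [_ G1oo] := W0_approx_lty mOm mp p1 pP aG1.
have [_ G2oo] := W0_approx_lty mOm mp p1 pP aG2.
have wm w W i : weak_gradient Om w W -> measurable_fun Om (fun x => W x ord0 i).
  by move=> [_ /(_ i)[[]]].
have mw w W : weak_gradient Om w W -> measurable_fun Om w by move=> [[]].
(* The weak gradients of [u] and [v] are assembled from the same pieces as those of w and h, so that
   [Du - Dv] is literally [W + K], with no appeal to uniqueness of weak gradients. *)
pose Du x := G1 x + Dg x; pose Dv x := G2 x + Dg' x.
have wDu : weak_gradient Om u Du.
  have := weak_gradientD mOm wG1 wDg; congr weak_gradient.
  by apply/funext => x; rewrite subrK.
have wDv : weak_gradient Om v Dv.
  have := weak_gradientD mOm wG2 wDg'; congr weak_gradient.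
  by apply/funext => x; rewrite subrK.
have sum_oo w1 W1 w2 W2 i : weak_gradient Om w1 W1 -> weak_gradient Om w2 W2 ->
    (modular Om p (fun x => W1 x ord0 i) < +oo)%E ->
    (modular Om p (fun x => W2 x ord0 i) < +oo)%E ->
    (modular Om p (fun x => (W1 x + W2 x)%R ord0 i) < +oo)%E.
  move=> h1 h2 l1 l2; under [X in modular _ _ X]eq_fun do rewrite mxE.
  exact: (modularD_lty mOm mp p1 pP (wm _ _ i h1) (wm _ _ i h2) l1 l2).
have Duoo i : (modular Om p (fun x => Du x ord0 i) < +oo)%E.
  exact: sum_oo wG1 wDg (G1oo i) (Dgoo i).
have Dvoo i : (modular Om p (fun x => Dv x ord0 i) < +oo)%E.
  exact: sum_oo wG2 wDg' (G2oo i) (Dg'oo i).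
pose K x := Dg x - Dg' x.
have Koo i : (modular Om p (fun x => K x ord0 i) < +oo)%E.
  under [X in modular _ _ X]eq_fun do rewrite !mxE.
  exact: (modularB_lty mOm mp p1 pP (wm _ _ i wDg) (wm _ _ i wDg') (Dgoo i) (Dg'oo i)).
(* Here w is [(u - g) - (v - g')] and h is [g - g']; their sum is [u - v]. *)
have := truncation_W0_approx oOm mp p1 pP P2 L0 pL (W0_approxB mOm mp p1 pP aG1 aG2)
  (weak_gradientB mOm wDg wDg') (modularB_lty mOm mp p1 pP (mw _ _ wDg) (mw _ _ wDg') goo g'oo) Koo.
pose psi x := flatn 0 (u x - v x).
pose Dpsi x := flatn 1 (u x - v x) *: (Du x - Dv x).
have dE x : u x - g x - (v x - g' x) + (g x - g' x) = u x - v x by ring.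
under [X in W0_approx _ _ X]eq_fun do rewrite dE.
under [X in W0_approx _ _ _ X]eq_fun do rewrite dE addrACA -opprD.
move=> aux; have {}aux : W0_approx Om p psi Dpsi.
  by apply: aux; apply: filterS hgg' => x h Ox; rewrite subr_le0 h.
have [psioo Dpsioo] := W0_approx_lty mOm mp p1 pP aux.
have psi0 := W0_approx_Sobolev0 mOm mp p1 pP aux.
have wpsi := W0_approx_weak_gradient mOm mp p1 pP aux.
have mpsi := mw _ _ wpsi.
have EU := weak_u Du psi Dpsi wDu psi0 wpsi.
have EV := weak_v Dv psi Dpsi wDv psi0 wpsi.
have iDu := p_laplace_pairing_integrable mOm mp p1 pP (fun i => wm _ _ i wDu)
  (fun i => wm _ _ i wpsi) Duoo Dpsioo.
have iDv := p_laplace_pairing_integrable mOm mp p1 pP (fun i => wm _ _ i wDv)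
  (fun i => wm _ _ i wpsi) Dvoo Dpsioo.
have rhs w k : measurable_fun Om w -> (modular Om p w < +oo)%E ->
    variable_Lebesgue Om (conjugate_exponent p) k ->
    (lebesgue_rV n).-integrable Om
      (EFin \o (fun x => (a * `|w x| `^ (p x - 2) * w x + k x) * psi x)).
  move=> mw_ woo hk.
  have i1 := p_power_pairing_integrable mOm mp p1 mw_ mpsi woo psioo.
  have i2 := conjugate_pairing_integrable mOm mp p1 pP hk mpsi psioo.
  apply: eq_integrable (integrableD mOm (integrableZl mOm a i1) i2) => //.
  by move=> x _ /=; rewrite -EFinM -EFinD; congr EFin; ring.
have iu := rhs u f mu_ uoo hf; have iv := rhs v f' mv voo hf'.
pose A x := enorm (Du x) `^ (p x - 2) * dot (Du x) (Dpsi x) -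
  enorm (Dv x) `^ (p x - 2) * dot (Dv x) (Dpsi x).
pose B x := (a * `|u x| `^ (p x - 2) * u x + f x) * psi x -
  (a * `|v x| `^ (p x - 2) * v x + f' x) * psi x.
have A0 x : Om x -> 0 <= A x.
  move=> Ox; rewrite /A /Dpsi !dotZr.
  have := mulr_ge0 (flatn1_ge0 (u x - v x)) (p_laplace_monotone (Du x) (Dv x) (p1 x Ox)).
  by rewrite mulrBr !(mulrCA (flatn 1 _)).
have Blt x : Om x -> f x <= f' x -> v x < u x -> B x < 0.
  move=> Ox ff' vu; rewrite /B -mulrBl pmulr_llt0; last by apply: flatn0_gt0; rewrite subr_gt0.
  have h : a * (`|u x| `^ (p x - 2) * u x) < a * (`|v x| `^ (p x - 2) * v x).
    by rewrite ltr_nM2l//; apply: p_power_increasing => //; exact: p1.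
  by rewrite -!mulrA; lra.
have B0 : {ae lebesgue_rV n, forall x, Om x -> B x <= 0}.
  apply: filterS hff' => x ff' Ox; have [uv|vu] := leP (u x) (v x).
    by rewrite /B /psi (flatn_le0 0 (_ : u x - v x <= 0)) ?subr_le0// !mulr0.
  by apply/ltW/Blt => //; exact: ff'.
have AB : \int[lebesgue_rV n]_(x in Om) A x = \int[lebesgue_rV n]_(x in Om) B x.
  by rewrite !RintegralB// EU EV.
have := ae_eq0_of_opposite_signs mOm (integrableB mOm iDu iDv) (integrableB mOm iu iv) A0 B0 AB.
apply: filterS2 hff' => x ff' B_eq0 Ox.
rewrite leNgt; apply/negP => vu.
by have := Blt x Ox (ff' Ox) vu; rewrite [B x]B_eq0// ltxx.
Qed.
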